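(* Let $\Omega$ be a polyhedral domain of $\mathbb{R}^n$. Consider the vector-valued function $\Phi=\mathrm{id}+\varphi$ with $\varphi\in\mathcal{U}_0(\Omega)$. If $\min_{x\in\overline{\Omega}}J(\Phi)(x)>0$, then $\Phi$ is a bijection (one-to-one and onto) of $\Omega$.
   Context: $\mathrm{id}$ is the identity map and $J(\Phi)=\det(\nabla\Phi)$ is the Jacobian determinant. Simplex: a closed subset $\sigma\subset\mathbb{R}^n$ is a $k$-simplex if it is the convex hull of a finite set $\{x_1,\dots,x_{k+1}\}$ and is not contained in a $(k-1)$-dimensional affine subspace. For any non-empty $I\subset\{x_1,\dots,x_{k+1}\}$ the convex hull of $I$ is called a face of $\sigma$. Polyhedron: $K\subset\mathbb{R}^n$ is a bounded polyhedron if there is a finite set of $n$-simplices $\sigma_1,\dots,\sigma_\ell$ of $\mathbb{R}^n$ whose union is $K$ and such that for any $1\le i<j\le\ell$ the set $\sigma_i\cap\sigma_j$ is either empty or an entire face of both of them. Polyhedral domain: an open set $\Omega\subset\mathbb{R}^n$ is a (bounded) polyhedral domain if $\Omega$ is a connected Lipschitz domain of $\mathbb{R}^n$ and $\overline{\Omega}$ is a bounded polyhedron. $\mathcal{U}_0(\Omega)=\{\varphi\in C^1(\overline{\Omega};\mathbb{R}^n):\varphi\cdot\mathbf{n}|_{\partial\Omega}=0\}$, where $C^1(\overline{\Omega};\mathbb{R}^n)$ is the space of functions continuously differentiable up to the boundary, $\mathbf{n}$ is the outward unit normal (defined almost everywhere on $\partial\Omega$), and the boundary condition is understood almost everywhere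 on $\partial\Omega$. *)

(* Defs.v *)
From mathcomp Require Import all_boot all_order all_algebra.
From mathcomp Require Import all_classical all_reals all_analysis.
Import Order.TTheory GRing.Theory Num.Theory.
Import numFieldNormedType.Exports.

Set Implicit Arguments.
Unset Strict Implicit.
Unset Printing Implicit Defensive.

Local Open Scope classical_set_scope.
Local Open Scope ring_scope.

(* The library norm on 'rV[R]_n is the sup norm; unit vectors and diameters
   need the Euclidean one. *)
Definition dotp (R : realType) (n : nat) (u v : 'rV[R]_n) : R :=
  \sum_i u 0 i * v 0 i.

Definition enorm (R : realType) (n : nat) (u : 'rV[R]_n) : R :=
  Num.sqrt (dotp u u).

Definition boundary (T : topologicalType) (A : set T) : set T :=
  closure A `\` interior A.

Definition is_minimum (R : realType) (A : set R) (m : R) : Prop :=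
  A m /\ lbound A m.

(* Convex hull of the points v i, for i ranging over I. *)
Definition hull (R : realType) (n m : nat) (v : 'I_m -> 'rV[R]_n)
    (I : {set 'I_m}) : set 'rV[R]_n :=
  [set y | exists t : 'I_m -> R,
     [/\ forall i, 0 <= t i, \sum_(i in I) t i = 1
       & y = \sum_(i in I) t i *: v i]].

(* An affine subspace is written a + V; its dimension is that of V. *)
Definition is_simplex (R : realType) (n k : nat) (v : 'I_k.+1 -> 'rV[R]_n)
    (s : set 'rV[R]_n) : Prop :=
  s = hull v [set: 'I_k.+1]%SET /\
  forall (a : 'rV[R]_n) (V : {vspace 'rV[R]_n}), (\dim V).+1 = k ->
    ~ s `<=` [set y | y - a \in V].

Definition is_face (R : realType) (n k : nat) (v : 'I_k.+1 -> 'rV[R]_n)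
    (f : set 'rV[R]_n) : Prop :=
  exists2 I : {set 'I_k.+1}, I != finset.set0 & f = hull v I.

Definition bounded_polyhedron (R : realType) (n : nat)
    (K : set 'rV[R]_n) : Prop :=
  exists (l : nat) (s : 'I_l -> set 'rV[R]_n)
         (v : 'I_l -> 'I_n.+1 -> 'rV[R]_n),
    [/\ forall i, is_simplex (v i) (s i),
        K = \bigcup_i s i
      & forall i j : 'I_l, (i < j)%N ->
          s i `&` s j = set0 \/
          (is_face (v i) (s i `&` s j) /\ is_face (v j) (s i `&` s j))].

(* Orthogonal coordinates with vertical axis the unit vector e: the height of
   y is dotp y e, and its horizontal part is the projection on the hyperplane
   orthogonal to e, which stands for R^(n-1). *)
Definition horizontal (R : realType) (n : nat) (e y : 'rV[R]_n) : 'rV[R]_n :=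
  y - dotp y e *: e.

(* Near x, Omega is the set of points strictly above the graph of g.  Only the
   values of g on the hyperplane orthogonal to e matter. *)
Definition lipschitz_chart (R : realType) (n : nat) (Omega : set 'rV[R]_n)
    (x e : 'rV[R]_n) (g : 'rV[R]_n -> R) : Prop :=
  [/\ enorm e = 1, lipschitz g
    & \forall y \near x, Omega y <-> g (horizontal e y) < dotp y e].

Definition lipschitz_domain (R : realType) (n : nat)
    (Omega : set 'rV[R]_n) : Prop :=
  open Omega /\
  forall x, boundary Omega x -> exists e g, lipschitz_chart Omega x e g.

Definition polyhedral_domain (R : realType) (n : nat)
    (Omega : set 'rV[R]_n) : Prop :=
  [/\ connected Omega, lipschitz_domain Omega
    & bounded_polyhedron (closure Omega)].

Definition gradient (R : realType) (n : nat) (G : 'rV[R]_n -> R)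
    (x : 'rV[R]_n) : 'rV[R]_n :=
  \row_i 'D_(delta_mx 0 i) G x.

(* In a chart, Omega is locally the sublevel set of
   G y = g (horizontal e y) - dotp y e, which is differentiable at x exactly
   when g is differentiable, along the hyperplane, at the horizontal part of x.
   The normal is then (grad g - e) / sqrt (1 + |grad g|^2). *)
Definition outward_unit_normal (R : realType) (n : nat)
    (Omega : set 'rV[R]_n) (x nu : 'rV[R]_n) : Prop :=
  boundary Omega x /\
  exists (e : 'rV[R]_n) (g : 'rV[R]_n -> R),
    let G := fun y => g (horizontal e y) - dotp y e in
    [/\ lipschitz_chart Omega x e g, differentiable G x
      & nu = (enorm (gradient G x))^-1 *: gradient G x].

Definition ediam (R : realType) (n : nat) (U : set 'rV[R]_n) : \bar R :=
  ereal_sup [set (enorm (p.1 - p.2))%:E | p in U `*` U].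

(* The test makes the empty set weightless, including for s = 0, where
   non-empty sets have weight 1. *)
Definition hausdorff_gauge (R : realType) (n s : nat)
    (U : set 'rV[R]_n) : \bar R :=
  if U == set0 then 0%E else (ediam U ^+ s)%E.

Definition hausdorff_pre (R : realType) (n s : nat) (delta : R)
    (A : set 'rV[R]_n) : \bar R :=
  ereal_inf [set (\sum_(0 <= k <oo) hausdorff_gauge s (U k))%E
            | U in [set U : nat -> set 'rV[R]_n |
                    A `<=` \bigcup_k U k /\
                    forall k, (ediam (U k) <= delta%:E)%E]].

(* s-dimensional Hausdorff outer measure, without the normalising constant
   (only its null sets are used); for s = n - 1 its restriction to the boundary
   of a Lipschitz domain is, up to that constant, the surface measure. *)
Definition hausdorff (R : realType) (n s : nat)
    (A : set 'rV[R]_n) : \bar R :=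
  ereal_sup [set hausdorff_pre s delta A | delta in [set d : R | 0 < d]].

Definition ae_boundary (R : realType) (n : nat) (Omega : set 'rV[R]_n)
    (P : 'rV[R]_n -> Prop) : Prop :=
  hausdorff n.-1 (boundary Omega `&` [set x | ~ P x]) = 0%E.

(* The values of f outside the closure of Omega are irrelevant. *)
Definition C1_closure (R : realType) (n : nat) (Omega : set 'rV[R]_n)
    (f : 'rV[R]_n -> 'rV[R]_n) : Prop :=
  [/\ {within closure Omega, continuous f},
      forall x, Omega x -> differentiable f x
    & exists D : 'rV[R]_n -> 'M[R]_n,
        {within closure Omega, continuous D} /\
        forall x, Omega x -> D x = 'J f x].

(* Continuous extension to the closure of Omega of the gradient on Omega.
   'J acts on row vectors, hence is the transpose of the usual Jacobian matrix;
   the determinant is unaffected. *)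
Definition grad_closure (R : realType) (n : nat) (Omega : set 'rV[R]_n)
    (f : 'rV[R]_n -> 'rV[R]_n) (x : 'rV[R]_n) : 'M[R]_n :=
  lim ('J f y @[y --> within Omega (nbhs x)]).

Definition jacobian_det (R : realType) (n : nat) (Omega : set 'rV[R]_n)
    (f : 'rV[R]_n -> 'rV[R]_n) (x : 'rV[R]_n) : R :=
  \det (grad_closure Omega f x).

Definition U0 (R : realType) (n : nat) (Omega : set 'rV[R]_n) :
    set ('rV[R]_n -> 'rV[R]_n) :=
  [set phi | C1_closure Omega phi /\
     ae_boundary Omega (fun x =>
       forall nu, outward_unit_normal Omega x nu -> dotp (phi x) nu = 0)].

(* Main.v *)
(* Let a be the indicator function of Omega, and let the faces of Omega lie on a
   finite arrangement of hyperplanes.  Since phi is tangent to the boundary,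
   f = id + phi maps every face into its own hyperplane.  For a general chain a
   on the arrangement and a map f with this property, the sum of
   a x * sg (det D f x) over the fiber of a generic point y equals a y: both
   vanish far away, and when y crosses a hyperplane P at a point z lying on no
   other one, the sum changes by the same sum for the restriction of f to P and
   the jump of a across P, which by induction on the dimension is the jump of a
   at z.  With det D f > 0 this says that generic points of Omega have exactly
   one preimage and generic points of the complement none.  Openness of f then
   gives f Omega <= Omega and injectivity.  By compactness every point of Omega
   is the image of some point of the closure; a boundary point cannot occur, by
   the degree theorem applied in the hyperplanes of the faces. *)
From HB Require Import structures.
Require Import Defs.
From mathcomp Require Import all_boot all_order all_algebra.
From mathcomp Require Import all_classical all_reals all_analysis.
From mathcomp Require Import finmap.
From mathcomp Require Import ring lra.
Import Order.TTheory GRing.Theory Num.Theory.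
Import numFieldNormedType.Exports.

Set Implicit Arguments.
Unset Strict Implicit.
Unset Printing Implicit Defensive.

Local Open Scope classical_set_scope.
Local Open Scope ring_scope.

(** Ridges and corners of the arrangement are handled by perturbing segments: a set of codimension
    two does not separate, so it is enough to follow a count across one plane at a time. The
    obstacle is the induction. The trace of a domain on a hyperplane is no longer a domain: its
    coefficients are jumps, which carry signs, and the induced map may reverse orientation. Hence
    the induction ranges over real-valued chains and maps whose determinant is only nonzero.
    Derivatives are taken in the strict, two-point sense on a compact set, since that form passes to
    faces and still gives local inversion at the boundary. The Lipschitz condition provides it for
    maps that are C^1 up to the boundary, and it also excludes slits. The boundary condition, known
    off a null set, extends to whole faces because a disc in a hyperplane is not null. Signed counts
    may cancel, so for surjectivity the degree theorem is applied to a selection of faces having one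
    jump and one orientation, where no cancellation can occur. *)

(* Joins the completeness and the norm of matrices, for banach_fixed_point. *)
HB.instance Definition _ (R : realType) m n := Complete.on 'M[R]_(m, n).

(** * Estimates in the norm of matrices *)

Section MatrixNorm.
Variable R : realType.

Lemma near_norm (V : normedModType R) (x : V) (P : V -> Prop) :
  (\forall y \near x, P y) <->
  exists2 d : R, 0 < d & forall y, `|y - x| < d -> P y.
Proof.
split=> [/nbhs_normP[d d0 dP]|[d d0 dP]].
  by exists d => // y yx; apply: dP; rewrite /ball_ /= distrC.
by apply/nbhs_normP; exists d => // y; rewrite /ball_ /= distrC; exact: dP.
Qed.

Lemma closure_norm (V : normedModType R) (A : set V) (x : V) :
  closure A x <-> forall d : R, 0 < d -> exists2 y, A y & `|y - x| < d.
Proof.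
split=> [cA d d0|H B /near_norm[d d0 dB]].
  have [|y [Ay yx]] := cA [set y | `|y - x| < d]; last by exists y.
  by apply/near_norm; exists d.
by have [y Ay yx] := H _ d0; exists y; split=> //; exact: dB.
Qed.

Lemma open_norm (V : normedModType R) (A : set V) :
  open A <-> forall x, A x -> exists2 d : R, 0 < d & forall y, `|y - x| < d ->
    A y.
Proof.
rewrite openE; split=> H x Ax; first by apply/near_norm; exact: H.
by rewrite /interior; apply/near_norm; exact: H.
Qed.

Lemma near_ball_norm (V : normedModType R) (x0 x : V) (d : R) :
  `|x - x0| < d -> \forall y \near x, `|y - x0| < d.
Proof.
move=> xd; apply/near_norm; exists (d - `|x - x0|); first by rewrite subr_gt0.
move=> y yx; rewrite -(subrKA x) (le_lt_trans (ler_normD _ _))//; lra.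
Qed.

Lemma near_seq (T : eqType) (V : normedModType R) (x : V) (r : seq T)
    (B : T -> V -> Prop) :
  (forall t, t \in r -> \forall y \near x, B t y) ->
  \forall y \near x, forall t, t \in r -> B t y.
Proof.
elim: r => [_|t r IH H]; first by apply/near_norm; exists 1.
have /IH : forall u, u \in r -> \forall y \near x, B u y.
  by move=> u ur; apply: H; rewrite inE ur orbT.
have : \forall y \near x, B t y by apply: H; rewrite inE eqxx.
by apply: filterS2 => y Bt Br u; rewrite inE => /orP[/eqP->|/Br].
Qed.

Lemma normr_entry m n (A : 'M[R]_(m, n)) i j : `|A i j| <= `|A|.
Proof.
rewrite [leRHS]/Num.Def.normr/= mx_normrE.
exact: (le_bigmax _ (fun ij => `|A ij.1 ij.2|) (i, j)).
Qed.

Lemma normr_mx_le m n (A : 'M[R]_(m, n)) e :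
  0 <= e -> (forall i j, `|A i j| <= e) -> `|A| <= e.
Proof.
move=> e0 H; rewrite [leLHS]/Num.Def.normr/= mx_normrE (bigmax_le _ e0)//=.
Qed.

Lemma normr_mulmx m n p (A : 'M[R]_(m, n)) (B : 'M[R]_(n, p)) :
  `|A *m B| <= n%:R * `|A| * `|B|.
Proof.
apply: normr_mx_le => [|i j]; first by rewrite !mulr_ge0.
rewrite mxE (le_trans (ler_norm_sum _ _ _))//.
rewrite (@le_trans _ _ (\sum_(k < n) `|A| * `|B|))//.
  by apply: ler_sum => k _; rewrite normrM ler_pM// normr_entry.
by rewrite sumr_const card_ord -mulrA mulr_natl.
Qed.

Lemma mulmx_lipschitz n p (B : 'M[R]_(n, p)) :
  exists2 C : R, 0 < C & forall m (A : 'M[R]_(m, n)), `|A *m B| <= C * `|A|.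
Proof.
exists (n%:R * `|B| + 1) => [|m A]; first by rewrite ltr_pwDr// mulr_ge0.
rewrite (le_trans (normr_mulmx _ _))// mulrDl mul1r -mulrA (mulrC `|A|) mulrA.
by rewrite lerDl.
Qed.

Lemma det_continuous n : continuous (fun B : 'M[R]_n => \det B).
Proof.
move=> A; pose C (F : 'M[R]_n -> R) := continuous_at A F.
have Csum (I : Type) (r : seq I) (F : I -> 'M[R]_n -> R) :
    (forall i, C (F i)) -> C (fun B => \sum_(i <- r) F i B).
  move=> CF; elim: r => [|i r IH]; rewrite /C.
    by under eq_fun do rewrite big_nil; exact: cst_continuous.
  by under eq_fun do rewrite big_cons; exact: continuousD (CF i) IH.
have Cprod (I : Type) (r : seq I) (F : I -> 'M[R]_n -> R) :
    (forall i, C (F i)) -> C (fun B => \prod_(i <- r) F i B).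
  move=> CF; elim: r => [|i r IH]; rewrite /C.
    by under eq_fun do rewrite big_nil; exact: cst_continuous.
  by under eq_fun do rewrite big_cons; exact: continuousM (CF i) IH.
have Cmul c F : C F -> C (fun B => c * F B).
  by move=> CF; apply: continuousM CF; exact: cst_continuous.
apply: Csum => s; apply: Cmul.
by apply: Cprod => i; exact: coord_continuous.
Qed.

End MatrixNorm.

(** * Hyperplane arrangements *)

Section Arrangement.
Variables (R : realType) (n : nat).
Implicit Types (P Q : 'cV[R]_n * R) (s : seq ('cV[R]_n * R)) (x y : 'rV[R]_n).

Definition alt P x : R := (x *m P.1) 0 0 - P.2.

Definition plane P : set 'rV[R]_n := [set x | alt P x = 0].

Definition proper s := forall P, P \in s -> P.1 != 0.

Definition generic s x := forall P, P \in s -> alt P x != 0.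

(** Planes are compared as sets, because an arrangement may list one hyperplane under several
    proportional equations. A simple point thus lies on at most one geometric hyperplane. *)
Definition simple s x := forall P Q, P \in s -> Q \in s ->
  alt P x = 0 -> alt Q x = 0 -> plane P = plane Q.

Lemma altD P x y : alt P (x + y) = alt P x + (y *m P.1) 0 0.
Proof. by rewrite /alt mulmxDl mxE; lra. Qed.

Lemma altB P x y : alt P x - alt P y = ((x - y) *m P.1) 0 0.
Proof. by rewrite -{1}(subrK y x) [x - y + y]addrC altD addrAC subrr add0r. Qed.

Lemma alt_lipschitz P :
  exists2 C : R, 0 < C & forall x y, `|alt P x - alt P y| <= C * `|x - y|.
Proof.
have [C C0 HC] := mulmx_lipschitz P.1; exists C => // x y.
by rewrite altB (le_trans (normr_entry _ _ _)).
Qed.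

Lemma alt_segment P x y t :
  alt P (x + t *: (y - x)) = (1 - t) * alt P x + t * alt P y.
Proof.
rewrite altD -scalemxAl mxE -altB; ring.
Qed.

Lemma near_alt_pos P x (t : R) : 0 < t * alt P x ->
  \forall y \near x, 0 < t * alt P y.
Proof.
move=> Px; have [C C0 HC] := alt_lipschitz P.
have t0 : 0 < `|t|.
  by rewrite normr_gt0; apply: contraTneq Px => ->; rewrite mul0r ltxx.
apply/near_norm; exists (t * alt P x / (`|t| * C)).
  by apply: divr_gt0 => //; exact: mulr_gt0.
move=> y; rewrite ltr_pdivlMr; last exact: mulr_gt0; move=> yx.
have : `|t * alt P y - t * alt P x| < t * alt P x.
  rewrite -mulrBr normrM (le_lt_trans _ yx)// mulrC (mulrC `|y - x|) -mulrA.
  by rewrite mulrC ler_pM2l.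
by rewrite ltr_norml => /andP[+ _]; lra.
Qed.

Lemma near_alt_neq P x : alt P x != 0 -> \forall y \near x, alt P y != 0.
Proof.
move=> Px.
have : 0 < alt P x * alt P x by rewrite -expr2 exprn_even_gt0.
move=> /near_alt_pos; apply: filterS => y; apply: contraTneq => ->.
by rewrite mulr0 ltxx.
Qed.

Lemma near_generic s x : generic s x -> \forall y \near x, generic s y.
Proof.
by move=> gx; apply: near_seq => P /gx /near_alt_neq.
Qed.

(** A move along the normal [P.1^T] changes the height by a positive multiple of the squared length
    of that normal. *)
Lemma alt_perturb P x (d : R) : P.1 != 0 -> 0 < d ->
  exists2 y, `|y - x| < d & alt P y != 0.
Proof.
move=> P0 d0; have [Px|Px] := eqVneq (alt P x) 0; last first.
  by exists x => //; rewrite subrr normr0.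
have N0 : 0 < `|P.1| + 1 by rewrite ltr_pwDr.
have v0 : 0 < `|P.1^T| + 1 by rewrite ltr_pwDr.
pose t := d / 2 / (`|P.1^T| + 1).
have t0 : 0 < t by rewrite !divr_gt0.
exists (x + t *: P.1^T).
  rewrite addrC addKr normrZ gtr0_norm// /t mulrAC ltr_pdivrMr//.
  have := normr_ge0 P.1^T; nra.
rewrite altD Px add0r -scalemxAl mxE mulf_neq0 ?gt_eqF//.
have [i Pi] : exists i, P.1 i 0 != 0.
  apply/existsP; apply: contraNT P0 => /existsPn H; apply/eqP/matrixP => i j.
  by rewrite ord1 mxE; apply/eqP; rewrite -[_ == _]negbK H.
rewrite mxE (bigD1 i)//= mxE; apply: ltr_pwDl; last first.
  by apply: sumr_ge0 => k _; rewrite mxE -expr2 sqr_ge0.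
by rewrite -expr2 exprn_even_gt0.
Qed.

(** Leaving one more plane takes an arbitrarily small move, and being off the other planes is an
    open condition. *)
Lemma generic_dense s x (d : R) : proper s -> 0 < d ->
  exists2 y, `|y - x| < d & generic s y.
Proof.
move=> + d0; elim: s => [_|P s IH ps]; first by exists x;
  rewrite ?subrr ?normr0.
have [|y yx gy] := IH; first by move=> Q Qs; apply: ps; rewrite inE Qs orbT.
have /near_norm[e e0 He] := near_generic gy.
have P0 : P.1 != 0 by apply: ps; rewrite inE eqxx.
have m0 : 0 < Num.min e (d - `|y - x|) by rewrite lt_min e0 subr_gt0.
have [z zy Pz] := @alt_perturb P y _ P0 m0.
move: zy; rewrite lt_min => /andP[ze zd]; exists z.
  rewrite -(subrK y z) -addrA (le_lt_trans (ler_normD _ _))//; lra.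
by move=> Q; rewrite inE => /orP[/eqP->//|]; exact: He.
Qed.

Lemma generic_simple s x : generic s x -> simple s x.
Proof. by move=> gx P Q /gx /eqP. Qed.

(* The set of ends y such that the segment [x, y] meets two distinct planes of
   s at the same point is a union of hyperplanes through x. *)
Lemma simple_segment s x y (d : R) : proper s -> generic s x -> 0 < d ->
  exists2 z, `|z - y| < d & forall t, simple s (x + t *: (z - x)).
Proof.
move=> ps gx d0.
(* The affine function [alt P x * alt Q - alt Q x * alt P] vanishes at [x] and wherever [P] and [Q]
   meet; [nrm P Q] is its normal. If this is 0, the two equations are proportional and the planes
   coincide. *)
pose nrm P Q := alt P x *: Q.1 - alt Q x *: P.1.
pose r := [seq PQ <- [seq (P, Q) | P <- s, Q <- s] | nrm PQ.1 PQ.2 != 0].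
pose hp (PQ : ('cV[R]_n * R) * ('cV[R]_n * R)) :=
  (nrm PQ.1 PQ.2, (x *m nrm PQ.1 PQ.2) 0 0).
have [|z zy gz] := @generic_dense [seq hp PQ | PQ <- r] y d _ d0.
  by move=> P /mapP[PQ]; rewrite mem_filter => /andP[+ _] ->.
exists z => // t P Q Ps Qs HP HQ.
have Px := gx _ Ps; have Qx := gx _ Qs.
have [nz|nz] := eqVneq (nrm P Q) 0; last first.
  have /gz/eqP[] : hp (P, Q) \in [seq hp PQ | PQ <- r].
    by apply: map_f; rewrite mem_filter nz /=; apply: allpairs_f.
  rewrite /alt /= -[_ - _]/(((z *m nrm P Q) 0 0) - _).
  have -> : (z *m nrm P Q) 0 0 - (x *m nrm P Q) 0 0
     = alt P x * (alt Q z - alt Q x) - alt Q x * (alt P z - alt P x).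
    rewrite !altB /nrm !mulmxBr -!scalemxAr !mulmxBl !mxE; ring.
  move: HP HQ; rewrite !alt_segment => HP HQ.
  have t0 : t != 0.
    by apply: contra_neq Px => t0; move: HP; rewrite t0; lra.
  have HP' : t * (alt P z - alt P x) = - alt P x by lra.
  have HQ' : t * (alt Q z - alt Q x) = - alt Q x by lra.
  apply: (mulfI t0); rewrite mulr0 mulrBr !(mulrCA t) HP' HQ'; ring.
have E : alt P x *: Q.1 = alt Q x *: P.1 by apply/eqP;
  rewrite -subr_eq0 -/(nrm P Q) nz.
have H w : alt P x * alt Q w = alt Q x * alt P w.
  rewrite -(subrK (alt Q x) (alt Q w)) -[in RHS](subrK (alt P x) (alt P w)).
  have := congr1 (fun M => ((w - x) *m M) 0 0) E.
  by rewrite -!scalemxAr [in LHS]mxE [in RHS]mxE -!altB => ?; lra.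
apply/seteqP; split=> w; rewrite /plane /= => Hw; have := H w.
  by rewrite Hw mulr0 => /eqP; rewrite mulf_eq0 (negPf Px) => /eqP.
by rewrite Hw mulr0 => /esym/eqP; rewrite mulf_eq0 (negPf Qx) => /eqP.
Qed.

(** The essential value of [h] at [x]: values on the planes themselves are ignored. *)
Definition essconst s (h : 'rV[R]_n -> R) x v :=
  \forall y \near x, generic s y -> h y = v.

Lemma essconst_uniq s h x v w : proper s ->
  essconst s h x v -> essconst s h x w -> v = w.
Proof.
move=> ps /near_norm[d d0 Hd] /near_norm[e e0 He].
have m0 : 0 < Num.min d e by rewrite lt_min d0.
have [y] := @generic_dense s x _ ps m0.
by rewrite lt_min => /andP[yd ye] gy; rewrite -(Hd y)// (He y).
Qed.

(** Such a function has derivative 0 everywhere. *)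
Lemma locally_constant_segment (w : R -> R) :
  (forall t, \forall u \near t, w u = w t) -> w 0 = w 1.
Proof.
move=> H; apply: is_derive_0_is_cst => t.
have E : \forall u \near t, cst (w t) u = w u by apply: filterS (H t) => u ->.
exact: near_eq_is_derive E (is_derive_cst _ _ _).
Qed.

(** Extends a path parametrised by the unit interval to the whole line, as
    [locally_constant_segment] demands. *)
Definition clamp01 (t : R) : R := Num.max 0 (Num.min 1 t).

Lemma clamp01_lip t u : `|clamp01 t - clamp01 u| <= `|t - u|.
Proof.
have tu := ler_norm (t - u); have ut := ler_norm (u - t).
rewrite distrC in ut; rewrite /clamp01 ler_norml.
by case: (leP 1 t) => ?; case: (leP 1 u) => ?; rewrite ?(max_r ler01);
  try case: (leP 0 t) => ?; try case: (leP 0 u) => ?; apply/andP; split; lra.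
Qed.

Lemma clamp01_itv t : 0 <= clamp01 t <= 1.
Proof.
by rewrite /clamp01 le_max lexx /= ge_max ler01 /= ge_min lexx.
Qed.

(** The segment from [x] to [y] may cross points common to several planes. Replacing [y] by a nearby
    [z] avoids them by [simple_segment]; along the new segment the essential value is locally
    constant. *)
Lemma essconst_convex s h (U : set 'rV[R]_n) : proper s ->
  (forall x, U x -> \forall y \near x, U y) ->
  (forall x y t, U x -> U y -> 0 <= t <= 1 -> U (x + t *: (y - x))) ->
  (forall x, U x -> simple s x -> exists v, essconst s h x v) ->
  forall x y, U x -> U y -> generic s x -> generic s y -> h x = h y.
Proof.
move=> ps oU cU H x y Ux Uy gx gy.
have eg z : U z -> generic s z -> essconst s h z (h z).
  move=> Uz gz; have [v Hv] := H z Uz (generic_simple gz).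
  by rewrite (_ : h z = v)//; exact: (nbhs_singleton Hv).
have /near_norm[d d0 Hd] :
    \forall z \near y, U z /\ generic s z /\ (generic s z -> h z = h y).
  near=> z; split; first by near: z; exact: oU.
  by split; near: z; [exact: near_generic|exact: eg].
have [z zy sz] := @simple_segment s x y d ps gx d0.
have [Uz [gz /(_ gz)<-]] := Hd z zy.
pose g t := x + clamp01 t *: (z - x).
have Ug t : U (g t) by apply: cU => //; exact: clamp01_itv.
have [w Hw] : exists w, forall t, essconst s h (g t) (w t).
  by have /choice[w Hw] := fun t => H (g t) (Ug t) (sz _); exists w.
have g0 : g 0 = x by rewrite /g /clamp01 min_r// maxxx scale0r addr0.
have g1 : g 1 = z by rewrite /g /clamp01 minxx max_r// scale1r addrC subrK.
have w0 : w 0 = h x.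
  by apply: (essconst_uniq ps (Hw 0)); rewrite g0; exact: eg.
have w1 : w 1 = h z.
  by apply: (essconst_uniq ps (Hw 1)); rewrite g1; exact: eg.
rewrite -w0 -w1; apply: locally_constant_segment => t.
have /near_norm[e e0 He] := Hw t.
have N0 : 0 < `|z - x| + 1 by rewrite ltr_pwDr.
apply/near_norm; exists (e / (`|z - x| + 1)); first by rewrite divr_gt0.
move=> u; rewrite ltr_pdivlMr// => ut.
apply: (essconst_uniq ps (Hw u)).
have gd : `|g u - g t| < e.
  rewrite /g opprD addrACA subrr add0r -scalerBl normrZ (le_lt_trans _ ut)//.
  rewrite (@le_trans _ _ (`|u - t| * `|z - x|))//.
    by rewrite ler_wpM2r// clamp01_lip.
  by rewrite ler_wpM2l// lerDl.
apply/near_norm; exists (e - `|g u - g t|); first by rewrite subr_gt0.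
move=> v Hv; apply: He; rewrite -(subrK (g u) v) -addrA.
by rewrite (le_lt_trans (ler_normD _ _))//; lra.
Unshelve. all: by end_near. Qed.

End Arrangement.

(** * Strict differentiability *)

Section StrictDiff.
Variables (R : realType) (n : nat).
Implicit Types (K : set 'rV[R]_n) (f : 'rV[R]_n -> 'rV[R]_n).

(** Strict differentiability relative to [K]. Unlike differentiability at one point, it yields local
    injectivity on [K], even where [K] has no interior, and it is inherited by sections of [K]. *)
Definition sdiff K f (D : 'rV[R]_n -> 'M[R]_n) :=
  forall x, K x -> forall e, 0 < e -> exists2 d, 0 < d & forall p q,
    K p -> K q -> `|p - x| < d -> `|q - x| < d ->
    `|f p - f q - (p - q) *m D x| <= e * `|p - q|.

(** With [C] bounding multiplication by the inverse of [A], the choice [e = 1 / (2 C)] gives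
    [|p - q| <= |p - q| / 2] whenever [f p = f q]. *)
Lemma nearly_linear_inj (A : 'M[R]_n) : A \in unitmx ->
  exists2 e : R, 0 < e & forall f p q,
    `|f p - f q - (p - q) *m A| <= e * `|p - q| -> f p = f q -> p = q.
Proof.
move=> uA; have [C C0 HC] := mulmx_lipschitz (invmx A).
exists (2 * C)^-1; first by rewrite invr_gt0 mulr_gt0.
move=> f p q + fpq; rewrite fpq subrr sub0r normrN => H.
have := HC _ ((p - q) *m A); rewrite mulmxK// => H1.
apply/eqP; rewrite -subr_eq0 -normr_le0.
have : `|p - q| <= `|p - q| / 2.
  apply: (le_trans H1); apply: (@le_trans _ _ (C * ((2 * C)^-1 * `|p - q|))).
    by rewrite ler_pM2l.
  by rewrite invfM mulrA mulrCA mulfV ?gt_eqF// mulr1 mulrC.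
lra.
Qed.

(* Contraction principle applied to p |-> p + (y - f p) A^-1. *)
Lemma nearly_linear_onto (A : 'M[R]_n) : A \in unitmx ->
  exists2 e : R, 0 < e & exists2 C : R, 0 < C & forall f x d,
    (forall p q, `|p - x| < d -> `|q - x| < d ->
      `|f p - f q - (p - q) *m A| <= e * `|p - q|) ->
    forall r y, 0 < r -> r < d -> `|y - f x| <= C * r ->
    exists2 p, `|p - x| <= r & f p = y.
Proof.
move=> uA; have [C C0 HC] := mulmx_lipschitz (invmx A).
exists (2 * C)^-1; first by rewrite invr_gt0 mulr_gt0.
exists (2 * C)^-1; first by rewrite invr_gt0 mulr_gt0.
move=> f x d H r y r0 rd yx.
pose T p := p + (y - f p) *m invmx A.
pose U := [set p | `|p - x| <= r].
have Ud p : U p -> `|p - x| < d by move=> /le_lt_trans; exact.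
have Tc p q : U p -> U q -> `|T p - T q| <= 1 / 2 * `|p - q|.
  move=> Up Uq; have -> : T p - T q = - ((f p - f q - (p - q) *m A) *m invmx A).
    rewrite /T [in RHS]mulmxBl mulmxK// !mulmxBl.
    move: (y *m _) (f p *m _) (f q *m _) => a b c.
    by apply/matrixP => i j; rewrite !mxE; ring.
  rewrite normrN (le_trans (HC _ _))//.
  apply: (@le_trans _ _ (C * ((2 * C)^-1 * `|p - q|))).
    by rewrite ler_pM2l// H//; exact: Ud.
  by rewrite invfM mulrA mulrCA mulfV ?gt_eqF// mulr1 div1r.
have Ux : U x by rewrite /U /= subrr normr0 ltW.
have TU : set_fun U U T.
  move=> p Up; rewrite /U /= -(subrKA (T x)) (le_trans (ler_normD _ _))//.
  have : `|T x - x| <= r / 2.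
    rewrite /T addrC addKr (le_trans (HC _ _))//.
    apply: (@le_trans _ _ (C * ((2 * C)^-1 * r))).
      by rewrite ler_pM2l.
    by rewrite invfM mulrA mulrCA mulfV ?gt_eqF// mulr1 mulrC.
  have := Tc _ _ Up Ux; have : `|p - x| <= r by [].
  lra.
have [|||p Up Tp] := @banach_fixed_point R 'rV[R]_n U (mkfun TU).
- have h0 : 0 <= 1 / 2 :> R by lra.
  exists (NngNum h0); split => /=; first by lra.
  by case=> p q [/= Up Uq]; exact: Tc.
- rewrite (_ : U = closed_ball_ Num.norm x r).
    exact: closed_closed_ball_.
  by apply/seteqP; split=> p; rewrite /U /closed_ball_ /= distrC.
- by exists x.
exists p => //; move/eqP: Tp; rewrite /= /T -subr_eq0 opprD addNKr oppr_eq0.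
move=> /eqP/(congr1 (mulmx^~ A)); rewrite mulmxKV// mul0mx => /eqP.
by rewrite subr_eq0 => /eqP.
Qed.

Lemma sdiff_inj K f D x : sdiff K f D -> K x -> \det (D x) != 0 ->
  exists2 d, 0 < d & forall p q, K p -> K q -> `|p - x| < d -> `|q - x| < d ->
    f p = f q -> p = q.
Proof.
move=> sd Kx; rewrite -unitfE -unitmxE => /nearly_linear_inj[e e0 He].
have [d d0 Hd] := sd _ Kx _ e0; exists d => // p q Kp Kq px qx.
by apply: He; exact: Hd.
Qed.

Lemma sdiff_lip K f D x : sdiff K f D -> K x ->
  exists2 C, 0 < C & exists2 d, 0 < d & forall p, K p -> `|p - x| < d ->
    `|f p - f x| <= C * `|p - x|.
Proof.
move=> sd Kx; have [C C0 HC] := mulmx_lipschitz (D x).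
have [d d0 Hd] := sd _ Kx _ ltr01.
exists (1 + C); first by rewrite addr_gt0.
exists d => // p Kp px.
have := Hd p x Kp Kx px; rewrite subrr normr0 => /(_ d0).
have := HC _ (p - x); have :=
  ler_normD (f p - f x - (p - x) *m D x) ((p - x) *m D x).
rewrite subrK; lra.
Qed.

Lemma sdiff_cts K f D x : sdiff K f D -> K x -> forall e, 0 < e ->
  exists2 d, 0 < d & forall p, K p -> `|p - x| < d -> `|f p - f x| < e.
Proof.
move=> sd Kx e e0; have [C C0 [d d0 Hd]] := sdiff_lip sd Kx.
exists (Num.min d (e / C)); first by rewrite lt_min d0 divr_gt0.
move=> p Kp; rewrite lt_min => /andP[pd pe].
by rewrite (le_lt_trans (Hd _ Kp pd))// mulrC -ltr_pdivlMr.
Qed.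

Lemma sdiff_within K f D : sdiff K f D -> {within K, continuous f}.
Proof.
move=> sd; apply/subspace_continuousP => x Kx; apply/cvgrPdist_lt => e e0.
have [d d0 Hd] := sdiff_cts sd Kx e0.
have : \forall p \near x, `|p - x| < d by apply/near_norm; exists d.
by apply: filterS => p px Kp; rewrite distrC; exact: Hd.
Qed.

End StrictDiff.

(** * Fibers over a compact set *)

Section Fibers.
Variables (R : realType) (n : nat) (K : set 'rV[R]_n).
Variables (f : 'rV[R]_n -> 'rV[R]_n) (D : 'rV[R]_n -> 'M[R]_n).
Hypotheses (cK : compact K) (sd : sdiff K f D).
Hypothesis Dunit : forall x, K x -> \det (D x) != 0.

Lemma fiber_compact (L : set 'rV[R]_n) z : closed L ->
  (forall x, K x -> L x -> f x <> z) ->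
  exists2 d, 0 < d & forall x, K x -> L x -> d <= `|f x - z|.
Proof.
move=> cL H.
have cKL : compact (K `&` L) by exact: compact_closedI.
have cf : compact (f @` (K `&` L)).
  apply: continuous_compact => //.
  by apply: continuous_subspaceW (sdiff_within sd) => x [].
have /closed_openC o : closed (f @` (K `&` L)).
  by apply: compact_closed => //; exact: norm_hausdorff.
have : nbhs z (~` (f @` (K `&` L))).
  by apply: open_nbhs_nbhs; split=> // -[x [Kx Lx]]; exact: H.
move=> /near_norm[d d0 Hd]; exists d => // x Kx Lx; rewrite leNgt.
by apply/negP => /Hd; apply; exists x.
Qed.

(** The fiber is compact, and by [sdiff_inj] each of its points is isolated. *)
Lemma fiber_finite z : finite_set [set x | K x /\ f x = z].
Proof.
pose F := [set x | K x /\ f x = z].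
have cF : compact F.
  rewrite (_ : F = K `&` [set x | K x -> f x = z]); last first.
    by apply/seteqP; split=> x [] Kx Hx; split=> //; exact: Hx.
  suff /(compact_closedI cK) : closed F.
    congr compact; apply/seteqP; split=> x [Kx] Fx; split=> //.
      by move=> _; case: Fx.
    by split=> //; exact: Fx.
  have clK : closed K by apply: compact_closed => //; exact: norm_hausdorff.
  move=> x cx; have Kx : K x.
    by apply: clK; move=> B /cx[y [[Ky _] By]]; exists y.
  split=> //; apply/eqP; rewrite -subr_eq0 -normr_le0; apply/ler_addgt0Pl =>
    e e0.
  have [d d0 Hd] := sdiff_cts sd Kx e0.
  have /closure_norm/(_ _ d0)[y [Ky <-] yx] := cx.
  by rewrite addr0 distrC ltW// Hd.
have := cF; rewrite compact_cover.
have /choice[d Hd] : forall x, exists d, F x -> 0 < d /\ forall p q, K p ->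
  K q ->
    `|p - x| < d -> `|q - x| < d -> f p = f q -> p = q.
  move=> x; case: (pselect (F x)) => [[Kx _]|]; last by exists 0.
  by have [d d0 Hd] := sdiff_inj sd Kx (Dunit Kx); exists d.
move=> /(_ _ F (fun x => [set y | F x /\ `|y - x| < d x]))[].
- move=> x Fx; apply/open_norm => y [_ yx].
  exists (d x - `|y - x|); first by rewrite subr_gt0.
  move=> u uy; split=> //; rewrite -(subrKA y) (le_lt_trans (ler_normD _ _))//.
  lra.
- by move=> x Fx; exists x => //; split=> //; rewrite subrr normr0;
    case: (Hd _ Fx).
move=> S SF SC; apply: sub_finite_set (finite_fset S) => y Fy.
have [x xS [Fx yx]] := SC _ Fy; have [d0 H] := Hd _ Fx.
suff -> : y = x by [].
case: Fx Fy => Kx fx [Ky fy]; apply: H => //; last by rewrite fx fy.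
by rewrite subrr normr0.
Qed.

(** Apply [fiber_compact] to the complement of the balls around the fiber. This ensures that no
    preimage of a point near [z] escapes the local sheets. *)
Lemma fiber_near z r : 0 < r ->
  exists2 d, 0 < d & forall x, K x -> `|f x - z| < d ->
    exists2 x0, K x0 /\ f x0 = z & `|x - x0| < r.
Proof.
move=> r0; pose L := [set x | forall x0, K x0 /\ f x0 = z -> r <= `|x - x0|].
have cL : closed L.
  move=> x /closure_norm cx x0 Hx0; rewrite leNgt; apply/negP => xr.
  have [y Ly yx] := cx (r - `|x - x0|) ltac:(by rewrite subr_gt0).
  have := Ly _ Hx0; rewrite leNgt => /negP; apply.
  rewrite -(subrKA x) (le_lt_trans (ler_normD _ _))//; lra.
have [|d d0 Hd] := @fiber_compact L z cL.
  by move=> x Kx Lx fx; have := Lx x (conj Kx fx);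
    rewrite subrr normr0 leNgt r0.
exists d => // x Kx fxz; apply: contrapT => H.
have : d <= `|f x - z|.
  apply: Hd => // x0 Hx0; rewrite leNgt; apply/negP => ?; apply: H.
  by exists x0.
by rewrite leNgt fxz.
Qed.

End Fibers.

(** * Chains and their faces *)

Section Chains.
Variables (R : realType) (n : nat).
Implicit Types (P Q : 'cV[R]_n * R) (s : seq ('cV[R]_n * R)) (x y : 'rV[R]_n).
Implicit Types (a : 'rV[R]_n -> R).

Definition csupp a := closure [set x | a x != 0].

Definition locconst a x := \forall y \near x, a y = a x.

(* A chain assigns a coefficient to each open cell of the arrangement s.  Its
   values on the planes only matter through tc_regular, which makes a locally
   constant at every point whose neighbouring cells carry the same value: the
   points where a is not locally constant form the boundary of the chain. *)
Record tangent_chain s a (f : 'rV[R]_n -> 'rV[R]_n) (D : 'rV[R]_n -> 'M[R]_n)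
    : Prop := TangentChain {
  tc_proper : proper s;
  tc_generic : forall x, generic s x -> locconst a x;
  tc_regular : forall x v, essconst s a x v -> a x = v;
  tc_bounded : exists M : R, forall x, a x != 0 -> `|x| <= M;
  tc_sdiff : sdiff (csupp a) f D;
  tc_cts : forall x, csupp a x -> forall e : R, 0 < e ->
    exists2 d : R, 0 < d & forall y, csupp a y -> `|y - x| < d ->
      `|D y - D x| < e;
  tc_det : forall x, csupp a x -> \det (D x) != 0;
  tc_tangent : forall x P, P \in s -> simple s x -> alt P x = 0 ->
    ~ locconst a x -> alt P (f x) = 0 }.

Lemma ball_convex (x0 : 'rV[R]_n) (d : R) x y t : 0 <= t <= 1 ->
  `|x - x0| < d -> `|y - x0| < d -> `|x + t *: (y - x) - x0| < d.
Proof.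
move=> /andP[t0 t1] xd yd.
have -> : x + t *: (y - x) - x0 = (1 - t) *: (x - x0) + t *: (y - x0).
  by apply/matrixP => i j; rewrite !mxE; ring.
rewrite (le_lt_trans (ler_normD _ _))// !normrZ ger0_norm ?subr_ge0//
  ger0_norm//.
have [->|tn] := eqVneq t 0; first lra.
have : 0 < t by rewrite lt_neqAle eq_sym tn.
by nra.
Qed.

Lemma locconst_open a x : locconst a x -> \forall y \near x, locconst a y.
Proof.
move=> /near_norm[d d0 Hd]; apply/near_norm; exists d => // y yx.
apply/near_norm; exists (d - `|y - x|); first by rewrite subr_gt0.
move=> z zy; rewrite (Hd y)// (Hd z)// -(subrKA y) (le_lt_trans (ler_normD _
  _))//.
lra.
Qed.

Lemma csupp_supp a x : a x != 0 -> csupp a x.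
Proof. by move=> ax; apply: subset_closure. Qed.

Lemma csupp_out a x : ~ csupp a x -> locconst a x /\ a x = 0.
Proof.
move=> nx.
have ax y : ~ csupp a y -> a y = 0.
  by move=> ny; apply: contrapT => /eqP /csupp_supp.
split; last exact: ax.
have /open_norm/(_ x nx)[d d0 Hd] : open (~` csupp a).
  by apply: closed_openC; exact: closed_closure.
by apply/near_norm; exists d => // y yx; rewrite (ax x nx); apply: ax;
  exact: Hd.
Qed.

Lemma nonlc_csupp a x : ~ locconst a x -> csupp a x.
Proof. by move=> H; apply: contrapT => /csupp_out[]. Qed.

(** The closed face carried by [P]: it keeps the part of [P] where the chain really has a boundary,
    and drops the places where [P] merely passes through a cell. *)
Definition acc s a P : set 'rV[R]_n :=
  closure [set y | [/\ simple s y, alt P y = 0 & ~ locconst a y]].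

Lemma alt_closed P (A : set 'rV[R]_n) x : closure A x ->
  (forall y, A y -> alt P y = 0) -> alt P x = 0.
Proof.
move=> cx HA; apply: contrapT => /eqP /near_alt_neq/near_norm[d d0 Hd].
by move/closure_norm: cx => /(_ d d0)[y Ay /Hd]; rewrite HA// eqxx.
Qed.

Lemma open_near_closureC (A : set 'rV[R]_n) x : ~ closure A x ->
  \forall y \near x, ~ closure A y.
Proof.
move=> nA; have /open_norm/(_ x nA)[d d0 Hd] : open (~` closure A).
  by apply: closed_openC; exact: closed_closure.
by apply/near_norm; exists d.
Qed.

Lemma sg_det_near A : \det A != 0 -> exists2 e : R, 0 < e &
  forall B : 'M[R]_n, `|B - A| < e -> Num.sg (\det B) = Num.sg (\det A).
Proof.
move=> A0; have : {for A, continuous (fun B : 'M[R]_n => \det B)}.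
  by exact: det_continuous.
move=> /cvgrPdist_lt/(_ `|\det A|); rewrite normr_gt0 => /(_ A0).
move=> /near_norm[e e0 He]; exists e => // B /He; move: A0.
case: (ltrgt0P (\det A)) => // dA _.
  rewrite ltr_norml => /andP[_ ?]; rewrite !gtr0_sg//; lra.
rewrite ltr_norml => /andP[? _]; rewrite !ltr0_sg//; lra.
Qed.

Lemma neqN1 : -1 != 0 :> R. Proof. by rewrite oppr_eq0 oner_neq0. Qed.

(** If a small perturbation lands on the wrong side of [P], its reflection through [x] lands on the
    right one. *)
Lemma alt_side (t : R) P x d : P.1 != 0 -> alt P x = 0 -> t != 0 -> 0 < d ->
  exists2 y, `|y - x| < d & 0 < t * alt P y.
Proof.
move=> P0 Px t0 d0; have [y yx Py] := alt_perturb x P0 d0.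
have : t * alt P y != 0 by rewrite mulf_neq0.
rewrite neq_lt => /orP[H|H]; last by exists y.
exists (x - (y - x)).
  by rewrite addrAC subrr add0r normrN.
have -> : alt P (x - (y - x)) = - alt P y.
  have : alt P (x - (y - x)) - alt P x = - (alt P y - alt P x).
    by rewrite !altB addrAC subrr add0r mulNmx [in LHS]mxE.
  by rewrite Px !subr0.
by rewrite mulrN oppr_gt0.
Qed.

Section Tangent.
Variables (s : seq ('cV[R]_n * R)) (a : 'rV[R]_n -> R).
Variables (f : 'rV[R]_n -> 'rV[R]_n) (D : 'rV[R]_n -> 'M[R]_n).
Hypothesis T : tangent_chain s a f D.

Let ps := tc_proper T.

Lemma essconst_near x v : essconst s a x v -> \forall y \near x, a y = v.
Proof.
move=> /near_norm[d d0 Hd]; apply/near_norm; exists d => // y yx.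
apply: (tc_regular T); apply/near_norm.
exists (d - `|y - x|); first by rewrite subr_gt0.
move=> z zy; apply: Hd; rewrite -(subrKA y) (le_lt_trans (ler_normD _ _))//.
lra.
Qed.

Lemma essconst_locconst x v : essconst s a x v -> locconst a x.
Proof.
move=> e; rewrite /locconst (tc_regular T e); exact: essconst_near.
Qed.

Lemma locconst_essconst x : locconst a x -> essconst s a x (a x).
Proof. by apply: filterS. Qed.

(** Points that are not simple are avoided by [essconst_convex]; [tc_regular] then carries the
    constant over to points on the planes. *)
Lemma const_of_simple_locconst (U : set 'rV[R]_n) :
  (forall x, U x -> \forall y \near x, U y) ->
  (forall x y t, U x -> U y -> 0 <= t <= 1 -> U (x + t *: (y - x))) ->
  (forall x, U x -> simple s x -> locconst a x) ->
  forall x y, U x -> U y -> a x = a y.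
Proof.
move=> oU cU H.
have [[x0 Ux0 gx0]|nU] := pselect (exists2 x, U x & generic s x); last first.
  move=> x y Ux; have /near_norm[d d0 Hd] := oU x Ux.
  have [z zx gz] := @generic_dense _ _ s x d ps d0.
  by case: nU; exists z => //; exact: Hd.
suff Hx x : U x -> a x = a x0 by move=> x y Ux Uy; rewrite !Hx.
move=> Ux; apply: (tc_regular T); apply: filterS (oU x Ux) => y Uy gy.
apply: (essconst_convex ps oU cU) => // z Uz /(H z Uz) lz.
by exists (a z); exact: locconst_essconst.
Qed.

(** Otherwise the chain would be constant on the ball by [const_of_simple_locconst]. So boundary
    points in corners are limits of simple boundary points. *)
Lemma nonlc_simple x d : ~ locconst a x -> 0 < d ->
  exists y, [/\ `|y - x| < d, simple s y & ~ locconst a y].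
Proof.
move=> nx d0; apply: contrapT => H; apply: nx.
apply/near_norm; exists d => // y yx.
apply: (@const_of_simple_locconst [set y | `|y - x| < d]) => //=.
- by move=> u; exact: near_ball_norm.
- by move=> u v t ux vx t01; exact: ball_convex.
- move=> u ux su; apply: contrapT => nu; apply: H; by exists u.
- by rewrite subrr normr0.
Qed.

(** The simple boundary points approaching [x] are not generic, hence lie on planes of [s]; since
    [s] is finite, one plane occurs arbitrarily near. *)
Lemma nonlc_acc x : ~ locconst a x -> exists2 P, P \in s & acc s a P x.
Proof.
move=> nx; apply: contrapT => H.
have /near_norm[d d0 Hd] : \forall y \near x, forall P, P \in s ->
    ~ [/\ simple s y, alt P y = 0 & ~ locconst a y].
  apply: near_seq => P Ps; have : ~ acc s a P x by move=> HP; apply: H;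
    exists P.
  by move/open_near_closureC; apply: filterS => y nc Hy;
    apply/nc/subset_closure.
have [y [yx sy ny]] := nonlc_simple nx d0.
apply: (ny); apply: (tc_generic T) => P Ps; apply/eqP => Py.
by apply: (Hd y yx P Ps).
Qed.

Lemma acc_nonlc P x : acc s a P x -> ~ locconst a x.
Proof.
move=> + /locconst_open/near_norm[d d0 Hd] =>
  /closure_norm/(_ d d0)[y [_ _ ny]].
by move/Hd.
Qed.

Lemma acc_alt P x : acc s a P x -> alt P x = 0.
Proof. by move=> /alt_closed; apply=> y []. Qed.

Lemma csupp_closed_alt P x : csupp a x ->
  (forall d, 0 < d -> exists2 y, csupp a y /\ alt P (f y) = 0 & `|y - x| < d) ->
  alt P (f x) = 0.
Proof.
move=> Kx H; apply: (@alt_closed P [set z | alt P z = 0]) => //.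
apply/closure_norm => e e0; have [d d0 Hd] := sdiff_cts (tc_sdiff T) Kx e0.
by have [y [Ky Py] yx] := H d d0; exists (f y) => //; exact: Hd.
Qed.

Lemma acc_alt_image P x : P \in s -> acc s a P x -> alt P (f x) = 0.
Proof.
move=> Ps Px; apply: csupp_closed_alt.
  by apply: nonlc_csupp; exact: acc_nonlc Px.
move=> d d0; move/closure_norm: Px => /(_ d d0)[y [sy Py ny] yx].
exists y => //; split; first exact: nonlc_csupp.
exact: (tc_tangent T).
Qed.

Lemma only_acc P x : P \in s ->
  (forall Q, Q \in s -> acc s a Q x -> plane Q = plane P) ->
  \forall y \near x, ~ locconst a y -> alt P y = 0 /\ alt P (f y) = 0.
Proof.
move=> Ps H; have : \forall y \near x, forall Q, Q \in s ->
    acc s a Q y -> plane Q = plane P.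
  apply: near_seq => Q Qs; have [/(H Q Qs) E|nQ] := pselect (acc s a Q x).
    by apply/near_norm; exists 1.
  by move/open_near_closureC: nQ; apply: filterS => y nQ /nQ.
apply: filterS => y Hy ny; have [Q Qs Qy] := nonlc_acc ny.
have E := Hy _ Qs Qy.
have PQ z : alt Q z = 0 -> alt P z = 0.
  by move=> Qz; have : plane P z by rewrite -E.
by split; apply: PQ; [exact: acc_alt|exact: acc_alt_image].
Qed.

(** Each open half of a ball around [x] is convex and free of boundary points, so the chain is
    constant on it. *)
Lemma two_sides P x : P \in s -> alt P x = 0 ->
  (\forall y \near x, ~ locconst a y -> alt P y = 0) ->
  exists vp vm, \forall y \near x,
    (0 < alt P y -> a y = vp) /\ (alt P y < 0 -> a y = vm).
Proof.
move=> Ps Px /near_norm[d d0 Hd].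
suff H (t : R) : t != 0 -> exists v, forall y, `|y - x| < d ->
  0 < t * alt P y -> a y = v.
  have [vp Hp] := H 1 (oner_neq0 _).
  have [vm Hm] := H (-1) ltac:(by rewrite oppr_eq0 oner_neq0).
  exists vp, vm; apply/near_norm; exists d => // y yx.
  by split=> Py; [apply: Hp|apply: Hm] => //; rewrite ?mul1r// mulN1r oppr_gt0.
move=> t0; pose U := [set y | `|y - x| < d /\ 0 < t * alt P y].
have [[y0 Uy0]|nU] := pselect (exists y, U y); last first.
  by exists 0 => y yx Py; case: nU; exists y.
exists (a y0) => y yx Py.
apply: (@const_of_simple_locconst U) => //.
- move=> z [zx Pz].
  by apply: filterS2 (near_ball_norm zx) (near_alt_pos Pz) => w; split.
- move=> u v c [ux Pu] [vx Pv] c01; split; first exact: ball_convex.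
  rewrite alt_segment; case/andP: c01 => c0 c1.
  have [->|cn] := eqVneq c 0; first by rewrite subr0 mul1r mul0r addr0.
  have : 0 < c by rewrite lt_neqAle eq_sym cn.
  by nra.
- move=> u [ux Pu] _; apply: contrapT => /(Hd u ux) Pu0.
  by rewrite Pu0 mulr0 ltxx in Pu.
Qed.

Definition sides P x vp vm := \forall y \near x,
  (0 < alt P y -> a y = vp) /\ (alt P y < 0 -> a y = vm).

Lemma sides_eq P x vp vm : P \in s -> sides P x vp vm -> vp = vm ->
  locconst a x.
Proof.
move=> Ps + E; rewrite -E => H; apply: (@essconst_locconst _ vp).
apply: filterS H => y [Hp Hm] gy; have := gy P Ps.
by rewrite neq_lt => /orP[/Hm|/Hp].
Qed.

Lemma sides_nonlc P x vp vm : P \in s -> sides P x vp vm -> vp <> vm ->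
  \forall y \near x, alt P y = 0 -> ~ locconst a y.
Proof.
move=> Ps /near_norm[d d0 Hd] vpm; apply/near_norm; exists d => // y yx Py.
move=> /near_norm[e e0 He]; apply: vpm.
have P0 : P.1 != 0 by apply: ps.
have m0 : 0 < Num.min e (d - `|y - x|) by rewrite lt_min e0 subr_gt0.
have yd z : `|z - y| < d - `|y - x| -> `|z - x| < d.
  by move=> zy; rewrite -(subrKA y) (le_lt_trans (ler_normD _ _))//; lra.
have [z] := alt_side P0 Py (oner_neq0 R) m0.
rewrite lt_min mul1r => /andP[ze /yd zx] /(Hd z zx).1 <-.
have [w] := alt_side P0 Py neqN1 m0.
rewrite lt_min mulN1r oppr_gt0 => /andP[we /yd wx] /(Hd w wx).2 <-.
by rewrite He// He.
Qed.

Lemma sides_uniq P x vp vm wp wm : P.1 != 0 -> alt P x = 0 ->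
  sides P x vp vm -> sides P x wp wm -> vp = wp /\ vm = wm.
Proof.
move=> P0 Px /near_norm[d d0 Hd] /near_norm[e e0 He].
have m0 : 0 < Num.min d e by rewrite lt_min d0.
split.
  have [z] := alt_side P0 Px (oner_neq0 R) m0.
  by rewrite lt_min mul1r => /andP[zd ze] Pz;
    rewrite -(Hd z zd).1// (He z ze).1.
have [z] := alt_side P0 Px neqN1 m0.
rewrite lt_min mulN1r oppr_gt0 => /andP[zd ze] Pz.
by rewrite -(Hd z zd).2// (He z ze).2.
Qed.

Lemma sides_near P x vp vm : sides P x vp vm ->
  \forall y \near x, sides P y vp vm.
Proof.
move=> /near_norm[d d0 Hd]; apply/near_norm; exists d => // y yx.
by apply: filterS (near_ball_norm yx).
Qed.

End Tangent.
End Chains.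

(** * Local sheets of the map *)

Section Sheets.
Variables (R : realType) (n : nat).
Implicit Types (P Q : 'cV[R]_n * R) (x y : 'rV[R]_n).

Lemma transversal (v : 'cV[R]_n) : v != 0 ->
  exists w : 'rV[R]_n, w *m v = 1%:M.
Proof.
move=> v0; have [i vi] : exists i, v i 0 != 0.
  apply/existsP; apply: contraNT v0 => /existsPn H; apply/eqP/matrixP => i j.
  by rewrite ord1 mxE; apply/eqP; rewrite -[_ == _]negbK H.
exists ((v i 0)^-1 *: delta_mx 0 i); rewrite -scalemxAl -rowE.
by apply/matrixP => j k; rewrite !ord1 !mxE mulVf.
Qed.

(** Split each vector along a vector [w0] with [w0 *m v = 1]: only the part along [w0] contributes
    to [A *m v], with factor [c]. *)
Lemma eigen_of_kernel (v : 'cV[R]_n) (A : 'M[R]_n) : v != 0 ->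
  (forall w : 'rV[R]_n, w *m v = 0 -> w *m A *m v = 0) ->
  exists c : R, A *m v = c *: v.
Proof.
move=> /transversal[w0 w01] H; exists ((w0 *m A *m v) 0 0).
apply/row_matrixP => i; rewrite !rowE; set w := delta_mx _ _.
have := H (w - (w *m v) *m w0).
rewrite mulmxBl -[_ *m w0 *m v]mulmxA w01 mulmx1 subrr => /(_ erefl).
rewrite !mulmxBl -!mulmxA => /eqP; rewrite subr_eq0 => /eqP->.
rewrite -scalemxAr; apply/matrixP => j k; rewrite !ord1.
by rewrite [in LHS]mulmxA mxE big_ord1 [in RHS]mxE mulrC.
Qed.

Variables (s : seq ('cV[R]_n * R)) (a : 'rV[R]_n -> R).
Variables (f : 'rV[R]_n -> 'rV[R]_n) (D : 'rV[R]_n -> 'M[R]_n).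
Hypothesis T : tangent_chain s a f D.

Lemma sg_det_csupp x : csupp a x -> exists2 d : R, 0 < d &
  forall y, csupp a y -> `|y - x| < d ->
    Num.sg (\det (D y)) = Num.sg (\det (D x)).
Proof.
move=> Kx; have [e e0 He] := sg_det_near (tc_det T Kx).
have [d d0 Hd] := tc_cts T Kx e0.
by exists d => // y Ky yx; apply: He; exact: Hd.
Qed.

(** Near [x] the points of [P] carry the jump and are mapped into [P], so [D x] preserves the
    directions of [P]; dually, the normal is an eigenvector. The eigenvalue [c] multiplies heights
    over [P], and its sign tells whether the sides are exchanged. *)
Lemma face_eigen P x vp vm : P \in s -> alt P x = 0 ->
  (\forall y \near x, ~ locconst a y -> alt P y = 0 /\ alt P (f y) = 0) ->
  sides a P x vp vm -> vp <> vm ->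
  exists c, D x *m P.1 = c *: P.1.
Proof.
move=> Ps Px H1 H2 vpm; have P0 := tc_proper T Ps.
have [d d0 Hd] : exists2 d, 0 < d & forall y, `|y - x| < d -> alt P y = 0 ->
    csupp a y /\ alt P (f y) = 0.
  apply/near_norm; apply: filterS2 H1 (sides_nonlc T Ps H2 vpm) =>
    y Hy ny /ny nl.
  by split; [exact: nonlc_csupp|case: (Hy nl)].
have x0 : `|x - x| < d by rewrite subrr normr0.
have [Kx Pfx] := Hd x x0 Px.
apply: eigen_of_kernel => // w wP; apply/eqP; rewrite -normr_le0.
have [C C0 HC] := mulmx_lipschitz P.1.
apply/ler_addgt0Pl => e e0; rewrite addr0.
have N0 : 0 < `|w| + 1 by rewrite ltr_pwDr.
(* The tolerance absorbs [C], which bounds multiplication by [P.1], and the length of [w]. *)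
have [d' d'0 Hd'] := tc_sdiff T Kx (divr_gt0 e0 (mulr_gt0 C0 N0)).
pose m := Num.min d d'.
have m0 : 0 < m by rewrite lt_min d0.
pose t := m / 2 / (`|w| + 1).
have t0 : 0 < t by rewrite !divr_gt0.
pose y := x + t *: w.
have tw : `|t *: w| < m.
  rewrite normrZ gtr0_norm// /t mulrAC ltr_pdivrMr//.
  have := normr_ge0 w; nra.
have yx : `|y - x| < m by rewrite /y addrC addKr.
have Py : alt P y = 0 by rewrite altD Px -scalemxAl wP scaler0 mxE addr0.
have [yd yd'] : `|y - x| < d /\ `|y - x| < d'.
  by move: yx; rewrite lt_min => /andP.
have [Ky Pfy] := Hd y yd Py.
have := Hd' y x Ky Kx yd'; rewrite subrr normr0 => /(_ d'0).
set u := f y - f x - _ => Hu.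
have uE : u *m P.1 = - (t *: (w *m D x *m P.1)).
  have E : (f y - f x) *m P.1 = 0.
    by apply/matrixP => i j; rewrite !ord1 -altB Pfx Pfy subrr mxE.
  by rewrite /u mulmxBl E sub0r /y addrC addKr -!scalemxAl.
have := HC _ u; rewrite uE normrN normrZ gtr0_norm// => H.
rewrite -(ler_pM2l t0) (le_trans H)//.
apply: (@le_trans _ _ (C * (e / (C * (`|w| + 1)) * `|y - x|))).
  by rewrite ler_pM2l.
have -> : `|y - x| = t * `|w| by rewrite /y addrC addKr normrZ gtr0_norm.
rewrite invfM.
have -> : C * (e * (C^-1 * (`|w| + 1)^-1) * (t * `|w|)) =
   (C * C^-1) * (t * e) * (`|w| / (`|w| + 1)) by ring.
rewrite mulfV ?gt_eqF// mul1r ler_piMr// ?mulr_ge0 ?ltW//.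
by rewrite ltr_pdivrMr// mul1r ltrDl.
Qed.

(** The inverse function theorem at an interior point of the support. The radius of uniqueness [r0]
    comes before [r], so that [count_sheets] can choose [r] from the spacing of a fiber. *)
Lemma interior_sheet x0 : csupp a x0 -> locconst a x0 ->
  exists2 r0, 0 < r0 & forall r, 0 < r -> exists2 d, 0 < d & forall y,
    `|y - f x0| < d -> exists x, [/\ `|x - x0| < r, f x = y,
      a x = a x0, Num.sg (\det (D x)) = Num.sg (\det (D x0)) &
      forall x', csupp a x' -> `|x' - x0| < r0 -> f x' = y -> x' = x].
Proof.
move=> Kx0 l0.
have a0 : a x0 != 0.
  move/near_norm: l0 => [d d0 Hd]; move/closure_norm: (Kx0) =>
    /(_ d d0)[y ay yx].
  by rewrite -(Hd y yx).
have /near_norm[d1 d10 Hd1] := l0.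
have Kd1 x : `|x - x0| < d1 -> csupp a x.
  by move=> xd; apply: csupp_supp; rewrite Hd1.
have := tc_det T Kx0; rewrite -unitfE -unitmxE => uA.
have [e1 e10 He1] := nearly_linear_inj uA.
have [e2 e20 [C C0 He2]] := nearly_linear_onto uA.
have m0 : 0 < Num.min e1 e2 by rewrite lt_min e10.
have [d2 d20 Hd2] := tc_sdiff T Kx0 m0.
have [d3 d30 Hd3] := sg_det_csupp Kx0.
pose r0 := Num.min d1 (Num.min d2 d3).
have r00 : 0 < r0 by rewrite !lt_min d10 d20.
have r01 x : `|x - x0| < r0 -> `|x - x0| < d1 by rewrite !lt_min => /and3P[].
have r02 x : `|x - x0| < r0 -> `|x - x0| < d2 by rewrite !lt_min => /and3P[].
have r03 x : `|x - x0| < r0 -> `|x - x0| < d3 by rewrite !lt_min => /and3P[].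
have E p q e : Num.min e1 e2 <= e -> `|p - x0| < r0 -> `|q - x0| < r0 ->
    `|f p - f q - (p - q) *m D x0| <= e * `|p - q|.
  move=> le_e px qx; apply: le_trans (Hd2 p q _ _ _ _) _; try exact: r02.
  - by apply: Kd1; exact: r01.
  - by apply: Kd1; exact: r01.
  - by rewrite ler_wpM2r.
exists r0 => // r rpos; pose r' := Num.min r r0 / 2.
have r'0 : 0 < r' by rewrite divr_gt0// lt_min rpos.
have [r'r r'r0] : r' < r /\ r' < r0.
  have : Num.min r r0 <= r by rewrite ge_min lexx.
  have : Num.min r r0 <= r0 by rewrite ge_min lexx orbT.
  by rewrite /r' in r'0 *; split; lra.
exists (C * r'); first exact: mulr_gt0.
move=> y yz.
have [|x xr fx] := He2 f x0 r0 _ r' y r'0 r'r0 (ltW yz).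
  by move=> p q; apply: E; rewrite ge_min lexx orbT.
have xr0 : `|x - x0| < r0 by exact: le_lt_trans r'r0.
exists x; split => //.
- exact: le_lt_trans r'r.
- by apply: Hd1; exact: r01.
- by apply: Hd3; [apply: Kd1; exact: r01|exact: r03].
- move=> x' Kx' x'r fx'; apply: (He1 f); last by rewrite fx.
  by apply: E => //; rewrite ge_min lexx.
Qed.

(** [beta u] is the height to be removed: all of [u] on a side where the chain vanishes, nothing on
    the other side. *)
Lemma clamp_side (vp vm : R) : exists beta : R -> R,
  [/\ forall u v, `|beta u - beta v| <= `|u - v|, beta 0 = 0,
      forall u, 0 < u -> vp != 0 -> beta u = 0,
      forall u, u < 0 -> vm != 0 -> beta u = 0 &
      forall u, (0 < u - beta u -> vp != 0) /\ (u - beta u < 0 -> vm != 0)].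
Proof.
pose beta (u : R) :=
  if (0 < u) && (vp == 0) || (u < 0) && (vm == 0) then u else 0.
exists beta; split.
- move=> u v; have h1 := ler_norm (u - v); have h2 := ler_norm (v - u).
  rewrite distrC in h2; rewrite /beta.
  case: (ltrgtP 0 u) => hu; case: (ltrgtP 0 v) => hv; case: (vp == 0);
    case: (vm == 0); rewrite /= ?subrr ?normr0 ?subr0 ?sub0r ?normrN//;
    try (rewrite (gtr0_norm hu)); try (rewrite (ltr0_norm hu));
    try (rewrite (gtr0_norm hv)); try (rewrite (ltr0_norm hv)); lra.
- by rewrite /beta !ltxx.
- by move=> u u0 /negPf v0; rewrite /beta v0 andbF /= lt_gtF.
- by move=> u u0 /negPf v0; rewrite /beta v0 andbF orbF lt_gtF.
- move=> u; rewrite /beta; case: (ltrgtP 0 u) => hu; case: eqP => hp;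
    case: eqP => hm; rewrite /= ?subrr ?subr0; split => //; lra.
Qed.

(* Across P the map is extended by f p := f (cl p) + (p - cl p) D x0, where cl
   clamps p to the side of P on which the chain is supported. *)
Lemma face_sheet x0 P vp vm c : P \in s -> alt P x0 = 0 ->
  (\forall y \near x0, ~ locconst a y -> alt P y = 0 /\ alt P (f y) = 0) ->
  sides a P x0 vp vm -> vp <> vm -> D x0 *m P.1 = c *: P.1 ->
  exists2 r0, 0 < r0 & forall r, 0 < r -> exists2 d, 0 < d & forall y,
    `|y - f x0| < d -> alt P y != 0 -> exists x, [/\ `|x - x0| < r,
      a x = (if 0 < c * alt P y then vp else vm),
      a x != 0 -> f x = y,
      a x != 0 -> Num.sg (\det (D x)) = Num.sg (\det (D x0)) &
      forall x', csupp a x' -> `|x' - x0| < r0 -> f x' = y -> x' = x].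
Proof.
move=> Ps Px H1 H2 vpm Dc; have P0 := tc_proper T Ps.
have [v vP] := transversal P0.
have Kx0 : csupp a x0.
  by apply: nonlc_csupp; exact: nbhs_singleton (sides_nonlc T Ps H2 vpm) Px.
have := tc_det T Kx0; rewrite -unitfE -unitmxE => uA.
have c0 : c != 0.
  apply: contraNneq P0 => c0; move: Dc; rewrite c0 scale0r.
  by move=> /(congr1 (mulmx (invmx (D x0)))); rewrite mulKmx// mulmx0 => ->.
have [d1 d10 Hd1] : exists2 d, 0 < d & forall y, `|y - x0| < d -> alt P y = 0 ->
    csupp a y /\ alt P (f y) = 0.
  apply/near_norm; apply: filterS2 H1 (sides_nonlc T Ps H2 vpm) =>
    y Hy ny /ny nl.
  by split; [exact: nonlc_csupp|case: (Hy nl)].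
have [d2 d20 Hd2] : exists2 d, 0 < d & forall y, `|y - x0| < d ->
  (0 < alt P y -> a y = vp) /\ (alt P y < 0 -> a y = vm) by apply/near_norm.
have [beta [bL b0 bp bm bs]] := clamp_side vp vm.
pose cl p := p - beta (alt P p) *: v.
have altcl p : alt P (cl p) = alt P p - beta (alt P p).
  by rewrite /cl altD mulNmx -scalemxAl vP [X in _ + X]mxE [X in - X]mxE mxE
    mulr1.
have [CP CP0 HCP] := alt_lipschitz P.
pose M := 1 + CP * `|v|.
have M0 : 0 < M by rewrite ltr_pwDl// mulr_ge0// ltW.
have clL p q : `|cl p - cl q| <= M * `|p - q|.
  have -> : cl p - cl q = (p - q) - (beta (alt P p) - beta (alt P q)) *: v.
    by apply/matrixP => i j; rewrite !mxE; ring.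
  rewrite (le_trans (ler_normB _ _))// mulrDl mul1r lerD2l normrZ.
  rewrite mulrAC ler_wpM2r// (le_trans (bL _ _))//; exact: HCP.
have clx0 : cl x0 = x0 by rewrite /cl Px b0 scale0r subr0.
(* A clamped point lies either strictly on a side with nonzero coefficient, or on [P], where the
   chain jumps. *)
have clK p : M * `|p - x0| < Num.min d1 d2 -> csupp a (cl p).
  move=> pd; have : `|cl p - x0| < Num.min d1 d2.
    by rewrite -{1}clx0 (le_lt_trans (clL _ _)).
  rewrite lt_min => /andP[pd1 pd2].
  case: (ltrgtP (alt P (cl p)) 0) => h; last by case: (Hd1 _ pd1 h).
    apply: csupp_supp; rewrite (Hd2 _ pd2).2//.
    by have [_ +] := bs (alt P p); rewrite -altcl; apply.
  apply: csupp_supp; rewrite (Hd2 _ pd2).1//.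
  by have [+ _] := bs (alt P p); rewrite -altcl; apply.
(* A point strictly on a side with coefficient 0 has a neighbourhood where the chain vanishes, so it
   is outside the support. *)
have clid p : `|p - x0| < d2 -> csupp a p -> cl p = p.
  move=> pd Kp; suff bp0 : beta (alt P p) = 0 by rewrite /cl bp0 scale0r subr0.
  case: (ltrgtP (alt P p) 0) => h; last by rewrite h.
    apply: bm => //; apply/eqP => v0; move: Kp.
    have h' : 0 < -1 * alt P p by rewrite mulN1r oppr_gt0.
    have [e e0 He] := (near_norm _ _).1 (filterI (near_ball_norm pd)
      (near_alt_pos h')).
    move=> /closure_norm/(_ e e0)[q aq /He[qd]]; rewrite mulN1r oppr_gt0 => hq.
    by move: aq; rewrite /= (Hd2 q qd).2// v0 eqxx.
  apply: bp => //; apply/eqP => v0; move: Kp.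
  have h' : 0 < 1 * alt P p by rewrite mul1r.
  have [e e0 He] := (near_norm _ _).1 (filterI (near_ball_norm pd) (near_alt_pos
    h')).
  move=> /closure_norm/(_ e e0)[q aq /He[qd]]; rewrite mul1r => hq.
  by move: aq; rewrite /= (Hd2 q qd).1// v0 eqxx.
pose g p := f (cl p) + (p - cl p) *m D x0.
(* The extension has the linearization error of [f] at the clamped points. As [cl] is [M]-Lipschitz,
   tolerance [e / M] for [f] gives tolerance [e] for [g]. *)
have gE p q : g p - g q - (p - q) *m D x0 =
    f (cl p) - f (cl q) - (cl p - cl q) *m D x0.
  rewrite /g; move: (cl p) (cl q) => p' q'.
  rewrite !mulmxBl; move: (p *m _) (q *m _) (p' *m _) (q' *m _) => A B A' B'.
  by apply/matrixP => i j; rewrite !mxE; ring.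
have [e1 e10 He1] := nearly_linear_inj uA.
have [e2 e20 [C C0 He2]] := nearly_linear_onto uA.
have [CQ CQ0 HCQ] := mulmx_lipschitz P.1.
pose N := CQ * (`|v| + 1).
have N0 : 0 < N by rewrite mulr_gt0// ltr_pwDr.
(* Makes the height of [g p] differ from [c * alt P p] by at most half its size, so that both have
   the same sign. *)
pose e3 := `|c| / (2 * N).
have e30 : 0 < e3 by rewrite divr_gt0 ?normr_gt0// mulr_gt0.
pose e := Num.min e1 (Num.min e2 e3).
have e0 : 0 < e by rewrite !lt_min e10 e20.
have [d3 d30 Hd3] := tc_sdiff T Kx0 (divr_gt0 e0 M0).
have [d4 d40 Hd4] := sg_det_csupp Kx0.
pose m := Num.min (Num.min d1 d2) (Num.min d3 d4).
have m0 : 0 < m by rewrite !lt_min d10 d20 d30.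
have M1 : 1 <= M by rewrite lerDl mulr_ge0// ltW.
pose r0 := m / M.
have r00 : 0 < r0 by rewrite divr_gt0.
have r0M p : `|p - x0| < r0 -> M * `|p - x0| < m.
  by rewrite /r0 ltr_pdivlMr// mulrC.
have r0m p : `|p - x0| < r0 -> `|p - x0| < m.
  move=> /r0M; apply: le_lt_trans; by rewrite ler_peMl.
have clr p : `|p - x0| < r0 -> `|cl p - x0| < m.
  by move=> /r0M; apply: le_lt_trans; rewrite -{1}clx0.
have Kcl p : `|p - x0| < r0 -> csupp a (cl p).
  by move=> /r0M; rewrite lt_min => /andP[? _]; exact: clK.
have E p q : `|p - x0| < r0 -> `|q - x0| < r0 ->
    `|g p - g q - (p - q) *m D x0| <= e * `|p - q|.
  move=> pr qr; rewrite gE.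
  have d3P u : `|u - x0| < r0 -> `|cl u - x0| < d3.
    by move=> /clr; rewrite !lt_min => /andP[_ /andP[]].
  apply: le_trans (Hd3 _ _ (Kcl _ pr) (Kcl _ qr) (d3P _ pr) (d3P _ qr)) _.
  rewrite -mulrA ler_pM2l// mulrC ler_pdivrMr// mulrC; exact: clL.
(* Keeps the projection [p0] of [p] to [P], used in [side], within [r0] of [x0]. *)
pose r1 := r0 / M.
have r10 : 0 < r1 by rewrite divr_gt0.
have r1M p : `|p - x0| < r1 -> M * `|p - x0| < r0.
  by rewrite /r1 ltr_pdivlMr// mulrC.
have r1r0 p : `|p - x0| < r1 -> `|p - x0| < r0.
  move=> /r1M; apply: le_lt_trans; by rewrite ler_peMl.
have side p : `|p - x0| < r1 ->
  `|alt P (g p) - c * alt P p| <= `|c * alt P p| / 2.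
  move=> pr; pose p0 := p - alt P p *: v.
  have Pp0 : alt P p0 = 0.
    by rewrite /p0 altD mulNmx -scalemxAl vP [X in _ + X]mxE [X in - X]mxE mxE
      mulr1 subrr.
  have p0r : `|p0 - x0| < r0.
    apply: le_lt_trans (r1M _ pr).
    have -> : p0 - x0 = (p - x0) - (alt P p - alt P x0) *: v.
      by rewrite Px subr0 /p0 addrAC.
    rewrite (le_trans (ler_normB _ _))// mulrDl mul1r lerD2l normrZ.
    rewrite mulrAC ler_wpM2r//; exact: HCP.
  have gp0 : g p0 = f p0 by rewrite /g /cl Pp0 b0 scale0r subr0 subrr mul0mx
    addr0.
  have Pgp0 : alt P (g p0) = 0.
    by rewrite gp0; apply: (Hd1 p0 _ Pp0).2; move: (r0m _ p0r);
      rewrite !lt_min => /andP[/andP[]].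
  have := E p p0 (r1r0 _ pr) p0r; set u := _ - _ - _ => Hu.
  have pp0 : p - p0 = alt P p *: v by rewrite /p0 opprB addrC subrK.
  have <- : (u *m P.1) 0 0 = alt P (g p) - c * alt P p.
    rewrite /u mulmxBl [LHS]mxE [X in _ + X]mxE -altB Pgp0 subr0; congr (_ - _).
    by rewrite pp0 -mulmxA Dc -scalemxAr -scalemxAl vP !mxE mulr1.
  rewrite (le_trans (normr_entry _ _ _))// (le_trans (HCQ _ _))//.
  apply: (@le_trans _ _ (CQ * (e3 * `|p - p0|))).
    rewrite ler_pM2l// (le_trans Hu)// ler_wpM2r//.
    by rewrite /e !ge_min lexx !orbT.
  rewrite pp0 normrZ (normrM c) /e3.
  have -> : CQ * (`|c| / (2 * N) * (`|alt P p| * `|v|)) =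
      `|c| * `|alt P p| / 2 * ((CQ * `|v|) / N).
    by rewrite invfM; ring.
  rewrite ler_piMr// ?mulr_ge0// ler_pdivrMr// mul1r /N ler_pM2l//.
  by rewrite lerDl.
exists r1 => // r rpos; pose r' := Num.min r r1 / 2.
have r'0 : 0 < r' by rewrite divr_gt0// lt_min rpos.
have [r'r r'r1] : r' < r /\ r' < r1.
  have : Num.min r r1 <= r by rewrite ge_min lexx.
  have : Num.min r r1 <= r1 by rewrite ge_min lexx orbT.
  by rewrite /r' in r'0 *; split; lra.
have gx0 : g x0 = f x0 by rewrite /g clx0 subrr mul0mx addr0.
exists (C * r'); first exact: mulr_gt0.
move=> y yz Py.
have [||x xr gx] := He2 g x0 r1 _ r' y r'0 r'r1; last 1 first.
- have xr1 : `|x - x0| < r1 by exact: le_lt_trans r'r1.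
  have xr0 := r1r0 _ xr1.
  have xm := r0m _ xr0.
  have xd2 : `|x - x0| < d2 by move: xm; rewrite !lt_min => /andP[/andP[]].
  have xd4 : `|x - x0| < d4 by move: xm; rewrite !lt_min => /andP[_ /andP[]].
  have clx : a x != 0 -> cl x = x by move=> ax; apply: clid => //;
    exact: csupp_supp.
  exists x; split.
  + exact: le_lt_trans r'r.
  + have := side x xr1; rewrite gx => sx.
    (* Multiplying by [c] replaces its unknown sign by the positive [c ^+ 2]: the sign of
       [c * alt P y] is that of [alt P x]. *)
    have : `|c * alt P y - c ^+ 2 * alt P x| <= c ^+ 2 * `|alt P x| / 2.
      rewrite expr2 -mulrA -mulrBr normrM.
      have -> : c * c * `|alt P x| / 2 = `|c| * (`|c * alt P x| / 2).
        rewrite normrM -[c * c]expr2 -real_normK ?num_real//; ring.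
      by rewrite ler_pM2l// normr_gt0.
    have c2 : 0 < c ^+ 2 by rewrite exprn_even_gt0.
    have ax0 : alt P x != 0.
      apply: contraNneq Py => ax0; move: sx;
        rewrite ax0 mulr0 subr0 normr0 mul0r.
      by rewrite normr_le0.
    rewrite ler_norml => /andP[s1 s2].
    case: (ltrgtP (alt P x) 0) ax0 => // h _.
      rewrite (Hd2 _ xd2).2// ifF//; apply/negbTE; rewrite -leNgt.
      rewrite (ltr0_norm h) in s2;
        have : c ^+ 2 * alt P x < 0 by rewrite pmulr_rlt0.
      lra.
    rewrite (Hd2 _ xd2).1// ifT//.
    rewrite (gtr0_norm h) in s1;
      have : 0 < c ^+ 2 * alt P x by rewrite pmulr_rgt0.
    lra.
  + by move=> /clx clx'; rewrite -gx /g clx' subrr mul0mx addr0.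
  + by move=> ax; apply: Hd4 => //; exact: csupp_supp.
  + move=> x' Kx' x'r fx'; apply: (He1 g).
      apply: le_trans (E _ _ (r1r0 _ x'r) xr0) _.
      by rewrite ler_wpM2r// /e ge_min lexx.
    have x'd2 : `|x' - x0| < d2.
      by move: (r0m _ (r1r0 _ x'r)); rewrite !lt_min => /andP[/andP[]].
    by rewrite gx /g clid// subrr mul0mx addr0.
- move=> p q pr qr; apply: le_trans (E _ _ (r1r0 _ pr) (r1r0 _ qr)) _.
  by rewrite ler_wpM2r// /e !ge_min lexx orbT.
- by rewrite gx0 ltW.
Qed.

End Sheets.

(** * Signed counts *)

Lemma small_seq (R : realType) (T : eqType) (r : seq T) (B : T -> R -> Prop) :
  (forall t, t \in r -> exists2 d, 0 < d & forall e, 0 < e -> e <= d ->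
    B t e) ->
  exists2 d, 0 < d & forall e, 0 < e -> e <= d -> forall t, t \in r -> B t e.
Proof.
elim: r => [_|t r IH H]; first by exists 1.
have [|d d0 Hd] := IH; first by move=> u ur; apply: H; rewrite inE ur orbT.
have [|d' d'0 Hd'] := H t; first by rewrite inE eqxx.
exists (Num.min d d'); first by rewrite lt_min d0.
move=> e e0; rewrite le_min => /andP[ed ed'] u; rewrite inE => /orP[/eqP->|].
  exact: Hd'.
exact: Hd.
Qed.

Section Count.
Variables (R : realType) (n : nat).
Implicit Types (P Q : 'cV[R]_n * R) (x y : 'rV[R]_n).

(** The degree of [f] weighted by the chain. For a tangent chain only finitely many terms are
    nonzero, by [fiber_finite], and values of [f] where [a] vanishes do not matter. *)
Definition dcount (a : 'rV[R]_n -> R) (f : 'rV[R]_n -> 'rV[R]_n)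
    (D : 'rV[R]_n -> 'M[R]_n) (y : 'rV[R]_n) : R :=
  \sum_(x \in [set x | f x = y]) a x * Num.sg (\det (D x)).

Variables (s : seq ('cV[R]_n * R)) (a : 'rV[R]_n -> R).
Variables (f : 'rV[R]_n -> 'rV[R]_n) (D : 'rV[R]_n -> 'M[R]_n).
Hypothesis T : tangent_chain s a f D.

Lemma csupp_compact : compact (csupp a).
Proof.
have [M HM] := tc_bounded T.
apply: bounded_closed_compact; last exact: closed_closure.
exists M; split; first exact: num_real.
move=> M' MM' x /closure_norm Kx; apply/ler_addgt0Pl => e e0.
have [y ay yx] := Kx e e0; have := HM y ay.
rewrite -(subrK y x) => yM; rewrite (le_trans (ler_normD _ _))//.
by rewrite distrC; lra.
Qed.

Let cK := csupp_compact.

Let F (z : 'rV[R]_n) := [set x | csupp a x /\ f x = z].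

Let finF z : finite_set (F z).
Proof. exact: fiber_finite cK (tc_sdiff T) (tc_det T) z. Qed.

(** By [fiber_near] each preimage of [y] in the support is close to a point over [z], where the
    sheet has a single candidate [x]. A candidate with [a x = 0] contributes nothing and need not
    lie over [y]. The condition [G] serves to keep [y] off a plane. *)
Lemma count_sheets z (G : 'rV[R]_n -> Prop) (al : 'rV[R]_n -> 'rV[R]_n -> R) :
  (forall x0, F z x0 ->
    exists2 r0, 0 < r0 & forall r, 0 < r -> exists2 d, 0 < d & forall y,
    `|y - z| < d -> G y -> exists x, [/\ `|x - x0| < r,
      a x = al x0 y,
      a x != 0 -> f x = y,
      a x != 0 -> Num.sg (\det (D x)) = Num.sg (\det (D x0)) &
      forall x', csupp a x' -> `|x' - x0| < r0 -> f x' = y -> x' = x]) ->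
  exists2 d, 0 < d & forall y, `|y - z| < d -> G y ->
    dcount a f D y = \sum_(x0 \in F z) al x0 y * Num.sg (\det (D x0)).
Proof.
move=> H; have /finite_seqP[r rE] := finF z.
have Fr x : F z x = (x \in r) :> Prop by rewrite rE.
(* Distinct points over [z] are more than [2 * rho] apart, so their sheets are disjoint and [chi]
   below is injective. *)
have [rho rho0 Hrho] : exists2 d, 0 < d & forall e, 0 < e -> e <= d -> forall t,
    t \in r -> forall y, y \in r -> y <> t -> e + e < `|y - t|.
  apply: small_seq => x xr; apply: small_seq => y yr.
  have [->|yx] := eqVneq y x; first by exists 1.
  have yx0 : 0 < `|y - x| by rewrite normr_gt0 subr_eq0.
  by exists (`|y - x| / 3); [lra|move=> e e0 ed _; lra].
pose B (x0 : 'rV[R]_n) e := forall y, `|y - z| < e -> G y ->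
  exists x, [/\ `|x - x0| < rho,
      a x = al x0 y,
      a x != 0 -> f x = y,
      a x != 0 -> Num.sg (\det (D x)) = Num.sg (\det (D x0)) &
      forall x', csupp a x' -> `|x' - x0| < e -> f x' = y -> x' = x].
have [d d0 Hd] : exists2 d, 0 < d & forall e, 0 < e -> e <= d -> forall t,
    t \in r -> B t e.
  apply: small_seq => x xr; have [|r0 r00 Hr0] := H x; first by rewrite Fr.
  have [d d0 Hd] := Hr0 rho rho0.
  exists (Num.min r0 d); first by rewrite lt_min r00.
  move=> e e0; rewrite le_min => /andP[er0 ed] y yz Gy.
  have [x' [x'x ax ax1 ax2 u]] := Hd y (lt_le_trans yz ed) Gy.
  exists x'; split=> // u' Ku' u'x; apply: u => //; exact: lt_le_trans er0.
have [d1 d10 Hd1] := fiber_near cK (tc_sdiff T) z d0.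
pose m := Num.min d d1; have m0 : 0 < m by rewrite lt_min d0.
exists m => // y; rewrite lt_min => /andP[yd yd1] Gy.
have /choice[chi Hchi] : forall x0, exists x, F z x0 -> [/\ `|x - x0| < rho,
      a x = al x0 y,
      a x != 0 -> f x = y,
      a x != 0 -> Num.sg (\det (D x)) = Num.sg (\det (D x0)) &
      forall x', csupp a x' -> `|x' - x0| < d -> f x' = y -> x' = x].
  move=> x0; case: (pselect (F z x0)) => [Fx|]; last by exists 0.
  have x0r : x0 \in r by rewrite -Fr.
  by have [x Hx] := Hd d d0 (lexx d) x0 x0r y yd Gy; exists x.
pose w x := a x * Num.sg (\det (D x)).
pose A := [set x | f x = y /\ a x != 0].
have -> : dcount a f D y = \sum_(x \in A) w x.
  apply/esym/fsbig_widen => [x []//|x [fx nA]].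
  rewrite /preimage /= /w; have [->|ax] := eqVneq (a x) 0;
    first by rewrite mul0r.
  by case: nA.
have -> : \sum_(x \in A) w x = \sum_(x \in chi @` F z) w x.
  apply: fsbig_widen => [x [fx ax]|_ [[x0 Fx0 <-] nA]].
    have Kx := csupp_supp ax.
    have [|x0 Fx0 xx0] := Hd1 x Kx; first by rewrite fx.
    exists x0 => //; have [_ _ _ _ u] := Hchi x0 Fx0.
    by rewrite -(u x).
  rewrite /preimage /= /w; have [->|ax] := eqVneq (a (chi x0)) 0.
    by rewrite mul0r.
  by case: nA; split=> //; have [_ _ -> //] := Hchi x0 Fx0.
rewrite fsbig_image; last first.
  move=> x0 x1 /set_mem Fx0 /set_mem Fx1 E; apply: contrapT => x01.
  have x0r : x0 \in r by rewrite -Fr.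
  have x1r : x1 \in r by rewrite -Fr.
  have [h0 _ _ _ _] := Hchi x0 Fx0; have [h1 _ _ _ _] := Hchi x1 Fx1.
  have := Hrho rho rho0 (lexx _) x1 x1r x0 x0r x01.
  have : `|x0 - x1| <= `|chi x0 - x0| + `|chi x1 - x1|.
    rewrite (distrC (chi x0)) -(subrKA (chi x0)) E; exact: ler_normD.
  lra.
apply: eq_fsbigr => x0 /set_mem Fx0; rewrite /w.
have [_ <- _ sg _] := Hchi x0 Fx0.
by have [->|ax] := eqVneq (a (chi x0)) 0; rewrite ?mul0r// sg.
Qed.

End Count.

(** * Traces on a hyperplane *)

(** Complete [v] to an invertible matrix with columns [v] and [B]; its inverse has rows [r] and [C].
    Thus [B] reads coordinates on the hyperplane, [C] embeds them, and [r] is transversal. Writing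
    the dimension as [1 + m] makes the blocks typecheck. *)
Lemma hyperplane_coords (F : fieldType) m (v : 'cV[F]_(1 + m)) : v != 0 ->
  exists (r : 'rV[F]_(1 + m)) (B : 'M[F]_(1 + m, m)) (C : 'M[F]_(m, 1 + m)),
  [/\ r *m v = 1%:M, r *m B = 0, C *m v = 0, C *m B = 1%:M &
      v *m r + B *m C = 1%:M].
Proof.
move=> v0.
have [M [uM Mv]] : exists M : 'M[F]_(1 + m, 1 + m),
  M \in unitmx /\ lsubmx M = v.
  have rv : \rank v = 1%N.
    by apply/eqP; rewrite eqn_leq rank_leq_col lt0n mxrank_eq0.
  have k0 : row_ebase v 0 0 != 0.
    have := row_ebase_unit v; rewrite unitmxE unitfE.
    by rewrite [row_ebase v]mx11_scalar det_scalar1 mxE.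
  (* The rank factorisation of [v] makes it the first column of [col_ebase v] times a nonzero
     scalar. *)
  exists (col_ebase v *m block_mx (row_ebase v) 0 0 1%:M); split.
    rewrite unitmx_mul col_ebase_unit /= unitmxE det_ublock det1 mulr1.
    by rewrite -unitmxE row_ebase_unit.
  rewrite -{3}(mulmx_ebase v) rv -{1}(hsubmxK (col_ebase v)).
  rewrite (_ : pid_mx 1 = col_mx 1%:M 0 :> 'M[F]_(1 + m, 1)); last first.
    apply/matrixP => i j; rewrite !mxE; case: splitP => k ->;
      rewrite !ord1 ?mxE//.
  rewrite -[X in _ = X *m _ *m _](hsubmxK (col_ebase v)).
  by rewrite !mul_row_col !mul_mx_row add_row_mx row_mxKl !mulmx0 !addr0 mulmx1.
pose N := invmx M.
exists (usubmx N), (rsubmx M), (dsubmx N).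
have E1 : N *m M = 1%:M by rewrite mulVmx.
have E2 : M *m N = 1%:M by rewrite mulmxV.
rewrite -Mv; move: E1 E2; rewrite -{1 2}(hsubmxK M) -{1 2}(vsubmxK N).
rewrite mul_col_row mul_row_col => + ->.
rewrite (scalar_mx_block 1 m) => /eq_block_mx[-> -> -> ->].
by split.
Qed.

Section Face.
Variables (R : realType) (m : nat).
Implicit Types (P Q : 'cV[R]_(1 + m) * R).

Section Coords.
Variables (P : 'cV[R]_(1 + m) * R).
Variables (r : 'rV[R]_(1 + m)) (B : 'M[R]_(1 + m, m)) (C : 'M[R]_(m, 1 + m)).
Hypotheses (rv : r *m P.1 = 1%:M) (rB : r *m B = 0) (Cv : C *m P.1 = 0).
Hypotheses (CB : C *m B = 1%:M) (vrBC : P.1 *m r + B *m C = 1%:M).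

Definition iota (u : 'rV[R]_m) : 'rV[R]_(1 + m) := P.2 *: r + u *m C.

Definition trace_plane Q : 'cV[R]_m * R :=
  (C *m Q.1, Q.2 - ((P.2 *: r) *m Q.1) 0 0).

(** Planes parallel to [P] are dropped: pulled back to [P] they have zero normal. *)
Definition trace_planes (s : seq ('cV[R]_(1 + m) * R)) :=
  [seq trace_plane Q | Q <- s & C *m Q.1 != 0].

Lemma iotaB u v : iota u - iota v = (u - v) *m C.
Proof. by rewrite /iota opprD addrACA subrr add0r mulmxBl. Qed.

Lemma iotaK u : iota u *m B = u.
Proof. by rewrite mulmxDl -scalemxAl rB scaler0 add0r -mulmxA CB mulmx1. Qed.

Lemma alt_iota u : alt P (iota u) = 0.
Proof.
by rewrite /alt mulmxDl -scalemxAl rv -mulmxA Cv mulmx0 addr0 !mxE mulr1 subrr.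
Qed.

Lemma iota_proj x : alt P x = 0 -> iota (x *m B) = x.
Proof.
move=> /eqP; rewrite subr_eq0 => /eqP Px.
rewrite /iota -[RHS]mulmx1 -vrBC mulmxDr -!mulmxA; congr (_ + _).
rewrite mulmxA [x *m P.1]mx11_scalar Px mul_scalar_mx//.
Qed.

Lemma alt_trace Q u : alt (trace_plane Q) u = alt Q (iota u).
Proof. by rewrite /alt /= mulmxDl mulmxA [in RHS]mxE; ring. Qed.

Lemma parallel_plane Q x : Q.1 != 0 -> C *m Q.1 = 0 -> alt P x = 0 ->
  alt Q x = 0 -> plane Q = plane P.
Proof.
move=> Q0 CQ Px Qx.
have E : Q.1 = ((r *m Q.1) 0 0) *: P.1.
  rewrite -{1}[Q.1]mul1mx -vrBC mulmxDl -!mulmxA CQ mulmx0 addr0.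
  by rewrite {1}[r *m Q.1]mx11_scalar mul_mx_scalar.
set k := (r *m Q.1) 0 0 in E.
have k0 : k != 0 by apply: contraNneq Q0 => k0; rewrite E k0 scale0r.
have H y : alt Q y = k * alt P y.
  rewrite -[LHS]subr0 -Qx -[alt P y]subr0 -Px !altB E -scalemxAr.
  by rewrite mxE.
apply/seteqP; split=> y; rewrite /plane /= H; last by move=> ->; rewrite mulr0.
by move=> /eqP; rewrite mulf_eq0 (negPf k0) /= => /eqP.
Qed.

Lemma plane_eq_trace Q : plane Q = plane P -> C *m Q.1 = 0.
Proof.
move=> E; have H u : alt Q (iota u) = 0.
  by have : plane Q (iota u) by rewrite E; exact: alt_iota.
apply/row_matrixP => i; rewrite row0 rowE mulmxA.
have := altB Q (iota (delta_mx 0 i)) (iota 0).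
rewrite !H subr0 iotaB subr0 => H0.
by apply/matrixP => j k; rewrite !ord1 -H0 mxE.
Qed.

Lemma trace_proper s : proper (trace_planes s).
Proof. by move=> Q' /mapP[Q]; rewrite mem_filter => /andP[CQ _] ->. Qed.

Lemma generic_trace s u Q : proper s -> generic (trace_planes s) u -> Q \in s ->
  alt Q (iota u) = 0 -> plane Q = plane P.
Proof.
move=> ps gu Qs Qu; have [CQ|CQ] := eqVneq (C *m Q.1) 0.
  exact: parallel_plane (ps _ Qs) CQ (alt_iota u) Qu.
have /gu : trace_plane Q \in trace_planes s.
  by apply: map_f; rewrite mem_filter CQ.
by rewrite alt_trace Qu eqxx.
Qed.

Lemma trace_generic s z : P \in s -> simple s z -> alt P z = 0 ->
  generic (trace_planes s) (z *m B).
Proof.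
move=> Ps sz Pz Q' /mapP[Q]; rewrite mem_filter => /andP[CQ Qs] ->.
rewrite alt_trace iota_proj//; apply: contra CQ => /eqP Qz; apply/eqP.
exact/plane_eq_trace/sz.
Qed.

Lemma iota_lip : exists2 K : R, 0 < K & forall u v,
  `|iota u - iota v| <= K * `|u - v|.
Proof.
have [K K0 HK] := mulmx_lipschitz C; exists K => // u v.
by rewrite iotaB.
Qed.

Lemma near_iota u (G : 'rV[R]_(1 + m) -> Prop) :
  (\forall x \near iota u, G x) -> \forall v \near u, G (iota v).
Proof.
move=> /near_norm[d d0 Hd]; have [K K0 HK] := iota_lip.
apply/near_norm; exists (d / K); first by rewrite divr_gt0.
move=> v; rewrite ltr_pdivlMr// mulrC => vu; apply: Hd.
exact: le_lt_trans (HK _ _) vu.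
Qed.

(** In the basis with rows [r] and [C], the matrix [A] is block triangular with diagonal blocks [c]
    and the map induced on [P]. *)
Lemma det_face (A : 'M[R]_(1 + m)) c : A *m P.1 = c *: P.1 ->
  \det A = c * \det (C *m A *m B).
Proof.
move=> Ac; have E1 : col_mx r C *m row_mx P.1 B = 1%:M.
  by rewrite mul_col_row rv rB Cv CB -scalar_mx_block.
have : \det (col_mx r C *m A *m row_mx P.1 B) = \det A.
  rewrite !det_mulmx mulrAC -det_mulmx E1 det1 mul1r//.
rewrite mul_col_mx mul_col_row -![_ *m A *m P.1]mulmxA Ac -!scalemxAr Cv
  scaler0.
by rewrite det_ublock rv scalemx1 det_scalar1 => <-.
Qed.

End Coords.
End Face.

(** * Replacing a function by its essential values *)

Section Regularize.
Variables (R : realType) (n : nat) (s : seq ('cV[R]_n * R)).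
Hypothesis ps : proper s.

(** Makes [tc_regular] available for traces; 0 is the default where no essential value exists. *)
Definition regularize (h : 'rV[R]_n -> R) x :=
  xget 0 [set v | essconst s h x v].

Lemma regularizeE h x v : essconst s h x v -> regularize h x = v.
Proof.
move=> hv; have : essconst s h x (regularize h x).
  by apply: (@xgetPex _ _ [set v | essconst s h x v]); exists v.
by move=> hr; exact: (essconst_uniq ps hr hv).
Qed.

Lemma regularize_neq0 h x : regularize h x != 0 ->
  essconst s h x (regularize h x).
Proof.
move=> h0; apply: contrapT => nh; move/eqP: h0; apply.
apply: (@xgetPN _ _ [set v | essconst s h x v]) => v hv.
by apply: nh; rewrite /= (regularizeE hv).
Qed.

End Regularize.

Section TraceChain.
Variables (R : realType) (m : nat).
Variables (s : seq ('cV[R]_(1 + m) * R)) (a : 'rV[R]_(1 + m) -> R).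
Variables (f : 'rV[R]_(1 + m) -> 'rV[R]_(1 + m)).
Variables (D : 'rV[R]_(1 + m) -> 'M[R]_(1 + m)).
Hypothesis T : tangent_chain s a f D.
Variables (P : 'cV[R]_(1 + m) * R).
Variables (r : 'rV[R]_(1 + m)) (B : 'M[R]_(1 + m, m)) (C : 'M[R]_(m, 1 + m)).
Hypotheses (rv : r *m P.1 = 1%:M) (rB : r *m B = 0) (Cv : C *m P.1 = 0).
Hypotheses (CB : C *m B = 1%:M) (vrBC : P.1 *m r + B *m C = 1%:M).
Hypothesis Ps : P \in s.
(* The coefficient of the trace on a face is a function psi of the jump of the
   chain across P and of the orientation of the map induced on P. *)
Variable psi : R -> R -> R.
Hypothesis psi0 : forall t, psi 0 t = 0.

Let ps := tc_proper T.
Let P0 : P.1 != 0. Proof. exact: ps. Qed.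
Let I := iota P r C.
Let s' := trace_planes P r C s.
Let ps' : proper s'. Proof. exact: trace_proper. Qed.

(** Unambiguous by [sides_uniq]. The default 0 applies where the chain has no one-sided values, as
    may happen where faces meet. *)
Definition jump (x : 'rV[R]_(1 + m)) : R :=
  xget 0 [set j | exists vp vm, sides a P x vp vm /\ j = vp - vm].

Lemma jumpE x vp vm : alt P x = 0 -> sides a P x vp vm -> jump x = vp - vm.
Proof.
move=> Px H; have : [set j | exists vp vm,
  sides a P x vp vm /\ j = vp - vm] (jump x).
  apply: (@xgetPex _ _ [set j | exists vp vm,
    sides a P x vp vm /\ j = vp - vm]).
  by exists (vp - vm); exists vp, vm.
move=> [wp [wm [H' ->]]].
by have [-> ->] := sides_uniq P0 Px H H'.
Qed.

Lemma near_jump u vp vm : sides a P (I u) vp vm ->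
  \forall v \near u, jump (I v) = vp - vm.
Proof.
move=> /sides_near/near_iota; apply: filterS => v H.
by apply: jumpE => //; exact: alt_iota.
Qed.

Definition trace_map u := f (I u) *m B.
Definition trace_diff u := C *m D (I u) *m B.
Definition trace_pre u := psi (jump (I u)) (Num.sg (\det (trace_diff u))).
Definition trace_chain := regularize s' trace_pre.

(** The last clause says that [D (I u)] preserves the directions of [P]. All three conditions are
    closed, so they persist at the corners of a face, where one-sided values may fail to exist. *)
Definition face_good u := csupp a (I u) /\ alt P (f (I u)) = 0 /\
  C *m D (I u) *m P.1 = 0.

Lemma face_good_closed u :
  (forall d, 0 < d -> exists2 v, face_good v & `|v - u| < d) -> face_good u.
Proof.
move=> H; have [L L0 HL] := iota_lip P r C.
have H' d : 0 < d -> exists2 v, face_good v & `|I v - I u| < d.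
  move=> d0; have [v gv vu] := H _ (divr_gt0 d0 L0); exists v => //.
  by rewrite (le_lt_trans (HL _ _))// mulrC -ltr_pdivlMr.
have Ku : csupp a (I u).
  apply: closed_closure; apply/closure_norm => d d0.
  by have [v [Kv _] vu] := H' d d0; exists (I v).
split=> //; split.
  apply: (csupp_closed_alt T Ku) => d d0.
  by have [v [Kv [Pv _]] vu] := H' d d0; exists (I v).
apply/eqP; rewrite -normr_le0; apply/ler_addgt0Pl => e e0; rewrite addr0.
have [L1 L10 HL1] := mulmx_lipschitz P.1.
have N0 : 0 < m.+1%:R * (`|C| + 1) * L1.
  by rewrite !mulr_gt0// ltr_pwDr.
have [d d0 Hd] := tc_cts T Ku (divr_gt0 e0 N0).
have [v [Kv [_ Dv]] vu] := H' d d0.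
have := Hd _ Kv vu => Dvu.
have -> : C *m D (I u) *m P.1 = - (C *m (D (I v) - D (I u)) *m P.1).
  by rewrite mulmxBr mulmxBl Dv sub0r opprK.
rewrite normrN (le_trans (HL1 _ _))// mulrC -ler_pdivlMr//.
rewrite (le_trans (normr_mulmx _ _))//.
apply: (@le_trans _ _ ((m.+1%:R * (`|C| + 1)) * (e / (m.+1%:R * (`|C| + 1) *
  L1)))).
  rewrite ler_pM ?mulr_ge0//; last exact: ltW.
  by rewrite ler_wpM2l// lerDl.
rewrite !invfM; set X := m.+1%:R * _.
have X0 : X != 0 by rewrite gt_eqF// /X mulr_gt0// ltr_pwDr.
have -> : X * (e * ((m.+1%:R)^-1 * (`|C| + 1)^-1 * L1^-1)) = (X / X) * (e / L1).
  by rewrite /X !invfM; ring.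
by rewrite mulfV// mul1r.
Qed.

(** The normal of [P] is an eigenvector of [D (I u)], so by [det_face] the induced determinant
    divides a nonzero one. *)
Lemma face_good_det u : face_good u -> \det (trace_diff u) != 0.
Proof.
move=> [Ku [_ Du]]; have := tc_det T Ku.
have E : D (I u) *m P.1 = ((r *m D (I u) *m P.1) 0 0) *: P.1.
  rewrite -{1}[D (I u)]mul1mx -vrBC mulmxDl mulmxDl -!mulmxA.
  rewrite [C *m (_ *m _)]mulmxA Du mulmx0 addr0.
  by rewrite {1}[r *m (_ *m _)]mx11_scalar mul_mx_scalar !mulmxA.
by rewrite (det_face rv rB Cv CB E) mulf_eq0 negb_or => /andP[].
Qed.

Lemma only_face u : (forall Q, Q \in s -> acc s a Q (I u) ->
  plane Q = plane P) ->
  exists vp vm, sides a P (I u) vp vm.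
Proof.
move=> H; have := only_acc T Ps H.
have Pu : alt P (I u) = 0 by exact: alt_iota.
move=> H1; apply: (two_sides T Ps Pu).
by apply: filterS H1 => y Hy /Hy[].
Qed.

Lemma face_good_sides u vp vm :
  (forall Q, Q \in s -> acc s a Q (I u) -> plane Q = plane P) ->
  sides a P (I u) vp vm -> vp <> vm -> face_good u.
Proof.
move=> H Hs vpm; have H1 := only_acc T Ps H.
have Pu : alt P (I u) = 0 by exact: alt_iota.
have nl : ~ locconst a (I u) by apply: nbhs_singleton (sides_nonlc T Ps Hs vpm)
  Pu.
have [c Dc] := face_eigen T Ps Pu H1 Hs vpm.
split; first exact: nonlc_csupp.
split; first by have [] := nbhs_singleton H1 nl.
by rewrite -mulmxA Dc -scalemxAr Cv scaler0.
Qed.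

Lemma trace_diff_cts u : face_good u -> forall e, 0 < e -> exists2 d, 0 < d &
  forall v, csupp a (I v) -> `|v - u| < d -> `|trace_diff v - trace_diff u| < e.
Proof.
move=> [Ku _] e e0; have [L L0 HL] := iota_lip P r C.
have [L1 L10 HL1] := mulmx_lipschitz B.
have N0 : 0 < m.+1%:R * (`|C| + 1) * L1.
  by rewrite !mulr_gt0// ltr_pwDr.
have [d d0 Hd] := tc_cts T Ku (divr_gt0 e0 N0).
exists (d / L); first by rewrite divr_gt0.
move=> v Kv; rewrite ltr_pdivlMr// mulrC => vu.
have /Hd Dv := le_lt_trans (HL v u) vu.
rewrite /trace_diff -mulmxBl -mulmxBr (le_lt_trans (HL1 _ _))//.
rewrite mulrC -ltr_pdivlMr// (le_lt_trans (normr_mulmx _ _))//.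
apply: (@le_lt_trans _ _ ((m.+1%:R * (`|C| + 1)) * `|D (I v) - D (I u)|)).
  by rewrite ler_wpM2r// ler_wpM2l// lerDl.
rewrite mulrC -ltr_pdivlMr ?mulr_gt0 ?ltr_pwDr//.
by move: (Dv Kv); rewrite !invfM !mulrA; congr (_ < _); ring.
Qed.

(** Away from other faces the jump is locally constant. If it is nonzero, so is the orientation of
    the induced map; if it is 0, [psi0] makes the orientation irrelevant. *)
Lemma trace_pre_const u vp vm :
  (forall Q, Q \in s -> acc s a Q (I u) -> plane Q = plane P) ->
  sides a P (I u) vp vm ->
  \forall v \near u, trace_pre v = psi (vp - vm) (Num.sg (\det (trace_diff u))).
Proof.
move=> H Hs; have Hj := near_jump Hs.
have [vpm|vpm] := eqVneq vp vm.
  by apply: filterS Hj => v; rewrite /trace_pre vpm subrr => ->; rewrite !psi0.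
have gu := face_good_sides H Hs (elimN eqP vpm).
have [e e0 He] := sg_det_near (face_good_det gu).
have [d d0 Hd] := trace_diff_cts gu e0.
have Hd' : \forall v \near u, `|v - u| < d by apply/near_norm; exists d.
have Hnl : \forall v \near u, csupp a (I v).
  have /near_iota := sides_nonlc T Ps Hs (elimN eqP vpm).
  apply: filterS => v nl; apply/nonlc_csupp/nl; exact: alt_iota.
near=> v; rewrite /trace_pre (_ : jump (I v) = vp - vm); last by near: v.
rewrite (He (trace_diff v))//; apply: Hd; by near: v.
Unshelve. all: by end_near. Qed.

Lemma trace_locconst u vp vm :
  (forall Q, Q \in s -> acc s a Q (I u) -> plane Q = plane P) ->
  sides a P (I u) vp vm ->
  trace_chain u = psi (vp - vm) (Num.sg (\det (trace_diff u))) /\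
  locconst trace_chain u.
Proof.
move=> H Hs; have /near_norm[d d0 Hd] := trace_pre_const H Hs.
have E v : `|v - u| < d ->
  trace_chain v = psi (vp - vm) (Num.sg (\det (trace_diff u))).
  move=> vu; apply: regularizeE => //.
  by apply: filterS (near_ball_norm vu) => w /Hd.
have Eu : trace_chain u = psi (vp - vm) (Num.sg (\det (trace_diff u))).
  by apply: E; rewrite subrr normr0.
by split=> //; apply/near_norm; exists d => // v /E ->.
Qed.

Lemma generic_only u : generic s' u ->
  forall Q, Q \in s -> acc s a Q (I u) -> plane Q = plane P.
Proof.
move=> gu Q Qs /acc_alt; exact: generic_trace rv Cv vrBC s u Q ps gu Qs.
Qed.

Lemma trace_generic_pre u : generic s' u -> trace_chain u = trace_pre u.
Proof.
move=> gu; have [vp [vm Hs]] := only_face (generic_only gu).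
have [-> _] := trace_locconst (generic_only gu) Hs.
by rewrite (nbhs_singleton (trace_pre_const (generic_only gu) Hs)).
Qed.

(** Points of the support are limits of generic points with nonzero jump, which are good by
    [face_good_sides]. *)
Lemma csupp_face_good u : csupp trace_chain u -> face_good u.
Proof.
move=> /closure_norm cu; apply: face_good_closed => d d0.
have d20 : 0 < d / 2 by rewrite divr_gt0.
have [v /= bv vu] := cu _ d20.
have /near_norm[e e0 He] := regularize_neq0 ps' bv.
have m0 : 0 < Num.min e (d / 2) by rewrite lt_min e0.
have [w] := generic_dense v ps' m0.
rewrite lt_min => /andP[we wd] gw; exists w; last first.
  rewrite -(subrKA v) (le_lt_trans (ler_normD _ _))//; lra.
have := He w we gw; have [vp [vm Hs]] := only_face (generic_only gw).
rewrite (nbhs_singleton (trace_pre_const (generic_only gw) Hs)) => E.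
apply: (face_good_sides (generic_only gw) Hs) => vpm.
by move: bv; rewrite /trace_chain -E vpm subrr psi0 eqxx.
Qed.

Lemma face_goodK u : face_good u -> I (trace_map u) = f (I u).
Proof. by move=> [_ [Pu _]]; exact: iota_proj. Qed.

(** The main point is tangency. Where the trace chain is not locally constant, a face in another
    plane [Q2] arrives. By [acc_alt_image] the image lies in [Q2], and it lies in [P] by
    [face_good], so it lies in the trace of [Q2]. *)
Theorem trace_tangent : tangent_chain s' trace_chain trace_map trace_diff.
Proof.
have [L L0 HL] := iota_lip P r C; have [LB LB0 HLB] := mulmx_lipschitz B.
split=> //.
- move=> u gu; have [vp [vm Hs]] := only_face (generic_only gu).
  by have [] := trace_locconst (generic_only gu) Hs.
- move=> u v Hv; apply: regularizeE => //.
  by apply: filterS Hv => w Hw gw; rewrite -(Hw gw) trace_generic_pre.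
- have [M HM] := tc_bounded T; exists (LB * (M + 1)) => u bu.
  have [Ku _] := csupp_face_good (csupp_supp bu).
  have [y ay yu] := (closure_norm _ _).1 Ku 1 ltr01.
  rewrite -(iotaK P rB CB u) (le_trans (HLB _ _))// ler_pM2l//.
  rewrite -(subrK y (iota P r C u)) (le_trans (ler_normD _ _))//.
  by rewrite distrC; have := HM y ay; move: yu; rewrite /I; lra.
- move=> u /csupp_face_good[Ku _] e e0.
  have [d d0 Hd] := tc_sdiff T Ku (divr_gt0 e0 (mulr_gt0 LB0 L0)).
  exists (d / L); first by rewrite divr_gt0.
  move=> p q /csupp_face_good[Kp _] /csupp_face_good[Kq _].
  rewrite !ltr_pdivlMr// ![_ * L]mulrC => pu qu.
  have := Hd _ _ Kp Kq (le_lt_trans (HL _ _) pu) (le_lt_trans (HL _ _) qu).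
  rewrite /trace_map /trace_diff => H.
  have -> : f (I p) *m B - f (I q) *m B - (p - q) *m (C *m D (I u) *m B) =
      (f (I p) - f (I q) - (I p - I q) *m D (I u)) *m B.
    by rewrite iotaB !mulmxBl !mulmxA.
  rewrite (le_trans (HLB _ _))// mulrC -ler_pdivlMr// (le_trans H)//.
  rewrite (@le_trans _ _ (e / (LB * L) * (L * `|p - q|)))//.
    by rewrite ler_wpM2l// ?divr_ge0 ?ltW// mulr_gt0.
  rewrite invfM; have -> : e * (LB^-1 / L) * (L * `|p - q|) =
    (e * `|p - q| / LB) * (L / L) by ring.
  by rewrite mulfV ?gt_eqF// mulr1.
- move=> u /csupp_face_good gu e e0.
  have [d d0 Hd] := trace_diff_cts gu e0.
  by exists d => // v /csupp_face_good[Kv _]; exact: Hd.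
- by move=> u /csupp_face_good; exact: face_good_det.
- move=> u Q' /[dup] Q's' /mapP[Q]; rewrite mem_filter =>
    /andP[CQ Qs] Q'E su Qu nl.
  have gu := csupp_face_good (nonlc_csupp nl).
  have [Q2 [Q2s Q2u nP]] : exists Q, [/\ Q \in s, acc s a Q (I u) &
    plane Q <> plane P].
    apply: contrapT => H; apply: nl.
    have H' Q0 : Q0 \in s -> acc s a Q0 (I u) -> plane Q0 = plane P.
      by move=> Q0s aQ; apply: contrapT => nP; apply: H; exists Q0.
    have [vp [vm Hs]] := only_face H'.
    by have [] := trace_locconst H' Hs.
  have Q2alt := acc_alt Q2u.
  have CQ2 : C *m Q2.1 != 0.
    apply/eqP => CQ2; apply: nP.
    exact: (parallel_plane vrBC (ps Q2s) CQ2 (alt_iota rv Cv u) Q2alt).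
  have Q2s' : trace_plane P r C Q2 \in s'.
    by apply: map_f; rewrite mem_filter CQ2.
  (* Simplicity of [u] identifies the trace of [Q2] with the given plane [Q']. *)
  have E : plane (trace_plane P r C Q2) = plane Q'.
    by apply: su => //; rewrite alt_trace.
  have : plane (trace_plane P r C Q2) (trace_map u).
    rewrite /plane /= alt_trace -/I face_goodK//.
    exact: acc_alt_image T _ _ Q2s Q2u.
  by rewrite E.
Qed.

End TraceChain.

(** * The degree theorem *)

Section Step.
Variables (R : realType) (m : nat).
Hypothesis IH : forall (s : seq ('cV[R]_m * R)) (a : 'rV[R]_m -> R)
  (f : 'rV[R]_m -> 'rV[R]_m) (D : 'rV[R]_m -> 'M[R]_m),
  tangent_chain s a f D -> forall y, generic s y -> dcount a f D y = a y.

Variables (s : seq ('cV[R]_(1 + m) * R)) (a : 'rV[R]_(1 + m) -> R).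
Variables (f : 'rV[R]_(1 + m) -> 'rV[R]_(1 + m)).
Variables (D : 'rV[R]_(1 + m) -> 'M[R]_(1 + m)).
Hypothesis T : tangent_chain s a f D.

Let ps := tc_proper T.
Let N := dcount a f D.
Let F (z : 'rV[R]_(1 + m)) := [set x | csupp a x /\ f x = z].

(** Faces are mapped into planes of [s], so every point over a generic [z] is interior to a cell and
    has an [interior_sheet]. *)
Lemma count_const_generic z : generic s z -> exists v, essconst s N z v.
Proof.
move=> gz; have [x0 Fx0|d d0 Hd] :=
  @count_sheets _ _ _ _ _ _ T z (fun=> True) (fun x _ => a x).
  have [Kx0 fx0] := Fx0.
  have l0 : locconst a x0.
    apply: contrapT => /(nonlc_acc T)[P Ps /(acc_alt_image T Ps)].
    by rewrite fx0; apply/eqP/gz.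
  have [r0 r00 Hr] := interior_sheet T Kx0 l0.
  exists r0 => // r rpos; have [d d0 Hd] := Hr r rpos.
  exists d => // y; rewrite -fx0 => /Hd[x [? ? ? ? ?]] _; by exists x.
eexists; apply/near_norm; exists d => // y yz _; exact: Hd.
Qed.

Section Crossing.
Variables (P : 'cV[R]_(1 + m) * R) (z : 'rV[R]_(1 + m)).
Hypotheses (Ps : P \in s) (Pz : alt P z = 0) (sz : simple s z).
Variables (r : 'rV[R]_(1 + m)) (B : 'M[R]_(1 + m, m)) (C : 'M[R]_(m, 1 + m)).
Hypotheses (rv : r *m P.1 = 1%:M) (rB : r *m B = 0) (Cv : C *m P.1 = 0).
Hypotheses (CB : C *m B = 1%:M) (vrBC : P.1 *m r + B *m C = 1%:M).

Let I := iota P r C.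
Let b := trace_chain s a D P r B C (fun j _ => j).
Let g := trace_map f P r B C.
Let E := trace_diff D P r B C.
Let P0 : P.1 != 0. Proof. exact: ps. Qed.
Let Tb : tangent_chain (trace_planes P r C s) b g E.
Proof. exact: trace_tangent. Qed.

Lemma trace_at x vp vm : alt P x = 0 ->
  (forall Q, Q \in s -> acc s a Q x -> plane Q = plane P) ->
  sides a P x vp vm -> b (x *m B) = vp - vm.
Proof.
move=> Px; have Ix : I (x *m B) = x by exact: iota_proj.
rewrite -{1 2}Ix => oa Hs.
by case: (trace_locconst T rv rB Cv CB vrBC Ps
  (psi := fun j _ => j) (fun=> erefl) oa Hs).
Qed.

Lemma sides_at x : alt P x = 0 ->
  (forall Q, Q \in s -> acc s a Q x -> plane Q = plane P) ->
  exists vp vm, sides a P x vp vm.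
Proof.
move=> Px oa; apply: (two_sides T Ps Px).
by apply: filterS (only_acc T Ps oa) => y Hy /Hy[].
Qed.

(** A face in [Q] is mapped into [Q], so [z] lies in [Q], and [z] is simple. *)
Lemma fiber_only_acc x0 : F z x0 ->
  forall Q, Q \in s -> acc s a Q x0 -> plane Q = plane P.
Proof.
move=> [Kx0 fx0] Q Qs /(acc_alt_image T Qs); rewrite fx0 => Qz.
exact: sz.
Qed.

Let term x0 := if alt P x0 == 0 then
  b (x0 *m B) * Num.sg (\det (E (x0 *m B))) else 0.

(** An interior point has the same coefficient on both sides and contributes no change. At a face,
    the sign of [det D] is that of [c] times that of the face map; when [c < 0] the sides are
    exchanged too, and the two signs cancel. *)
Lemma crossing_sheet x0 : F z x0 -> exists ap am,
  (ap - am) * Num.sg (\det (D x0)) = term x0 /\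
  exists2 r0, 0 < r0 & forall r, 0 < r -> exists2 d, 0 < d & forall y,
    `|y - z| < d -> alt P y != 0 -> exists x, [/\ `|x - x0| < r,
      a x = (if 0 < alt P y then ap else am),
      a x != 0 -> f x = y,
      a x != 0 -> Num.sg (\det (D x)) = Num.sg (\det (D x0)) &
      forall x', csupp a x' -> `|x' - x0| < r0 -> f x' = y -> x' = x].
Proof.
move=> Fx0; have [Kx0 fx0] := Fx0; have oa := fiber_only_acc Fx0.
have [l0|n0] := pselect (locconst a x0).
  exists (a x0), (a x0); split.
    rewrite subrr mul0r /term; case: eqP => // Px0.
    have Hs : sides a P x0 (a x0) (a x0) by apply: filterS l0.
    by rewrite (trace_at Px0 oa Hs) subrr mul0r.
  have [r0 r00 Hr] := interior_sheet T Kx0 l0.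
  exists r0 => // r' rpos; have [d d0 Hd] := Hr r' rpos.
  exists d => // y; rewrite -fx0 => /Hd[x [? ? ? ? ?]] _; exists x.
  by split=> //; case: ifP.
have Px0 : alt P x0 = 0.
  have [Q Qs aQ] := nonlc_acc T n0; have Qx0 := acc_alt aQ.
  have : plane Q x0 by [].
  by rewrite (oa _ Qs aQ).
have Ix0 : I (x0 *m B) = x0 by exact: iota_proj.
have [vp [vm Hs]] := sides_at Px0 oa.
have vpm : vp <> vm by move=> vpm; apply: n0; exact: (sides_eq T Ps Hs vpm).
have H1 := only_acc T Ps oa.
have [c Dc] := face_eigen T Ps Px0 H1 Hs vpm.
have dE := det_face rv rB Cv CB Dc.
have c0 : c != 0.
  by have := tc_det T Kx0; rewrite dE mulf_eq0 negb_or => /andP[].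
have tE : term x0 = (vp - vm) * Num.sg (\det (E (x0 *m B))).
  by rewrite /term Px0 eqxx (trace_at Px0 oa Hs).
have EE : E (x0 *m B) = C *m D x0 *m B by rewrite /E /trace_diff -/I Ix0.
have [r0 r00 Hr] := face_sheet T Ps Px0 H1 Hs vpm Dc.
case: (ltrgtP c 0) c0 => // c1 _.
  exists vm, vp; split.
    by rewrite tE EE dE sgrM ltr0_sg//; ring.
  exists r0 => // r' rpos; have [d d0 Hd] := Hr r' rpos.
  exists d => // y; rewrite -fx0 => /Hd H Py; have [x [? ax ? ? ?]] := H Py.
  exists x; split=> //; rewrite ax nmulr_rgt0//.
  by case: (ltrgtP (alt P y) 0) Py.
exists vp, vm; split.
  by rewrite tE EE dE sgrM gtr0_sg//; ring.
exists r0 => // r' rpos; have [d d0 Hd] := Hr r' rpos.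
exists d => // y; rewrite -fx0 => /Hd H Py; have [x [? ax ? ? ?]] := H Py.
by exists x; split=> //; rewrite ax pmulr_rgt0.
Qed.

(** [iota] sends the weighted points of the face count to points of the fiber on [P]; the other
    points of the fiber have zero term. *)
Lemma sum_terms : \sum_(x0 \in F z) term x0 = dcount b g E (z *m B).
Proof.
pose U := [set u | g u = z *m B /\ b u != 0].
pose w u := b u * Num.sg (\det (E u)).
have -> : dcount b g E (z *m B) = \sum_(u \in U) w u.
  apply/esym/fsbig_widen => [u []//|u [gu nU]].
  rewrite /preimage /= /w; have [->|bu] := eqVneq (b u) 0;
    first by rewrite mul0r.
  by case: nU.
have UI u : U u -> F z (I u).
  move=> [gu bu]; have fg := csupp_face_good T rv rB Cv CB vrBC Ps
    (psi := fun j _ => j) (fun=> erefl) (csupp_supp bu).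
  split; first by case: fg.
  by rewrite -(face_goodK vrBC fg) -/g gu; exact: iota_proj.
have Ik u : I u *m B = u by exact: iotaK.
have -> : \sum_(u \in U) w u = \sum_(x \in I @` U) term x.
  rewrite fsbig_image; last first.
    by move=> u v _ _ E'; rewrite -(Ik u) E' Ik.
  by apply: eq_fsbigr => u _; rewrite /term alt_iota// eqxx Ik.
apply/esym/fsbig_widen => [_ [u Uu <-]|x [Fx nU]]; first exact: UI.
rewrite /preimage /= /term; case: eqP => // Px.
have [->|bu] := eqVneq (b (x *m B)) 0; first by rewrite mul0r.
have Ix : I (x *m B) = x by exact: iota_proj.
case: nU; exists (x *m B) => //; split=> //.
by rewrite /g /trace_map -/I Ix; case: Fx => _ ->.
Qed.

(* Moving y across P at z changes the count by the degree at z of the face map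
   of P, applied to the jumps of the chain; by induction on the dimension it is
   the jump of the chain at z. *)
Lemma count_crossing : exists v, essconst s (fun y => N y - a y) z v.
Proof.
have /choice[ap Hap] : forall x0, exists ap, F z x0 -> exists am,
  (ap - am) * Num.sg (\det (D x0)) = term x0 /\
  exists2 r0, 0 < r0 & forall r, 0 < r -> exists2 d, 0 < d & forall y,
    `|y - z| < d -> alt P y != 0 -> exists x, [/\ `|x - x0| < r,
      a x = (if 0 < alt P y then ap else am),
      a x != 0 -> f x = y,
      a x != 0 -> Num.sg (\det (D x)) = Num.sg (\det (D x0)) &
      forall x', csupp a x' -> `|x' - x0| < r0 -> f x' = y -> x' = x].
  move=> x0; case: (pselect (F z x0)) => [/crossing_sheet[p H]|];
    last by exists 0.
  by exists p.
have /choice[am Ham] : forall x0, exists am, F z x0 ->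
  (ap x0 - am) * Num.sg (\det (D x0)) = term x0 /\
  exists2 r0, 0 < r0 & forall r, 0 < r -> exists2 d, 0 < d & forall y,
    `|y - z| < d -> alt P y != 0 -> exists x, [/\ `|x - x0| < r,
      a x = (if 0 < alt P y then ap x0 else am),
      a x != 0 -> f x = y,
      a x != 0 -> Num.sg (\det (D x)) = Num.sg (\det (D x0)) &
      forall x', csupp a x' -> `|x' - x0| < r0 -> f x' = y -> x' = x].
  move=> x0; case: (pselect (F z x0)) => [/Hap[q H]|]; last by exists 0.
  by exists q.
have [|d d0 Hd] := @count_sheets _ _ _ _ _ _ T z (fun y => alt P y != 0)
  (fun x0 y => if 0 < alt P y then ap x0 else am x0).
  by move=> x0 /Ham[].
have finF : finite_set (F z).
  exact: fiber_finite (csupp_compact T) (tc_sdiff T) (tc_det T) z.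
have oz Q : Q \in s -> acc s a Q z -> plane Q = plane P.
  by move=> Qs /acc_alt Qz; exact: sz.
have [vp [vm Hs]] := sides_at Pz oz.
have gz := trace_generic rv Cv vrBC Ps sz Pz.
have bz := trace_at Pz oz Hs.
have key : \sum_(x0 \in F z) ap x0 * Num.sg (\det (D x0)) - vp =
           \sum_(x0 \in F z) am x0 * Num.sg (\det (D x0)) - vm.
  have -> : \sum_(x0 \in F z) ap x0 * Num.sg (\det (D x0)) =
      \sum_(x0 \in F z) am x0 * Num.sg (\det (D x0)) + \sum_(x0 \in F z) term
        x0.
    rewrite -fsbig_split//; apply: eq_fsbigr => x0 /set_mem /Ham[<- _] /=; ring.
  rewrite sum_terms (IH Tb gz) bz; ring.
exists (\sum_(x0 \in F z) ap x0 * Num.sg (\det (D x0)) - vp).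
move/near_norm: Hs => [d' d'0 Hd'].
apply/near_norm; exists (Num.min d d'); first by rewrite lt_min d0.
move=> y; rewrite lt_min => /andP[yd yd'] gy.
have Py := gy P Ps; rewrite /N Hd//.
case: (ltrgtP (alt P y) 0) Py => // Py _.
  by rewrite (Hd' y yd').2// key.
by rewrite (Hd' y yd').1.
Qed.

End Crossing.

Lemma count_minus_const z : simple s z -> exists v, essconst s (fun y =>
  N y - a y) z v.
Proof.
move=> sz; have [gz|ngz] := pselect (generic s z).
  have [v Hv] := count_const_generic gz.
  exists (v - a z); apply: filterS2 Hv (tc_generic T gz) => y Ny ay gy.
  by rewrite Ny// ay.
have [P [Ps Pz]] : exists P, P \in s /\ alt P z = 0.
  apply: contrapT => H; apply: ngz => P Ps; apply/eqP => Pz; apply: H;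
    by exists P.
have [r [B [C [rv rB Cv CB vrBC]]]] := hyperplane_coords (ps Ps).
exact: (count_crossing Ps Pz sz rv rB Cv CB vrBC).
Qed.

Lemma far_generic : exists2 y, generic s y & N y = 0 /\ a y = 0.
Proof.
have [M HM] := tc_bounded T.
have cf : compact (f @` csupp a).
  by apply: continuous_compact (csupp_compact T);
    exact: sdiff_within (tc_sdiff T).
have [M' [_ HM']] := compact_bounded cf.
pose L := Num.max M (M' + 1) + 1.
(* A perturbation by less than 1 leaves the entries of [y], hence its norm, above [|L|]. *)
have [y yL gy] := @generic_dense _ _ s (const_mx (`|L| + 1)) _ ps ltr01.
have yL' : `|L| < `|y|.
  have := normr_entry y 0 0; have := normr_entry (y - const_mx (`|L| + 1)) 0 0.
  rewrite !mxE => h1 h2; have := le_lt_trans h1 yL.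
  rewrite ltr_norml => /andP[h3 h4]; have := ler_norm (y 0 0); lra.
have LL := ler_norm L.
have LM : M < L.
  by rewrite /L; have : M <= Num.max M (M' + 1) by [rewrite le_max lexx]; lra.
have LM' : M' + 1 < L.
  by rewrite /L; have : M' + 1 <= Num.max M (M' + 1) by [rewrite le_max lexx
    orbT]; lra.
exists y => //; split.
  rewrite /N /dcount fsbig1// => x /= fx.
  have [->|ax] := eqVneq (a x) 0; first by rewrite mul0r.
  have : `|y| <= M' + 1.
    apply: (HM' (M' + 1)); first lra.
    by exists x => //; exact: csupp_supp.
  lra.
apply: contrapT => /eqP /HM; lra.
Qed.

(** [N - a] has an essential value at every simple point, hence a single value on generic points,
    which [far_generic] shows to be 0. *)
Lemma degree_step y : generic s y -> N y = a y.
Proof.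
move=> gy; have [y0 gy0 [N0 a0]] := far_generic.
apply/eqP; rewrite -subr_eq0; apply/eqP.
rewrite -[RHS](_ : N y0 - a y0 = 0); last by rewrite N0 a0 subrr.
apply: (@essconst_convex _ _ s (fun y => N y - a y) setT ps) => //.
- by move=> x _; apply/near_norm; exists 1.
- by move=> x _; exact: count_minus_const.
Qed.

End Step.

Theorem degree (R : realType) n (s : seq ('cV[R]_n * R)) (a : 'rV[R]_n -> R)
    (f : 'rV[R]_n -> 'rV[R]_n) (D : 'rV[R]_n -> 'M[R]_n) :
  tangent_chain s a f D -> forall y, generic s y -> dcount a f D y = a y.
Proof.
elim: n s a f D => [|m IH] s a f D T y gy; last exact: (degree_step IH T).
(* In dimension 0 there is one point, and the empty determinant is 1. *)
rewrite /dcount (_ : [set x | f x = y] = [set y]).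
  by rewrite fsbig_set1 det_mx00 sgr1 mulr1.
by apply/seteqP; split=> x _;
  exact: flatmx0 || rewrite /= [LHS]thinmx0 [RHS]thinmx0.
Qed.

(** * Polyhedra *)

Section Polyhedron.
Variables (R : realType) (n : nat).

Lemma sum_setT (V : nmodType) m (F : 'I_m -> V) :
  \sum_(i in [set: 'I_m]%SET) F i = \sum_i F i.
Proof. by apply: eq_bigl => i; rewrite finset.in_setT. Qed.

Lemma hull_bounded m (v : 'I_m -> 'rV[R]_n) (I : {set 'I_m}) y :
  hull v I y -> `|y| <= \sum_i `|v i|.
Proof.
move=> [t [t0 t1 ->]]; rewrite (le_trans (ler_norm_sum _ _ _))//.
rewrite (@le_trans _ _ (\sum_(i in I) `|v i|))//.
  apply: ler_sum => i iI; rewrite normrZ ger0_norm// ler_piMl//.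
  by rewrite -t1 (bigD1 i)//= lerDl sumr_ge0.
by rewrite [leRHS](bigID (mem I))/= lerDl sumr_ge0.
Qed.

Lemma kernel_hyperplane (c : 'cV[R]_n) : c != 0 ->
  exists2 V : {vspace 'rV[R]_n}, (\dim V).+1 = n & forall y,
    (y \in V) = (y *m c == 0).
Proof.
move=> c0; pose f := linfun (mulmxr c : 'rV[R]_n -> 'rV[R]_1).
exists (lker f); last by move=> y; rewrite memv_ker lfunE.
have := limg_ker_dim f fullv; rewrite capfv dimvf dim_matrix. rewrite mul1r.
suff -> : \dim (limg f) = 1%N by rewrite addn1.
apply/eqP; rewrite eqn_leq; apply/andP; split.
  by rewrite (leq_trans (dimvS (subvf _)))// dimvf dim_matrix.
rewrite lt0n dimv_eq0; apply: contra c0 => /eqP f0.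
apply/eqP/row_matrixP => i; rewrite row0 rowE.
have : f (delta_mx 0 i) \in limg f by apply: memv_img; exact: memvf.
by rewrite f0 memv0 lfunE /= => /eqP.
Qed.

Variables (v : 'I_n.+1 -> 'rV[R]_n) (S : set 'rV[R]_n).
Hypothesis sv : is_simplex v S.

Let W : 'M[R]_n := \matrix_(i < n) (v (lift ord0 i) - v ord0).

Lemma hull_coords (t : 'I_n.+1 -> R) : \sum_i t i = 1 ->
  \sum_i t i *: v i = v ord0 + (\row_i t (lift ord0 i)) *m W.
Proof.
move=> t1; rewrite mulmx_sum_row.
have -> : \sum_i t i *: v i = v ord0 + \sum_i t i *: (v i - v ord0).
  under [X in _ = _ + X]eq_bigr do rewrite scalerBr.
  by rewrite sumrB -scaler_suml t1 scale1r addrC subrK.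
congr (_ + _); rewrite big_ord_recl subrr scaler0 add0r.
by apply: eq_bigr => i _; rewrite mxE rowK.
Qed.

(** If the edges were dependent, a nonzero normal would annihilate them all and the simplex would
    lie in a hyperplane. *)
Lemma simplex_unitmx : W \in unitmx.
Proof.
have [SE nS] := sv; rewrite unitmxE unitfE; apply/negP => /eqP dW.
have : \det W^T == 0 by rewrite det_tr dW.
move/det0P => [w w0 wW].
have c0 : w^T != 0 by rewrite -trmx0 (inj_eq trmx_inj).
have Wc : W *m w^T = 0.
  by apply: trmx_inj; rewrite trmx_mul trmxK wW trmx0.
have [V dV HV] := kernel_hyperplane c0.
apply: (nS (v ord0) V dV) => y; rewrite SE => -[t [_ t1 ->]] /=.
rewrite sum_setT in t1; rewrite sum_setT hull_coords// HV addrC addKr.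
by rewrite -mulmxA Wc mulmx0.
Qed.

(** The height is the barycentric coordinate of the vertex [lift ord0 i]; for [opposite_plane] it is
    minus the coordinate of [ord0]. *)
Definition facet_plane (i : 'I_n) : 'cV[R]_n * R :=
  (col i (invmx W), (v ord0 *m invmx W) 0 i).

Definition opposite_plane : 'cV[R]_n * R :=
  (invmx W *m const_mx 1, (v ord0 *m invmx W *m const_mx 1 : 'M[R]_1) 0 0 + 1).

Definition simplex_planes :=
  opposite_plane :: [seq facet_plane i | i <- enum 'I_n].

Lemma facet_planeE i x : alt (facet_plane i) x = ((x - v ord0) *m invmx W) 0 i.
Proof.
rewrite /alt /= -[in LHS](mulmx1 x) -mulmxA mul1mx mulmxBl !mxE; congr (_ - _).
by apply: eq_bigr => k _; rewrite !mxE.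
Qed.

Lemma opposite_planeE x :
  alt opposite_plane x = \sum_i ((x - v ord0) *m invmx W) 0 i - 1.
Proof.
rewrite /alt /= opprD addrA; congr (_ - _); rewrite mulmxA.
rewrite (_ : _ - _ = ((x - v ord0) *m invmx W *m const_mx 1 : 'M[R]_1) 0 0).
  by rewrite mxE; apply: eq_bigr => k _; rewrite [const_mx _ _ _]mxE mulr1.
by rewrite !mulmxBl [RHS]mxE [X in _ = _ + X]mxE.
Qed.

Lemma simplex_planes_proper : (0 < n)%N -> proper simplex_planes.
Proof.
move=> n0 P; rewrite inE => /orP[/eqP->|/mapP[i _ ->]] /=.
  apply/eqP => /(congr1 (mulmx W)); rewrite mulKVmx ?simplex_unitmx// mulmx0.
  move=> /matrixP/(_ (Ordinal n0) 0); rewrite !mxE => /eqP.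
  by rewrite oner_eq0.
apply/eqP; rewrite colE => /(congr1 (mulmx W)).
rewrite mulKVmx ?simplex_unitmx// mulmx0 => /matrixP/(_ i 0).
by rewrite !mxE !eqxx => /eqP; rewrite oner_eq0.
Qed.

Lemma simplexP x : S x <->
  (forall i, 0 <= alt (facet_plane i) x) /\ alt opposite_plane x <= 0.
Proof.
have [SE _] := sv; rewrite SE; split.
  move=> [t [t0 T1 ->]]; rewrite sum_setT in T1.
  rewrite sum_setT hull_coords//; set tau := \row_i _.
  have E : (v ord0 + tau *m W - v ord0) *m invmx W = tau.
    by rewrite [v ord0 + _]addrC addrK mulmxK// simplex_unitmx.
  split=> [i|]; first by rewrite facet_planeE E mxE.
  rewrite opposite_planeE E subr_le0 -[leRHS]T1 big_ord_recl.
  under eq_bigr do rewrite mxE.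
  by rewrite lerDr.
move=> [H0 H1]; pose tau := (x - v ord0) *m invmx W.
have tau0 i : 0 <= tau 0 i by rewrite -facet_planeE.
have tau1 : \sum_i tau 0 i <= 1 by rewrite -subr_le0 -opposite_planeE.
pose t (i : 'I_n.+1) :=
  if unlift ord0 i is Some j then tau 0 j else 1 - \sum_i tau 0 i.
have tl j : t (lift ord0 j) = tau 0 j by rewrite /t liftK.
have t00 : t ord0 = 1 - \sum_i tau 0 i by rewrite /t unlift_none.
have T1 : \sum_i t i = 1.
  rewrite big_ord_recl t00 -[RHS](subrK (\sum_i tau 0 i)); congr (_ + _).
  by apply: eq_bigr => i _; exact: tl.
exists t; split.
- move=> i; case: (unliftP ord0 i) => [j ->|->]; first by rewrite tl.
  by rewrite t00 subr_ge0.
- by rewrite sum_setT.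
- rewrite sum_setT hull_coords//; have -> : \row_i t (lift ord0 i) = tau.
    by apply/rowP => i; rewrite mxE tl.
  by rewrite /tau mulmxKV ?simplex_unitmx// addrC subrK.
Qed.

Lemma simplex_generic x : S x -> generic simplex_planes x -> \forall y \near x,
  S y.
Proof.
move=> /simplexP[H0 H1] gx.
have h1 : 0 < -1 * alt opposite_plane x.
  by rewrite mulN1r oppr_gt0 lt_neqAle H1 andbT; apply: gx; rewrite inE eqxx.
have h0 i : 0 < 1 * alt (facet_plane i) x.
  rewrite mul1r lt_neqAle H0 andbT eq_sym; apply: gx.
  by rewrite inE map_f ?orbT// mem_enum.
have : \forall y \near x, forall i, i \in enum 'I_n ->
  0 < 1 * alt (facet_plane i) y.
  by apply: near_seq => i _; exact: near_alt_pos.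
move: (near_alt_pos h1); apply: filterS2 => y Hy1 Hy0; apply/simplexP; split.
  by move=> i; have := Hy0 i; rewrite mem_enum mul1r => /(_ isT)/ltW.
by rewrite -oppr_ge0 -mulN1r ltW.
Qed.

End Polyhedron.

(** The arrangement consists of the facet planes of all simplices; off them a point is interior to
    its simplex. *)
Lemma polyhedron_planes (R : realType) n (K : set 'rV[R]_n) : (0 < n)%N ->
  bounded_polyhedron K -> exists2 s : seq ('cV[R]_n * R), proper s &
    forall x, K x -> generic s x -> \forall y \near x, K y.
Proof.
move=> n0 [l [S [v [Sv -> _]]]].
exists (flatten [seq simplex_planes (v i) | i <- enum 'I_l]).
  move=> P /flattenP[_ /mapP[i _ ->]] Pi.
  exact: (simplex_planes_proper (Sv i) n0 Pi).
move=> x [i _ Six] gx; have : \forall y \near x, S i y.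
  apply: (simplex_generic (Sv i)) => // P Pi; apply: gx; apply/flattenP.
  by exists (simplex_planes (v i)) => //; apply: map_f; rewrite mem_enum.
by apply: filterS => y Siy; exists i.
Qed.

Lemma polyhedron_bounded (R : realType) n (K : set 'rV[R]_n) :
  bounded_polyhedron K -> exists M : R, forall x, K x -> `|x| <= M.
Proof.
move=> [l [S [v [Sv -> _]]]]; exists (\sum_(i < l) \sum_j `|v i j|).
move=> x [i _]; have [-> _] := Sv i => /hull_bounded /le_trans; apply.
by rewrite (bigD1 i)//= lerDl sumr_ge0// => j _; exact: sumr_ge0.
Qed.

(** * Lipschitz domains *)

Section LipschitzDomain.
Variables (R : realType) (n : nat).
Implicit Types (Omega : set 'rV[R]_n) (x y : 'rV[R]_n).

Lemma dotp_mulmx x y : dotp x y = (x *m y^T) 0 0.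
Proof. by rewrite mxE; apply: eq_bigr => i _; rewrite mxE. Qed.

Lemma lipschitz_bound (g : 'rV[R]_n -> R) : lipschitz g ->
  exists2 L : R, 0 < L & forall x y, `|g x - g y| <= L * `|x - y|.
Proof.
move=> [M [_ HM]]; exists (`|M| + 1); first by rewrite ltr_pwDr.
move=> x y; apply: (HM (`|M| + 1) _ (x, y)) => //=.
have := ler_norm M; lra.
Qed.

(* k is the height above the graph of g. *)
Lemma chart_height Omega x (e : 'rV[R]_n) (g : 'rV[R]_n ->
  R) : lipschitz_chart Omega x e g ->
  exists2 k : 'rV[R]_n -> R,
    (exists2 L : R, 0 < L & forall p q, `|k p - k q| <= L * `|p - q|) /\
    (forall p t, k (p + t *: e) = k p + t) &
    exists2 d, 0 < d & forall y, `|y - x| < d -> (Omega y <-> 0 < k y).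
Proof.
move=> [e1 /lipschitz_bound[L L0 HL] /near_norm[d d0 Hd]].
have ee : dotp e e = 1.
  have : 0 <= dotp e e by apply: sumr_ge0 => i _; rewrite -expr2 sqr_ge0.
  by move=> /sqr_sqrtr; rewrite -/(enorm e) e1 expr1n.
exists (fun y => dotp y e - g (horizontal e y)); last first.
  by exists d => // y /Hd ->; rewrite subr_gt0.
have dL p q : `|dotp p e - dotp q e| <= n%:R * `|e^T| * `|p - q|.
  rewrite !dotp_mulmx; have ->
    : (p *m e^T) 0 0 - (q *m e^T) 0 0 = ((p - q) *m e^T) 0 0.
    by rewrite mulmxBl [RHS]mxE [X in _ = _ + X]mxE.
  rewrite (le_trans (normr_entry _ _ _))// (le_trans (normr_mulmx _ _))//.
  by rewrite mulrAC.
split.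
  pose M := n%:R * `|e^T|; have M0 : 0 <= M by rewrite mulr_ge0.
  exists (M + L * (1 + M * `|e|)).
    by rewrite ltr_wpDl// mulr_gt0// ltr_pwDl// mulr_ge0.
  move=> p q; rewrite opprD addrACA (le_trans (ler_normD _ _))// mulrDl.
  apply: lerD; first exact: dL.
  rewrite -opprD normrN (le_trans (HL _ _))// -mulrA ler_pM2l//.
  have -> : horizontal e p - horizontal e q = (p - q) - (dotp p e - dotp q e) *:
    e.
    by rewrite /horizontal; apply/matrixP => i j; rewrite !mxE; ring.
  rewrite (le_trans (ler_normB _ _))// mulrDl mul1r lerD2l normrZ mulrAC.
  by rewrite ler_wpM2r// dL.
move=> p t; have dt : dotp (p + t *: e) e = dotp p e + t.
  rewrite /dotp -[in RHS](mulr1 t) -ee /dotp mulr_sumr -big_split /=.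
  by apply: eq_bigr => i _; rewrite !mxE; ring.
have -> : horizontal e (p + t *: e) = horizontal e p.
  by rewrite /horizontal dt; apply/matrixP => i j; rewrite !mxE; ring.
by rewrite dt addrAC.
Qed.

Variable Omega : set 'rV[R]_n.
Hypothesis lO : lipschitz_domain Omega.

Lemma boundary_open x : closure Omega x -> ~ Omega x -> boundary Omega x.
Proof. by move=> cx nx; split=> // /interior_subset. Qed.

(** Slits are impossible: from a boundary point, a move down the axis of a chart reaches a point
    strictly below the graph, which has a neighbourhood disjoint from [Omega]. *)
Lemma interior_closure_lipschitz x : (\forall y \near x, closure Omega y) ->
  Omega x.
Proof.
move=> /near_norm[d1 d10 Hd1]; apply: contrapT => nx.
have cx : closure Omega x by apply: Hd1; rewrite subrr normr0.
have [e [g /chart_height[k [[L L0 kL] ke] [d d0 Hd]]]] :=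
  lO.2 x (boundary_open cx nx).
have kx : k x <= 0.
  rewrite leNgt; apply/negP => k0; apply: nx; apply/(Hd x) => //.
  by rewrite subrr normr0.
have N0 : 0 < `|e| + 1 by rewrite ltr_pwDr.
pose t := Num.min d d1 / 2 / (`|e| + 1).
have m0 : 0 < Num.min d d1 by rewrite lt_min d0.
have t0 : 0 < t by rewrite !divr_gt0.
pose y := x + (- t) *: e.
have yx : `|y - x| < Num.min d d1.
  rewrite /y addrC addKr normrZ normrN gtr0_norm// /t mulrAC ltr_pdivrMr//.
  have := normr_ge0 e; nra.
have ky : k y < 0 by rewrite ke; lra.
move: (yx); rewrite lt_min => /andP[yd yd1].
have := Hd1 y yd1 => /closure_norm.
pose m := Num.min (d - `|y - x|) (- k y / L).
have mpos : 0 < m by rewrite lt_min subr_gt0 yd divr_gt0// oppr_gt0.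
move=> /(_ m mpos)[z Oz]; rewrite lt_min => /andP[zd zk].
have zx : `|z - x| < d.
  by rewrite -(subrKA y) (le_lt_trans (ler_normD _ _))//; lra.
have := (Hd z zx).1 Oz.
have := kL z y; move: zk; rewrite ltr_pdivlMr// mulrC => zk.
by move=> /le_lt_trans/(_ zk); rewrite ltr_norml => /andP[_]; lra.
Qed.

(* Lift the segment [p, q] along the axis of the chart by a multiple of its
   length, so that it clears the graph. *)
Lemma short_paths x : closure Omega x -> exists2 C : R, 0 < C & exists2 d,
  0 < d &
  forall p q, Omega p -> Omega q -> `|p - x| < d -> `|q - x| < d ->
  exists w1 w2, [/\ `|w1 - p| <= C * `|p - q|, `|w2 - w1| <= C * `|p - q|,
    `|q - w2| <= C * `|p - q| &
    forall t, 0 <= t <= 1 -> [/\ Omega (p + t *: (w1 - p)),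
      Omega (w1 + t *: (w2 - w1)) & Omega (w2 + t *: (q - w2))]].
Proof.
move=> cx; have [Ox|nx] := pselect (Omega x).
  have /open_norm/(_ x Ox)[d d0 Hd] := lO.1.
  exists 1 => //; exists d => // p q Op Oq px qx; exists p, q.
  rewrite !subrr normr0 distrC mul1r lexx normr_ge0; split=> // t t01.
  rewrite !scaler0 !addr0; split=> //; apply: Hd; exact: ball_convex.
have [e [g /chart_height[k [[L L0 kL] ke] [d d0 Hd]]]] :=
  lO.2 x (boundary_open cx nx).
pose N := L * `|e|; have N0 : 0 <= N by rewrite mulr_ge0// ltW.
exists (1 + N); first by rewrite ltr_wpDr.
(* Points within [r] of [x] are less than [2 r] apart, so the lift is shorter than [2 N r] and the
   path stays within [(2 N + 1) r] of [x]. *)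
exists (d / (2 * N + 3)); first by rewrite divr_gt0//; lra.
move=> p q Op Oq; rewrite !ltr_pdivlMr; try lra; move=> px qx.
(* Along the segment the height drops by at most [L * l], so lifting by [s] keeps it positive. *)
pose l := `|p - q|; pose s := L * l.
have pq : l <= `|p - x| + `|q - x|.
  by rewrite /l -(subrKA x) (distrC q x) ler_normD.
have l0 : 0 <= l := normr_ge0 _.
have pd : `|p - x| < d by have := normr_ge0 (p - x); nra.
have qd : `|q - x| < d by have := normr_ge0 (q - x); nra.
have kp : 0 < k p by apply/(Hd p).
have kq : 0 < k q by apply/(Hd q).
have s0 : 0 <= s by rewrite mulr_ge0// ltW.
have se : `|s *: e| = N * l by rewrite normrZ ger0_norm// /s /N mulrAC.
have shift_ball u : `|u - x| < d / (2 * N + 3) -> `|u + s *: e - x| < d.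
  move=> ux; rewrite addrAC (le_lt_trans (ler_normD _ _))// se.
  move: ux; rewrite ltr_pdivlMr; last lra.
  have := normr_ge0 (u - x); have := normr_ge0 (p - x); have :=
    normr_ge0 (q - x).
  nra.
exists (p + s *: e), (q + s *: e).
have E1 : p + s *: e - p = s *: e by rewrite addrC addKr.
have E2 : q + s *: e - (p + s *: e) = q - p by rewrite opprD addrACA subrr
  addr0.
have E3 : q - (q + s *: e) = - (s *: e) by rewrite opprD addrA subrr add0r.
have pr : `|p - x| < d / (2 * N + 3) by rewrite ltr_pdivlMr//; lra.
have qr : `|q - x| < d / (2 * N + 3) by rewrite ltr_pdivlMr//; lra.
have pqd := shift_ball p pr; have qqd := shift_ball q qr.
split; rewrite ?E1 ?E2 ?E3 ?normrN ?se ?(distrC q p).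
- by rewrite ler_wpM2r// lerDr.
- by rewrite -/l mulrDl mul1r lerDl mulr_ge0.
- by rewrite ler_wpM2r// lerDr.
move=> t t01; have /andP[t0 t1] := t01; split.
- apply/Hd; first by rewrite -E1; exact: ball_convex.
  by rewrite scalerA ke ltr_wpDr// mulr_ge0.
- apply/Hd; first by rewrite -E2; exact: ball_convex.
  rewrite addrAC ke; have := kL (p + t *: (q - p)) p.
  have -> : p + t *: (q - p) - p = t *: (q - p) by rewrite addrC addKr.
  rewrite normrZ ger0_norm// (distrC q p) -/l ler_norml => /andP[h _].
  have : L * (t * l) <= s by rewrite /s ler_pM2l// ler_piMl.
  lra.
- apply/Hd; first by rewrite -E3; exact: ball_convex.
  have -> : q + s *: e + t *: - (s *: e) = q + ((1 - t) * s) *: e.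
    by apply/matrixP => i j; rewrite !mxE; ring.
  by rewrite ke ltr_wpDr// mulr_ge0// subr_ge0.
Qed.

Variables (f : 'rV[R]_n -> 'rV[R]_n) (D : 'rV[R]_n -> 'M[R]_n).
Hypothesis fc : {within closure Omega, continuous f}.
Hypothesis fd : forall x, Omega x -> differentiable f x.
Hypothesis Dc : {within closure Omega, continuous D}.
Hypothesis DJ : forall x, Omega x -> D x = 'J f x.

Lemma within_norm (V : normedModType R) (h : 'rV[R]_n -> V) :
  {within closure Omega, continuous h} ->
  forall x, closure Omega x -> forall e, 0 < e -> exists2 d, 0 < d &
  forall y, closure Omega y -> `|y - x| < d -> `|h y - h x| < e.
Proof.
move=> /subspace_continuousP hc x cx e e0.
have /cvgrPdist_lt/(_ e e0) := hc x cx.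
move=> /near_norm[d d0 Hd]; exists d => // y cy yx.
by rewrite distrC; exact: Hd.
Qed.

(** The mean value theorem for each coordinate of [f] minus the linear map [D x]; the factor [n]
    comes from [normr_mulmx]. *)
Lemma segment_mvt x (e : R) p q :
  (forall t, 0 <= t <= 1 -> Omega (p + t *: (q - p)) /\
     `|D (p + t *: (q - p)) - D x| <= e) ->
  `|f q - f p - (q - p) *m D x| <= n%:R * e * `|q - p|.
Proof.
move=> H; have e0 : 0 <= e.
  have [|_] := H 0; first by rewrite lexx ler01.
  exact: le_trans (normr_ge0 _).
apply: normr_mx_le => [|i j]; first by rewrite !mulr_ge0.
rewrite ord1; pose v := q - p.
pose c0 := (v *m D x) 0 j; pose h (t : R) := f (p + t *: v) 0 j - c0 * t.
pose dh t := (v *m (D (p + t *: v) - D x)) 0 j.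
have dhP (t : R) : 0 <= t <= 1 -> is_derive t 1 h (dh t).
  move=> /H[Ot _].
  have E : (fun k : R => k^-1 *: (((fun t : R =>
    f (p + t *: v)) \o shift t) (k *: 1) - f (p + t *: v)))
     = (fun k : R => k^-1 *: ((f \o shift (p + t *: v)) (k *: v) - f (p + t *:
       v))).
    apply/funext => k /=; congr (_ *: (f _ - _)).
    by rewrite [k *: 1]mulr1 scalerDl addrCA.
  have d1 : derivable (fun t : R => f (p + t *: v)) t 1.
    by rewrite /derivable E; apply: diff_derivable; exact: fd.
  have D1 : 'D_1 (fun t : R => f (p + t *: v)) t = v *m D (p + t *: v).
    by rewrite /derive E DJ// -deriveEjacobian//; exact: fd.
  have d2 := (derivable_mxP _ _ _).1 d1 0 j.
  have D2 : 'D_1 (fun t : R =>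
    f (p + t *: v) 0 j) t = (v *m D (p + t *: v)) 0 j.
    by rewrite -D1 (derive_mx d1) mxE.
  have H1 : is_derive t 1 (fun t : R =>
    f (p + t *: v) 0 j) ((v *m D (p + t *: v)) 0 j).
    by split.
  have H2 : is_derive t (1 : R) (c0 \*: (@id R)) (c0 *: (1 : R)) by exact:
    is_deriveZ.
  have -> : dh t = (v *m D (p + t *: v)) 0 j - c0 *: (1 : R).
    by rewrite /dh mulmxBr [LHS]mxE [X in _ + X]mxE [c0 *: _]mulr1.
  exact: (is_deriveB H1 H2).
have [||c] := @MVT R h dh 0 1 ltr01.
- by move=> t; rewrite in_itv /= => /andP[t0 t1]; apply: dhP; rewrite !ltW.
- apply: derivable_within_continuous => t; rewrite in_itv /= => /dhP[]//.
rewrite in_itv /= subr0 mulr1 => /andP[cge cle] hh.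
have -> : (f q - f p - (q - p) *m D x) 0 j = h 1 - h 0.
  rewrite /h /v scale1r scale0r addr0 mulr0 mulr1 subr0 [p + _]addrC subrK.
  by rewrite [LHS]mxE [X in X + _]mxE [X in _ + X]mxE [X in _ + X + _]mxE /c0
    /v; ring.
rewrite hh /dh (le_trans (normr_entry _ _ _))// (le_trans (normr_mulmx _ _))//.
rewrite mulrAC -/v ler_wpM2r// ler_wpM2l//.
by have [|] := H c; first rewrite !ltW.
Qed.

(** Inside [Omega], add up the mean value estimates along the three segments of [short_paths], since
    the straight segment may leave [Omega]. Points of the closure follow by approximation. *)
Lemma sdiff_C1 : sdiff (closure Omega) f D.
Proof.
move=> x cx e e0; have [C C0 [d1 d10 Hpath]] := short_paths cx.
(* Three segments of length at most [C * l] each, with the factor [n] of [segment_mvt]. *)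
have N0 : 0 < n%:R * C * 3 + 1 :> R by rewrite ltr_wpDl// !mulr_ge0// ltW.
pose e' := e / (n%:R * C * 3 + 1); have e'0 : 0 < e' by rewrite divr_gt0.
have [d2 d20 HD] := within_norm Dc cx e'0.
pose d := Num.min d1 (d2 / (4 * C + 2)).
have C2 : 0 < 4 * C + 2 by lra.
have d0 : 0 < d by rewrite lt_min d10 divr_gt0.
have key p q : Omega p -> Omega q -> `|p - x| < d -> `|q - x| < d ->
    `|f p - f q - (p - q) *m D x| <= e * `|p - q|.
  move=> Op Oq; rewrite !lt_min => /andP[p1 p2] /andP[q1 q2].
  rewrite ltr_pdivlMr// in p2; rewrite ltr_pdivlMr// in q2.
  have [w1 [w2 [l1 l2 l3 Ow]]] := Hpath p q Op Oq p1 q1.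
  set l := `|p - q| in l1 l2 l3 *.
  have pq : l <= `|p - x| + `|q - x|.
    by rewrite /l -(subrKA x) (distrC q x) ler_normD.
  have l0 : 0 <= l := normr_ge0 _.
  have nx0 := normr_ge0 (p - x); have nq0 := normr_ge0 (q - x).
  have near_x u v t : 0 <= t <= 1 -> `|u - x| < d2 -> `|v - x| < d2 ->
      Omega (u + t *: (v - u)) -> Omega (u + t *: (v - u)) /\
      `|D (u + t *: (v - u)) - D x| <= e'.
    move=> t01 ux vx Ouv; split=> //; apply/ltW/HD; last exact: ball_convex.
    exact: subset_closure.
  have px : `|p - x| < d2 by nra.
  have qx : `|q - x| < d2 by nra.
  have w1x : `|w1 - x| < d2.
    rewrite -(subrKA p) (le_lt_trans (ler_normD _ _))//; nra.
  have w2x : `|w2 - x| < d2.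
    rewrite -(subrKA q) (le_lt_trans (ler_normD _ _))// distrC; nra.
  have S1 := @segment_mvt x e' p w1 (fun t t01 =>
    near_x _ _ _ t01 px w1x (let: And3 h _ _ := Ow t t01 in h)).
  have S2 := @segment_mvt x e' w1 w2 (fun t t01 =>
    near_x _ _ _ t01 w1x w2x (let: And3 _ h _ := Ow t t01 in h)).
  have S3 := @segment_mvt x e' w2 q (fun t t01 =>
    near_x _ _ _ t01 w2x qx (let: And3 _ _ h := Ow t t01 in h)).
  have -> : f p - f q - (p - q) *m D x = - ((f w1 - f p - (w1 - p) *m D x) +
      (f w2 - f w1 - (w2 - w1) *m D x) + (f q - f w2 - (q - w2) *m D x)).
    rewrite !mulmxBl; move: (p *m _) (q *m _) (w1 *m _) (w2 *m _) => a b c d'.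
    by apply/matrixP => i j; rewrite !mxE; ring.
  rewrite normrN (le_trans (ler_normD _ _))//.
  apply: (@le_trans _ _ (n%:R * e' * (C * l) * 3)).
    have := ler_normD (f w1 - f p - (w1 - p) *m D x) (f w2 - f w1 - (w2 - w1) *m
      D x).
    have ne : 0 <= n%:R * e' by rewrite mulr_ge0// ltW.
    have := ler_wpM2l ne l1; have := ler_wpM2l ne l2; have := ler_wpM2l ne l3.
    lra.
  have -> : n%:R * e' * (C * l) * 3 = (n%:R * C * 3) / (n%:R * C * 3 + 1) * (e *
    l).
    by rewrite /e'; ring.
  apply: ler_piMl; first by rewrite mulr_ge0// ltW.
  by rewrite ler_pdivrMr// mul1r lerDl.
exists d => // p q cp cq px qx; apply/ler_addgt0Pl => eta eta0.
have [L L0 HL] := mulmx_lipschitz (D x).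
(* Replacing [p] and [q] by points of [Omega] costs two errors of [f], two of [D x] and two in the
   bound [e * |p - q|]. *)
pose eta' := eta / (2 + 2 * (L + e)).
have M0 : 0 < 2 + 2 * (L + e) by lra.
have eta'0 : 0 < eta' by rewrite divr_gt0.
have [dp dp0 Hp] := within_norm fc cp eta'0.
have [dq dq0 Hq] := within_norm fc cq eta'0.
have mp : 0 < Num.min eta' (Num.min dp (d - `|p - x|)) by rewrite !lt_min eta'0
  dp0 subr_gt0.
have mq : 0 < Num.min eta' (Num.min dq (d - `|q - x|)) by rewrite !lt_min eta'0
  dq0 subr_gt0.
have [p' Op'] := (closure_norm _ _).1 cp _ mp; rewrite !lt_min =>
  /and3P[pp1 pp2 pp3].
have [q' Oq'] := (closure_norm _ _).1 cq _ mq; rewrite !lt_min =>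
  /and3P[qq1 qq2 qq3].
have p'x : `|p' - x| < d by rewrite -(subrKA p) (le_lt_trans (ler_normD _ _))//;
  lra.
have q'x : `|q' - x| < d by rewrite -(subrKA q) (le_lt_trans (ler_normD _ _))//;
  lra.
have K := key p' q' Op' Oq' p'x q'x.
have Fp := Hp p' (subset_closure Op') pp2.
have Fq := Hq q' (subset_closure Oq') qq2.
have -> : f p - f q - (p - q) *m D x = (f p' - f q' - (p' - q') *m D x) +
   ((f p - f p') + (f q' - f q)) + ((p' - p) *m D x - (q' - q) *m D x).
  rewrite !mulmxBl; move: (p *m _) (q *m _) (p' *m _) (q' *m _) => a b c d'.
  by apply/matrixP => i j; rewrite !mxE; ring.
have n1 := ler_normD (f p' - f q' - (p' - q') *m D x + ((f p - f p') + (f q' - f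
  q))) ((p' - p) *m D x - (q' - q) *m D x).
have n2 := ler_normD (f p' - f q' - (p' - q') *m D x) ((f p - f p') + (f q' - f
  q)).
have n3 := ler_normD (f p - f p') (f q' - f q).
have n4 := ler_normB ((p' - p) *m D x) ((q' - q) *m D x).
have n5 := HL _ (p' - p); have n6 := HL _ (q' - q).
have n7 : `|p' - q'| <= `|p - q| + `|p' - p| + `|q' - q|.
  have -> : p' - q' = (p - q) + (p' - p) - (q' - q).
    by apply/matrixP => i j; rewrite !mxE; ring.
  by rewrite (le_trans (ler_normB _ _))// lerD2r ler_normD.
rewrite (distrC (f p)) in n3.
have n8 : e * `|p' - q'| <= e * (`|p - q| + `|p' - p| + `|q' - q|) by rewrite
  ler_pM2l.
have n9 : L * `|p' - p| <= L * eta' by rewrite ler_pM2l// ltW.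
have n10 : L * `|q' - q| <= L * eta' by rewrite ler_pM2l// ltW.
have n11 : e * `|p' - p| <= e * eta' by rewrite ler_pM2l// ltW.
have n12 : e * `|q' - q| <= e * eta' by rewrite ler_pM2l// ltW.
have n13 : eta = eta' * (2 + 2 * (L + e)) by rewrite /eta' divfK// gt_eqF.
apply: le_trans n1 _; rewrite n13; lra.
Qed.

End LipschitzDomain.

(** * Hausdorff null sets in a hyperplane *)

Section Grid.
Variable R : realType.

(** The first and last indices in the interval are less than [2 r / be] apart. *)
Lemma card_progression (N : nat) (al be r : R) : 0 < be -> 0 <= r ->
  #|[pred t : 'I_N | `|al + be * t%:R| < r]|%:R <= 2 * r / be + 1.
Proof.
move=> be0 r0; set A := [pred t | _].
have [t0 At0|A0] := pickP A; last first.
  by rewrite (eq_card0 A0) addr_ge0// divr_ge0 ?mulr_ge0 // ltW.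
have [tm Atm Htm] := arg_minnP (fun t : 'I_N => t : nat) At0.
have [tM AtM HtM] := arg_maxnP (fun t : 'I_N => t : nat) At0.
have mM : (tm <= tM)%N by apply: Htm.
have : (#|A| <= tM - tm + 1)%N.
  rewrite cardE -(size_map (@nat_of_ord N)).
  have u : uniq [seq nat_of_ord t | t <- enum A].
    by rewrite map_inj_uniq ?enum_uniq//; exact: val_inj.
  rewrite -(size_iota tm (tM - tm + 1)); apply: uniq_leq_size u _ =>
    _ /mapP[t + ->].
  rewrite mem_enum => At;
    rewrite mem_iota (Htm t At) /= addnA subnKC// addn1 ltnS.
  exact: HtM.
rewrite -(ler_nat R) natrD natrB// => /le_trans; apply; rewrite lerD2r.
rewrite ler_pdivlMr//; move: Atm AtM; rewrite !inE !ltr_norml.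
by move=> /andP[h1 h2] /andP[h3 h4]; rewrite mulrC; nra.
Qed.

(** Counting grid points replaces volume: of the [N ^ m] points of a fine grid in the cube, the ball
    of radius [r k] contains at most the fraction [(3 r k / rho) ^ m]. *)
Lemma cube_cover m (M : nat) (u0 : 'rV[R]_m) (rho : R) (c : nat -> 'rV[R]_m)
    (r : nat -> R) : 0 < rho -> (forall k, 0 < r k) ->
  (forall u : 'rV[R]_m, (forall i, 0 <= u 0 i - u0 0 i <= rho) ->
     exists2 k, (k < M)%N & `|u - c k| < r k) ->
  1 <= \sum_(k < M) (3 * r k / rho) ^+ m.
Proof.
move=> rho0 r0 H.
(* The mesh is below every radius, so the [+ 1] of [card_progression] is absorbed and the constant 2
   becomes 3. *)
have [N N0 HN] : exists2 N : nat, (0 < N)%N & forall k, (k < M)%N ->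
  rho / N%:R <= r k.
  elim: M {H} => [|M [N N0 HN]]; first by exists 1%N.
  have := archi_boundP (ltW (divr_gt0 rho0 (r0 M))); set a := Num.bound _ => Ha.
  have a0 : (0 < a)%N by rewrite -(ltr_nat R) (le_lt_trans _ Ha)// divr_ge0 //
    ltW.
  exists (N + a)%N; first by rewrite addn_gt0 N0.
  have E (b : nat) : (0 < b)%N -> (b <= N + a)%N ->
    rho / (N + a)%:R <= rho / b%:R.
    move=> b0 bN; rewrite ler_pM2l// lef_pV2 ?posrE ?ltr0n ?addn_gt0 ?N0//.
    by rewrite ler_nat.
  move=> k; rewrite ltnS leq_eqVlt => /orP[/eqP->|/HN].
    apply: le_trans (E a a0 (leq_addl _ _)) _.
    rewrite ler_pdivrMr ?ltr0n// mulrC -ler_pdivrMr//; exact: ltW.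
  by apply: le_trans; apply: E => //; exact: leq_addr.
have NR0 : 0 < N%:R :> R by rewrite ltr0n.
pose be := rho / N%:R; have be0 : 0 < be by rewrite divr_gt0.
pose pt (j : {ffun 'I_m -> 'I_N}) : 'rV[R]_m := \row_i (u0 0 i + be * (j i)%:R).
pose A (k : nat) := [pred j | `|pt j - c k| < r k].
have cA k : (k < M)%N -> #|A k|%:R <= N%:R ^+ m * (3 * r k / rho) ^+ m.
  move=> kM.
  pose G (i : 'I_m) :=
    [pred t : 'I_N | `|(u0 0 i - c k 0 i) + be * t%:R| < r k].
  have : (#|A k| <= \prod_(i < m) #|G i|)%N.
    rewrite (_ : (\prod_(i < m) _)%N = #|family G|); last first.
      by rewrite card_family foldrE big_map big_enum.
    apply: subset_leq_card; apply/fintype.subsetP => j.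
    rewrite inE => Hj; apply/familyP => i; rewrite inE.
    apply: le_lt_trans Hj; have := normr_entry (pt j - c k) 0 i.
    by rewrite !mxE addrAC.
  rewrite -(ler_nat R) natr_prod => /le_trans; apply; rewrite -exprMn.
  rewrite (_ : _ ^+ m = \prod_(i < m) (N%:R * (3 * r k / rho))); last first.
    by rewrite prodr_const card_ord.
  apply: ler_prod => i _; rewrite ler0n /=.
  apply: le_trans (card_progression _ _ be0 (ltW (r0 k))) _.
  have -> : N%:R * (3 * r k / rho) = 2 * r k / be + r k / be.
    by rewrite /be invf_div; ring.
  rewrite lerD2l ler_pdivlMr// mul1r; exact: HN.
have : (N ^ m <= \sum_(k < M) #|A k|)%N.
  have -> : (N ^ m = #|{: {ffun 'I_m ->
    'I_N}}|)%N by rewrite card_ffun !card_ord.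
  rewrite -sum1_card; under [leqRHS]eq_bigr do rewrite -sum1_card big_mkcond /=.
  rewrite exchange_big /=; apply: leq_sum => j _.
  have [|k kM Hk] := H (pt j).
    move=> i; have -> : pt j 0 i - u0 0 i = be * (j i)%:R.
      by rewrite mxE addrC addKr.
    apply/andP; split; first by rewrite mulr_ge0 ?ler0n// ltW.
    by rewrite /be mulrAC ler_pdivrMr// ler_pM2l// ler_nat ltnW.
  by rewrite (bigD1 (Ordinal kM))//= inE Hk.
rewrite -(ler_nat R) natrX natr_sum => h.
rewrite -(ler_pM2l (exprn_gt0 m NR0)) mulr1 (le_trans h)// mulr_sumr.
by apply: ler_sum => k _; exact: cA.
Qed.

End Grid.

Section Hausdorff.
Variable R : realType.

Lemma enorm_ge n (v : 'rV[R]_n) : `|v| <= enorm v.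
Proof.
apply: normr_mx_le => [|i j]; first exact: sqrtr_ge0.
rewrite ord1 -sqrtr_sqr ler_wsqrtr// /dotp (bigD1 j)//= -expr2 lerDl.
by apply: sumr_ge0 => k _; rewrite -expr2 sqr_ge0.
Qed.

Lemma ediam_ge n (U : set 'rV[R]_n) x y : U x -> U y ->
  (`|x - y|%:E <= ediam U)%E.
Proof.
move=> Ux Uy; apply: le_ereal_sup_tmp; exists (enorm (x - y))%:E; last first.
  by rewrite lee_fin enorm_ge.
by exists (x, y).
Qed.

Lemma gauge_ge0 n s (U : set 'rV[R]_n) : (0 <= hausdorff_gauge s U)%E.
Proof.
rewrite /hausdorff_gauge; case: eqP => // /eqP /set0P[x Ux].
by apply: expe_ge0; rewrite (le_trans _ (ediam_ge Ux Ux)).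
Qed.

Lemma hausdorff_null_cover n s (Z : set 'rV[R]_n) : hausdorff s Z = 0%E ->
  forall eps : R, 0 < eps -> exists U : nat -> set 'rV[R]_n,
    [/\ Z `<=` \bigcup_k U k, forall k, (ediam (U k) <= 1)%E &
      (\sum_(0 <= k <oo) hausdorff_gauge s (U k) < eps%:E)%E].
Proof.
move=> Z0 eps eps0; have : (hausdorff_pre s 1 Z < eps%:E)%E.
  apply: (@le_lt_trans _ _ 0%E); last by rewrite lte_fin.
  rewrite -Z0; apply: ereal_sup_ubound; exists 1 => //=.
by move=> /ereal_inf_lt[_ [U [ZU U1] <-] Ueps]; exists U.
Qed.

Lemma hausdorff0_neq0 n (Z : set 'rV[R]_n) x : Z x -> hausdorff 0 Z <> 0%E.
Proof.
move=> Zx /hausdorff_null_cover/(_ 1 ltr01)[U [ZU _]].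
apply/negP; rewrite -leNgt; have [k _ Ukx] := ZU x Zx.
apply: le_trans (nneseries_lim_ge k.+1 (fun _ _ _ => gauge_ge0 _ _)).
rewrite big_nat_recr//= (_ : hausdorff_gauge 0 (U k) = 1%E).
  by rewrite leeDr// sume_ge0// => i _; exact: gauge_ge0.
rewrite /hausdorff_gauge ifF ?expe0//.
by apply/negbTE/set0P; exists x.
Qed.

Lemma series_pow_lt (M : nat) (eta : R) : 0 < eta ->
  \sum_(k < M) eta * 2^-1 ^+ k.+1 < eta.
Proof.
move=> eta0; suff -> : \sum_(k < M) eta * 2^-1 ^+ k.+1 = eta - eta * 2^-1 ^+ M.
  by rewrite ltrBlDr ltrDl mulr_gt0// exprn_gt0// invr_gt0.
elim: M => [|M IH]; first by rewrite big_ord0 expr0 mulr1 subrr.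
rewrite big_ord_recr /= IH exprS; lra.
Qed.

Variables (m : nat) (P : 'cV[R]_(1 + m) * R).

(* A cover of the disc by sets of small total gauge projects, in hyperplane
   coordinates, to a cover of a cube by balls of small total volume. *)
Lemma hausdorff_disc x d (Z : set 'rV[R]_(1 + m)) : P.1 != 0 -> alt P x = 0 ->
  0 < d -> [set y | alt P y = 0 /\ `|y - x| < d] `<=` Z ->
  hausdorff m Z <> 0%E.
Proof.
move=> P0 Px d0 HZ.
case: (posnP m) => [m0|mpos].
  have -> : hausdorff m Z = hausdorff 0 Z by congr (hausdorff _ _).
  apply: (@hausdorff0_neq0 _ _ x); apply: HZ.
  by split=> //; rewrite subrr normr0.
move=> /hausdorff_null_cover Hcov.
have [r [B [C [rv rB Cv CB vrBC]]]] := hyperplane_coords P0.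
pose I := iota P r C; pose u0 := x *m B.
have Iu0 : I u0 = x by exact: iota_proj.
have [L1 L10 HL1] := iota_lip P r C.
have [L L0 HL] := mulmx_lipschitz B.
pose rho := d / (2 * L1); have rho0 : 0 < rho by rewrite divr_gt0// mulr_gt0.
(* The first factor is that of [cube_cover]; [2 ^ m] comes from bounding the [m]-th power of a sum
   of two terms. *)
pose c0 := (3 / rho) ^+ m * 2 ^+ m.
have c00 : 0 < c0 by rewrite mulr_gt0// exprn_gt0// divr_gt0.
have Lm : 0 < L ^+ m + 1 by rewrite addr_gt0// exprn_gt0.
(* Small enough for the total in [cube_cover] to stay below 1; [eps <= 1] serves to bound the powers
   of the slack terms of [rk] by the terms themselves. *)
pose eps := Num.min 1 (c0 * (L ^+ m + 1))^-1.
have eps0 : 0 < eps by rewrite lt_min ltr01 invr_gt0 mulr_gt0.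
have eps1 : eps <= 1 by rewrite ge_min lexx.
have [U [ZU U1 Ueps]] := Hcov eps eps0.
(* The empty set has supremal diameter minus infinity, so it is given 0 instead; this agrees with
   its gauge since [m] is positive. *)
pose dk k := if U k == set0 then 0 else fine (ediam (U k)).
have ediam_fin k x' : U k x' -> ediam (U k) \is a fin_num.
  move=> Ux; rewrite ge0_fin_numE; first by apply: le_lt_trans (U1 k) _;
    rewrite ltry.
  by apply: le_trans (ediam_ge Ux Ux); rewrite lee_fin.
have dk0 k : 0 <= dk k.
  rewrite /dk; case: eqP => // /eqP/set0P[y Uy]; apply: fine_ge0.
  by apply: le_trans (ediam_ge Uy Uy); rewrite lee_fin.
have dkg k : (dk k ^+ m)%:E = hausdorff_gauge m (U k).
  rewrite /dk /hausdorff_gauge; case: eqP => [_|/eqP/set0P[y Uy]].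
    by rewrite expr0n gtn_eqF.
  by rewrite EFin_expe fineK// (ediam_fin _ y).
have dksum M : \sum_(k < M) dk k ^+ m <= eps.
  rewrite -lee_fin; apply: le_trans (ltW Ueps).
  apply: le_trans (nneseries_lim_ge M (fun _ _ _ => gauge_ge0 _ _)).
  by rewrite -sumEFin big_mkord; apply: lee_sum => k _; rewrite dkg.
(* The geometric slack makes the radii positive even for sets of diameter 0, at a total cost below
   [eps]. *)
pose rk k := L * dk k + eps * 2^-1 ^+ k.+1.
have pk k : 0 < eps * 2^-1 ^+ k.+1 by rewrite mulr_gt0// exprn_gt0// invr_gt0.
have rk0 k : 0 < rk k by rewrite ltr_wpDl// mulr_ge0// ltW.
have /choice[ck Hck] : forall k, exists c, (exists v, U k (I v)) -> U k (I c).
  by move=> k; case: (pselect (exists v, U k (I v))) => [[v Uv]|];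
    [exists v|exists 0].
pose Q := [set u : 'rV[R]_m | forall i, 0 <= u 0 i - u0 0 i <= rho].
have QU u : Q u -> exists k, `|u - ck k| < rk k.
  move=> Qu; have : Z (I u).
    apply: HZ; split; first exact: alt_iota.
    rewrite -Iu0 (le_lt_trans (HL1 _ _))//.
    have : `|u - u0| <= rho.
      apply: normr_mx_le => [|i j]; first exact: ltW.
      rewrite ord1 mxE [(- u0) _ _]mxE; have /andP[? ?] := Qu j.
      by rewrite ger0_norm.
    rewrite -(ler_pM2l L10) => /le_lt_trans; apply.
    have -> : L1 * rho = d / 2.
      by rewrite /rho invfM mulrC -!mulrA mulVf ?gt_eqF// mulr1.
    by rewrite ltr_pdivrMr// ltr_pMr// ltr1n.
  move=> /ZU[k _ Uu]; exists k.
  have Uc : U k (I (ck k)) by apply: Hck; exists u.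
  apply: (@le_lt_trans _ _ (L * dk k)); last by rewrite ltrDl.
  rewrite -[u](iotaK P rB CB) -[ck k](iotaK P rB CB) -mulmxBl (le_trans (HL _
    _))//.
  rewrite ler_pM2l// /dk ifF; last by apply/negbTE/set0P; exists (I u).
  by rewrite -lee_fin fineK ?(ediam_fin _ _ Uu)// ediam_ge.
have cQ : compact Q.
  apply: bounded_closed_compact.
    exists (`|u0| + rho); split; first exact: num_real.
    move=> K HK u Qu; apply: le_trans (ltW HK); apply: normr_mx_le => [|i j].
      by rewrite addr_ge0// ltW.
    rewrite ord1 -(subrK (u0 0 j) (u 0 j)) addrC (le_trans (ler_normD _ _))//.
    rewrite lerD ?normr_entry//; have /andP[? ?] := Qu j.
    by rewrite ger0_norm.
  move=> u /closure_norm cu i.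
  have h (v : 'rV[R]_m) : `|v 0 i - u 0 i| <= `|v - u|.
    by have := normr_entry (v - u) 0 i; rewrite !mxE.
  apply/andP; split.
    apply/ler_addgt0Pr => e e0; have [v Qv vu] := cu e e0.
    have := le_lt_trans (h v) vu.
    by rewrite ltr_norml => /andP[? ?]; have /andP[? ?] := Qv i; lra.
  apply/ler_addgt0Pr => e e0; have [v Qv vu] := cu e e0.
  have := le_lt_trans (h v) vu.
  by rewrite ltr_norml => /andP[? ?]; have /andP[? ?] := Qv i; lra.
have [M HM] : exists M : nat, forall u, Q u -> exists2 k, (k < M)%N &
  `|u - ck k| < rk k.
  move: cQ; rewrite compact_cover => /(_ _ setT (fun k =>
    [set u | `|u - ck k| < rk k]))[].
  - by move=> k _; apply/open_norm => u uk; apply/near_norm;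
      exact: near_ball_norm.
  - by move=> u /QU[k uk]; exists k.
  move=> S _ QS; exists (\max_(k <- S) k).+1 => u /QS[k kS uk]; exists k => //.
  by rewrite ltnS; apply: leq_bigmax_seq.
have := cube_cover rho0 rk0 HM.
apply/negP; rewrite -ltNge.
have h1 k : (3 * rk k / rho) ^+ m <= c0 * (L ^+ m * dk k ^+ m + eps * 2^-1 ^+
  k.+1).
  have -> : 3 * rk k / rho = (3 / rho) * rk k by ring.
  have q0 : 0 < (3 / rho) ^+ m by rewrite exprn_gt0// divr_gt0.
  have q1 : 0 < 2 ^+ m :> R by rewrite exprn_gt0.
  rewrite exprMn /c0 -mulrA ler_pM2l//.
  pose a := L * dk k; pose b := eps * 2^-1 ^+ k.+1.
  have a0 : 0 <= a by rewrite mulr_ge0// ltW.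
  have b1 : b <= 1.
    have h0 : 0 <= 2^-1 :> R by lra.
    have h1 : 2^-1 <= 1 :> R by lra.
    by rewrite /b mulr_ile1 ?exprn_ge0 ?exprn_ile1// ltW.
  have bm : b ^+ m <= b.
    case: (m) mpos => // m' _; rewrite exprS ler_piMr//;
      first exact: ltW (pk k).
    by rewrite exprn_ile1// ltW// pk.
  have : rk k ^+ m <= (2 * Num.max a b) ^+ m.
    apply: lerXn2r; rewrite ?nnegrE.
    - exact: ltW.
    - by rewrite mulr_ge0// le_max a0.
    - by rewrite /rk -/a -/b mulr_natl mulr2n lerD// le_max lexx ?orbT.
  move=> /le_trans; apply; rewrite exprMn ler_pM2l//.
  rewrite -exprMn -/a -/b; have am0 : 0 <= a ^+ m by rewrite exprn_ge0.
  case: (leP a b) => _; first by rewrite (le_trans bm)// lerDr.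
  by rewrite lerDl ltW// pk.
apply: (@le_lt_trans _ _ (\sum_(k < M) c0 * (L ^+ m * dk k ^+ m + eps * 2^-1 ^+
  k.+1))).
  by apply: ler_sum => k _; exact: h1.
rewrite -mulr_sumr big_split /= -mulr_sumr.
apply: (@lt_le_trans _ _ (c0 * (L ^+ m * eps + eps))).
  rewrite ltr_pM2l//; apply: ler_ltD; last exact: series_pow_lt.
  by rewrite ler_pM2l ?exprn_gt0//; exact: dksum.
have -> : c0 * (L ^+ m * eps + eps) = (c0 * (L ^+ m + 1)) * eps by ring.
have q0 : 0 < c0 * (L ^+ m + 1) by exact: mulr_gt0.
by rewrite -(ler_pdivlMl _ _ q0) mulr1 /eps ge_min lexx orbT.
Qed.

End Hausdorff.

(** * Outward normals *)

Section Normal.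
Variables (R : realType) (n : nat).
Implicit Types (x y e : 'rV[R]_n).

Lemma dotpD x y e : dotp (x + y) e = dotp x e + dotp y e.
Proof. by rewrite !dotp_mulmx mulmxDl mxE. Qed.

Lemma dotpZ t x e : dotp (t *: x) e = t * dotp x e.
Proof. by rewrite !dotp_mulmx -scalemxAl mxE. Qed.

Lemma dotpC x y : dotp x y = dotp y x.
Proof. by apply: eq_bigr => i _; rewrite mulrC. Qed.

Lemma enorm_gt0 x : x != 0 -> 0 < enorm x.
Proof.
move=> x0; apply: lt_le_trans (enorm_ge x); by rewrite normr_gt0.
Qed.

Lemma dotp_enorm x : dotp x x = enorm x ^+ 2.
Proof.
by rewrite sqr_sqrtr//; apply: sumr_ge0 => i _; rewrite -expr2 sqr_ge0.
Qed.

Lemma affine_differentiable (c : R) e x :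
  differentiable (fun y => c - dotp y e) x.
Proof.
have -> : (fun y => c - dotp y e) =
    cst c - ((fun N : 'M[R]_(1, 1) => N 0 0) \o mulmxr e^T).
  by apply/funext => y; rewrite dotp_mulmx.
apply: differentiableB => //; apply: differentiable_comp;
  last exact: differentiable_coord.
apply: linear_differentiable.
suff cm (y : 'rV[R]_n) : (z *m e^T) @[z --> y] --> y *m e^T by move=> y;
  exact: cm.
apply/(cvgrPdist_lt (FF := nbhs_filter y)) => eps eps0.
have [L L0 HL] := mulmx_lipschitz e^T.
suff : \forall z \near y, `|z - y| < eps / L.
  apply: filterS => z; rewrite ltr_pdivlMr// mulrC => zy.
  by rewrite -mulmxBl (le_lt_trans (HL _ _))// distrC.
by apply/near_norm; exists (eps / L) => //; rewrite divr_gt0.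
Qed.

Lemma affine_derive (c : R) e x v : 'D_v (fun y => c - dotp y e) x = - dotp v e.
Proof.
apply: cvg_lim => //; apply: cvg_near_cst.
have : \forall h \near (0 : R)^', h != 0 by exact: nbhs_dnbhs_neq.
apply: filterS => h h0 /=; rewrite dotpD dotpZ.
have -> : c - (h * dotp v e + dotp x e) - (c - dotp x e) = h * (- dotp v e) by
  ring.
by rewrite [_ *: _]mulrA mulVf// mul1r.
Qed.

Lemma affine_gradient (c : R) e x : gradient (fun y => c - dotp y e) x = - e.
Proof.
apply/rowP => i; rewrite !mxE affine_derive; congr (- _).
rewrite /dotp (bigD1 i)//= mxE !eqxx mul1r big1 ?addr0// => j ji.
by rewrite mxE (negPf ji) andbF mul0r.
Qed.

(** The chart takes the inner unit normal as axis and a constant [g], so the gradient of its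
    defining function is minus the axis. *)
Lemma half_space_normal (Omega : set 'rV[R]_n) (P : 'cV[R]_n * R) (sg : R) x :
  P.1 != 0 -> sg ^+ 2 = 1 -> boundary Omega x ->
  (\forall y \near x, Omega y <-> 0 < sg * alt P y) ->
  outward_unit_normal Omega x (- ((sg / enorm P.1^T) *: P.1^T)).
Proof.
move=> P0 sg2 bx Ox; split=> //.
have PT0 : P.1^T != 0 by rewrite -trmx0 (inj_eq trmx_inj).
set q := enorm P.1^T; have q0 : 0 < q by exact: enorm_gt0.
set e := (sg / q) *: P.1^T.
have ee : enorm e = 1.
  rewrite /enorm /e dotpZ dotpC dotpZ dotp_enorm -/q.
  rewrite (_ : _ * _ = sg ^+ 2 * (q / q) ^+ 2); last by field; rewrite gt_eqF.
  by rewrite mulfV ?gt_eqF// expr1n mulr1 sg2 sqrtr1.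
have de y : dotp y e = sg / q * (y *m P.1) 0 0.
  by rewrite dotpC dotpZ dotpC dotp_mulmx trmxK.
exists e, (cst (sg * P.2 / q)) => /=; split.
- split=> //.
    exists 0; split=> // M M0 [y z] _ /=.
    by rewrite subrr normr0 mulr_ge0// ltW.
  apply: filterS Ox => y ->; rewrite /cst de -[X in _ <-> is_true X]subr_gt0.
  have -> : sg / q * (y *m P.1) 0 0 - sg * P.2 / q = sg * alt P y / q.
    by rewrite /alt; ring.
  by rewrite [X in _ <-> is_true X]pmulr_lgt0// invr_gt0.
- exact: affine_differentiable.
- rewrite affine_gradient (_ : enorm (- e) = 1) ?invr1 ?scale1r//.
  by rewrite -[RHS]ee /enorm -scaleN1r dotpZ dotpC dotpZ; congr Num.sqrt; ring.
Qed.

End Normal.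

(** * Fibers on which the determinant has constant sign *)

Section SignedCount.
Variables (R : realType) (n : nat).
Variables (s : seq ('cV[R]_n * R)) (a : 'rV[R]_n -> R).
Variables (f : 'rV[R]_n -> 'rV[R]_n) (D : 'rV[R]_n -> 'M[R]_n).
Hypothesis T : tangent_chain s a f D.
Variable tau : R.
Hypothesis a01 : forall x, a x = 0 \/ a x = 1.
Hypothesis sgD : forall x, a x != 0 -> Num.sg (\det (D x)) = tau.

Let F y := [set x | csupp a x /\ f x = y].

Lemma dcount_sum y : dcount a f D y = tau * \sum_(x \in F y) a x.
Proof.
rewrite mulr_fsumr; have -> : \sum_(x \in F y) tau * a x =
    \sum_(x \in F y) a x * Num.sg (\det (D x)).
  apply: eq_fsbigr => x _; have [->|ax] := eqVneq (a x) 0.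
    by rewrite mulr0 mul0r.
  by rewrite sgD// mulrC.
apply/esym/fsbig_widen => [x []//|x [fx nF]]; rewrite /preimage /=.
have [->|ax] := eqVneq (a x) 0; first by rewrite mul0r.
by case: nF; split=> //; exact: csupp_supp.
Qed.

Let finF y : finite_set (F y).
Proof. exact: fiber_finite (csupp_compact T) (tc_sdiff T) (tc_det T) y. Qed.

Let a_ge0 x : 0 <= a x. Proof. by case: (a01 x) => ->. Qed.

Lemma sum_fiber_ge1 y x : a x = 1 -> f x = y -> 1 <= \sum_(x \in F y) a x.
Proof.
move=> ax fx; have Fx : F y x.
  by split=> //; apply: csupp_supp; rewrite ax oner_neq0.
by rewrite (fsbigD1 x)//= ax lerDl; apply: fsumr_ge0.
Qed.

Lemma sum_fiber_ge2 y x x' : x <> x' -> a x = 1 -> a x' = 1 ->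
  f x = y -> f x' = y -> 2 <= \sum_(x \in F y) a x.
Proof.
move=> xx' ax ax' fx fx'; have FE z : a z = 1 -> f z = y -> F y z.
  by move=> az fz; split=> //; apply: csupp_supp; rewrite az oner_neq0.
rewrite (fsbigD1 x)//=; last exact: FE.
rewrite (fsbigD1 x')//=; last by split; [exact: FE|exact/nesym].
  by rewrite ax ax' addrA lerDl; apply: fsumr_ge0.
exact: finite_setD.
Qed.

End SignedCount.

(** * The chain of a polyhedral domain *)

Section Indicator.
Variables (R : realType) (n : nat) (Omega : set 'rV[R]_n).
Let a : 'rV[R]_n -> R := \1_Omega.

Lemma indic1 x : Omega x -> a x = 1.
Proof. by move=> Ox; rewrite /a indicE mem_set. Qed.

Lemma indic0 x : ~ Omega x -> a x = 0.
Proof. by move=> Ox; rewrite /a indicE memNset. Qed.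

Lemma indic01 x : a x = 0 \/ a x = 1.
Proof. by case: (pselect (Omega x)) => [/indic1|/indic0]; [right|left]. Qed.

Lemma indic_neq0 x : a x != 0 -> Omega x.
Proof. by move=> ax; apply: contrapT => /indic0 a0; rewrite a0 eqxx in ax. Qed.

Lemma csupp_indic : csupp a = closure Omega.
Proof.
congr closure; apply/seteqP; split=> x /=; first exact: indic_neq0.
by move=> /indic1 ->; exact: oner_neq0.
Qed.

Lemma near_domain x : open Omega -> Omega x -> \forall y \near x, Omega y.
Proof. by move=> /open_norm oO /oO[d d0 Hd]; apply/near_norm; exists d. Qed.

Lemma locconst_domain x : open Omega -> Omega x -> locconst a x.
Proof. by move=> oO Ox; apply: filterS (near_domain oO Ox) => y Oy;
  rewrite !indic1. Qed.

End Indicator.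

Section Domain.
Variables (R : realType) (m : nat) (Omega : set 'rV[R]_(1 + m)).
Variables (phi : 'rV[R]_(1 + m) -> 'rV[R]_(1 + m)) (mu : R).
Hypothesis hOmega : polyhedral_domain Omega.
Hypothesis hphi : U0 Omega phi.
Hypothesis hmin : is_minimum
  [set jacobian_det Omega (id \+ phi) x | x in closure Omega] mu.
Hypothesis hmu : 0 < mu.

Let f := id \+ phi.

Let lO : lipschitz_domain Omega. Proof. by case: hOmega. Qed.
Let oO : open Omega. Proof. by case: lO. Qed.
Let pO : bounded_polyhedron (closure Omega). Proof. by case: hOmega. Qed.

Section WithData.
Variables (dphi : 'rV[R]_(1 + m) ->
  'M[R]_(1 + m)) (s : seq ('cV[R]_(1 + m) * R)).
Hypothesis dphi_cts : {within closure Omega, continuous dphi}.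
Hypothesis dphiE : forall x, Omega x -> dphi x = 'J phi x.
Hypothesis ps : proper s.
Hypothesis sO : forall x, closure Omega x -> generic s x ->
  \forall y \near x, closure Omega y.

Let phi_cts : {within closure Omega, continuous phi}.
Proof. by case: hphi => -[]. Qed.
Let phi_diff x : Omega x -> differentiable phi x.
Proof. by case: hphi => -[_ + _] _; exact. Qed.

Let Df x : 'M[R]_(1 + m) := 1%:M + dphi x.

Lemma jacobian_id_add x : Omega x -> 'J f x = Df x.
Proof.
move=> Ox; have dphi_x := phi_diff Ox.
have df : differentiable f x by exact: differentiableD.
apply/row_matrixP => i; rewrite !rowE -deriveEjacobian//.
rewrite deriveD; [|exact: derivable_id|exact: diff_derivable].
by rewrite derive_id deriveEjacobian// -dphiE// mulmxDr mulmx1.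
Qed.

Lemma grad_closureE x : closure Omega x -> grad_closure Omega f x = Df x.
Proof.
move=> cx; have pf : ProperFilter (within Omega (nbhs x)) by exact:
  within_nbhs_proper.
apply: cvg_lim; first exact: norm_hausdorff.
apply/cvgrPdist_lt => e e0.
have [d d0 Hd] := within_norm dphi_cts cx e0.
have : \forall y \near x, `|y - x| < d by apply/near_norm; exists d.
apply: filterS => y yx Oy;
  rewrite jacobian_id_add// /Df opprD addrACA subrr add0r.
by rewrite distrC; apply: Hd => //; exact: subset_closure.
Qed.

Lemma det_pos x : closure Omega x -> 0 < \det (Df x).
Proof.
move=> cx; rewrite -grad_closureE//; apply: lt_le_trans hmu _.
by case: hmin => _; apply; exists x.
Qed.

Lemma sdiff_id_add : sdiff (closure Omega) f Df.
Proof.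
move=> x cx e e0.
have [d d0 Hd] := sdiff_C1 lO phi_cts phi_diff dphi_cts dphiE cx e0.
exists d => // p q cp cq px qx.
have -> : f p - f q - (p - q) *m Df x = phi p - phi q - (p - q) *m dphi x.
  rewrite /f /Df mulmxDr mulmx1; move: (_ *m _) => A.
  by apply/matrixP => i j; rewrite !mxE; ring.
exact: Hd.
Qed.

Local Notation a := (\1_Omega : 'rV[R]_(1 + m) -> R).

Lemma generic_locconst x : generic s x -> locconst a x.
Proof.
move=> gx; have [cx|nx] := pselect (closure Omega x).
  apply: (locconst_domain oO); apply: (interior_closure_lipschitz lO).
  exact: sO.
have /csupp_out[] // : ~ csupp a x by rewrite csupp_indic.
Qed.

(** If the essential value at [x] is 1, a ball around [x] lies in the closure, so [x] is in [Omega]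
    by [interior_closure_lipschitz]. *)
Lemma domain_regular x v : essconst s a x v -> a x = v.
Proof.
move=> /near_norm[d d0 Hd]; have [y yx gy] := generic_dense x ps d0.
have [Ox|nx] := pselect (Omega x).
  have /near_norm[e e0 He] := near_domain oO Ox.
  have me : 0 < Num.min d e by rewrite lt_min d0.
  have [z] := generic_dense x ps me.
  by rewrite lt_min => /andP[zd ze] gz; rewrite -(Hd z)// (indic1 Ox) indic1//;
    exact: He.
rewrite indic0//; case: (indic01 Omega y) => ay; first by rewrite -(Hd y)// ay.
case: nx; apply: (interior_closure_lipschitz lO); apply/near_norm; exists d =>
  // z zx.
apply/closure_norm => e e0.
have me : 0 < Num.min e (d - `|z - x|) by rewrite lt_min e0 subr_gt0.
have [w] := generic_dense z ps me.
rewrite lt_min => /andP[we wd] gw; exists w => //; apply: indic_neq0.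
have wx : `|w - x| < d.
  by rewrite -(subrKA z) (le_lt_trans (ler_normD _ _))//; lra.
by rewrite (Hd w wx gw) -(Hd y yx gy) ay oner_neq0.
Qed.

Lemma domain_bounded : exists M : R, forall x, a x != 0 -> `|x| <= M.
Proof.
have [M HM] := polyhedron_bounded pO; exists M => x /indic_neq0 Ox.
by apply: HM; exact: subset_closure.
Qed.

(** The lemmas on faces need some tangent map, and tangency of [f] is yet to be proved; the identity
    supplies one with the same chain. *)
Lemma identity_chain : tangent_chain s a id (fun=> 1%:M).
Proof.
split=> //.
- exact: generic_locconst.
- exact: domain_regular.
- exact: domain_bounded.
- move=> x _ e e0; exists 1 => // p q _ _ _ _.
  by rewrite mulmx1 subrr normr0 mulr_ge0// ltW.
- by move=> x _ e e0; exists 1 => // y _ _; rewrite subrr normr0.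
- by move=> x _; rewrite det1 oner_neq0.
Qed.

Lemma simple_only P x : P \in s -> simple s x -> alt P x = 0 ->
  forall Q, Q \in s -> acc s a Q x -> plane Q = plane P.
Proof. by move=> Ps sx Px Q Qs /acc_alt Qx; exact: sx. Qed.

(** The one-sided values are distinct and in {0, 1}, so [Omega] fills exactly one side. Points of
    [P] are excluded, since the chain is not locally constant there. *)
Lemma domain_half_space P x : P \in s -> simple s x -> alt P x = 0 ->
  ~ locconst a x -> exists2 sg : R, sg ^+ 2 = 1 &
  \forall y \near x, Omega y <-> 0 < sg * alt P y.
Proof.
move=> Ps sx Px nx; have oa := simple_only Ps sx Px.
have H1 := only_acc identity_chain Ps oa.
have H2 : \forall y \near x, ~ locconst a y -> alt P y = 0.
  by apply: filterS H1 => y Hy /Hy[].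
have [vp [vm Hs]] := two_sides identity_chain Ps Px H2.
have vpm : vp <> vm by move=> E; apply: nx;
  exact: (sides_eq identity_chain Ps Hs E).
have nlc := sides_nonlc identity_chain Ps Hs vpm.
have P0 := ps Ps.
have [d d0 Hd] := (near_norm _ _).1 (filterI Hs nlc).
have val (t : R) : t != 0 -> exists y, [/\ `|y - x| < d & 0 < t * alt P y].
  by move=> t0; have [y yx Py] := alt_side P0 Px t0 d0; exists y.
have vp01 : vp = 0 \/ vp = 1.
  have [y [yx Py]] := val 1 (oner_neq0 _); rewrite mul1r in Py.
  by rewrite -((Hd y yx).1.1 Py); exact: indic01 Omega _.
have vm01 : vm = 0 \/ vm = 1.
  have [y [yx]] := val (-1) (neqN1 _); rewrite mulN1r oppr_gt0 => Py.
  by rewrite -((Hd y yx).1.2 Py); exact: indic01 Omega _.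
have on y : `|y - x| < d -> alt P y = 0 -> ~ Omega y.
  by move=> yx Py /(locconst_domain oO); exact: (Hd y yx).2 Py.
case: vp01 vm01 => -> [] -> // in vpm Hd *; last first.
  exists 1; first by rewrite expr1n.
  apply/near_norm; exists d => // y yx; rewrite mul1r.
  have [[hp hm] _] := Hd y yx; split=> [Oy|/hp ay]; last by apply: indic_neq0;
    rewrite ay oner_neq0.
  case: (ltrgtP (alt P y) 0) => // h; last by case: (on y yx h).
  by have := indic1 Oy; rewrite hm// => /esym/eqP; rewrite oner_eq0.
exists (-1); first by rewrite sqrrN expr1n.
apply/near_norm; exists d => // y yx; rewrite mulN1r oppr_gt0.
have [[hp hm] _] := Hd y yx; split=> [Oy|/hm ay]; last by apply: indic_neq0;
  rewrite ay oner_neq0.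
case: (ltrgtP (alt P y) 0) => // h; last by case: (on y yx h).
by have := indic1 Oy; rewrite hp// => /esym/eqP; rewrite oner_eq0.
Qed.

(** A nonzero normal component of [phi] at [x] would persist on a whole disc of the face by
    continuity; by [hausdorff_disc] this disc is not null. *)
Lemma tangent_at_face P x : P \in s -> simple s x -> alt P x = 0 ->
  ~ locconst a x -> alt P (f x) = 0.
Proof.
move=> Ps sx Px nx; have P0 := ps Ps.
have [sg sg2 Hsg] := domain_half_space Ps sx Px nx.
have PT0 : P.1^T != 0 by rewrite -trmx0 (inj_eq trmx_inj).
pose q := enorm P.1^T; have q0 : 0 < q by exact: enorm_gt0.
pose nu := - ((sg / q) *: P.1^T).
have nuE y : dotp y nu = - (sg / q) * (y *m P.1) 0 0.
  by rewrite /nu -scaleNr dotpC dotpZ dotpC dotp_mulmx trmxK.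
have sg0 : sg != 0 by apply: contra_eq_neq sg2 => ->;
  rewrite expr0n eq_sym oner_neq0.
suff H : dotp (phi x) nu = 0.
  rewrite /f /= altD Px add0r; apply/eqP; move/eqP: H; rewrite nuE mulf_eq0 =>
    /orP[|//].
  by rewrite oppr_eq0 mulf_eq0 invr_eq0 (negPf sg0) (gt_eqF q0).
have cx : closure Omega x by rewrite -csupp_indic; exact: nonlc_csupp.
apply: contrapT => H.
have /near_norm[d1 d10 Hd1] := Hsg.
have [L L0 HL] := mulmx_lipschitz nu^T.
have hn : 0 < `|dotp (phi x) nu| / L by rewrite divr_gt0// normr_gt0; exact/eqP.
have [d2 d20 Hd2] := within_norm phi_cts cx hn.
have bnd y : `|y - x| < d1 -> alt P y = 0 -> boundary Omega y.
  move=> yx Py; apply: boundary_open; last first.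
    by rewrite (Hd1 y yx) Py mulr0 ltxx.
  apply/closure_norm => e e0.
  have me : 0 < Num.min e (d1 - `|y - x|) by rewrite lt_min e0 subr_gt0.
  have [z] := alt_side P0 Py sg0 me; rewrite lt_min => /andP[ze zd] Pz.
  exists z => //; apply/Hd1 => //.
  by rewrite -(subrKA y) (le_lt_trans (ler_normD _ _))//; lra.
have md : 0 < Num.min d1 d2 by rewrite lt_min d10.
have [_] := hphi; apply: (hausdorff_disc P0 Px md) => y [Py].
rewrite lt_min => /andP[yd1 yd2]; split; first exact: bnd.
have nz : dotp (phi y) nu <> 0.
  move=> E; have := Hd2 y; rewrite ltr_pdivlMr// => /(_ (bnd y yd1 Py).1 yd2).
  rewrite mulrC; apply/negP; rewrite -leNgt;
    apply: le_trans (HL _ (phi y - phi x)).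
  apply: le_trans (normr_entry _ 0 0).
  by rewrite -dotp_mulmx -scaleN1r dotpD dotpZ E add0r mulN1r normrN.
move=> /(_ nu) Hn; apply: nz; apply: Hn; apply: half_space_normal => //;
  first exact: bnd.
apply/near_norm; exists (d1 - `|y - x|); first by rewrite subr_gt0.
move=> z zy; apply: Hd1.
by rewrite -(subrKA y) (le_lt_trans (ler_normD _ _))//; lra.
Qed.

Lemma domain_chain : tangent_chain s a f Df.
Proof.
split; rewrite ?csupp_indic => //.
- exact: generic_locconst.
- exact: domain_regular.
- exact: domain_bounded.
- exact: sdiff_id_add.
- move=> x cx e e0; have [d d0 Hd] := within_norm dphi_cts cx e0.
  exists d => // y cy yx; rewrite /Df opprD addrACA subrr add0r; exact: Hd.
- by move=> x cx; rewrite gt_eqF// det_pos.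
- by move=> x P; exact: tangent_at_face.
Qed.

End WithData.
End Domain.

(** * Bijectivity *)

Section FaceImage.
Variables (R : realType) (m : nat) (Omega : set 'rV[R]_(1 + m)).
Variables (s : seq ('cV[R]_(1 + m) * R)) (f : 'rV[R]_(1 + m) -> 'rV[R]_(1 + m)).
Variable D : 'rV[R]_(1 + m) -> 'M[R]_(1 + m).
Local Notation a := (\1_Omega : 'rV[R]_(1 + m) -> R).
Hypothesis oO : open Omega.
Hypothesis T : tangent_chain s a f D.

(* If the face were mapped into Omega, the faces of P with the same jump and
   orientation as the one at x would form a chain whose face map covers the
   image of x, near which the chain 1_Omega has no jump across P, contradicting
   the degree theorem in P. *)
Lemma face_image P x : P \in s -> simple s x -> alt P x = 0 ->
  ~ locconst a x -> ~ Omega (f x).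
Proof.
move=> Ps sx Px nx Ofx.
have oa : forall Q, Q \in s -> acc s a Q x -> plane Q = plane P.
  by move=> Q Qs /acc_alt Qx; exact: sx.
have [vp [vm Hs]] : exists vp vm, sides a P x vp vm.
  apply: (two_sides T Ps Px).
  by apply: filterS (only_acc T Ps oa) => y Hy /Hy[].
have vpm : vp <> vm by move=> E; apply: nx; exact: (sides_eq T Ps Hs E).
have [r [B [C [rv rB Cv CB vrBC]]]] := hyperplane_coords (tc_proper T Ps).
pose u := x *m B; have Iu : iota P r C u = x by exact: iota_proj.
rewrite -Iu in oa Hs Ofx.
pose E := trace_diff D P r B C.
pose tau := Num.sg (\det (E u)).
(* Selecting one jump and one orientation gives a chain with values 0 and 1 and determinants of
   constant sign. *)
pose psi (j t : R) : R := ((j == vp - vm) && (t == tau))%:R.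
have psi0 t : psi 0 t = 0.
  by rewrite /psi eq_sym subr_eq0; move/eqP/negPf: vpm => ->.
have Tb := trace_tangent T rv rB Cv CB vrBC Ps psi0.
have [bu lu] := trace_locconst T rv rB Cv CB vrBC Ps psi0 oa Hs.
rewrite -/E -/tau {2}/psi !eqxx /= in bu.
set b := trace_chain s a D P r B C psi in Tb bu lu.
set g := trace_map f P r B C in Tb.
set s' := trace_planes P r C s in Tb.
have ps' := tc_proper Tb.
have pre w : b w != 0 -> forall d, 0 < d -> exists2 v, `|v - w| < d &
    generic s' v /\ b w = psi (jump a P (iota P r C v)) (Num.sg (\det (E v))).
  move=> bw d d0; have /near_norm[e e0 He] := regularize_neq0 ps' bw.
  have me : 0 < Num.min d e by rewrite lt_min d0.
  have [v] := generic_dense w ps' me.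
  by rewrite lt_min => /andP[vd ve] gv; exists v => //; split=> //;
    rewrite -[RHS]/(trace_pre a D P r B C psi v) He.
have b01 w : b w = 0 \/ b w = 1.
  have [|bw] := eqVneq (b w) 0; [by left|right].
  have [v _ [_ E1]] := pre w bw 1 ltr01.
  by move: bw; rewrite E1 /psi; case: (_ && _); rewrite ?eqxx.
have sgE w : b w != 0 -> Num.sg (\det (E w)) = tau.
  move=> bw; have [d d0 Hd] := sg_det_csupp Tb (csupp_supp bw).
  have [v vw [gv E1]] := pre w bw d d0.
  have bv : b v = b w.
    by rewrite E1 /b (trace_generic_pre T rv rB Cv CB vrBC Ps psi0 gv).
  rewrite -(Hd v) -/E//; last by apply: csupp_supp; rewrite bv.
  by move: bw; rewrite E1 /psi; case: (_ =P tau) => //; rewrite andbF eqxx.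
have gu : face_good a f D P r C u.
  exact: (face_good_sides T rv Cv Ps oa Hs vpm).
have tau0 : tau != 0.
  by rewrite /tau sgr_eq0; exact: (face_good_det T rv rB Cv CB vrBC gu).
have Ku : csupp b u by apply: csupp_supp; rewrite bu oner_neq0.
have [r1 _ Hr1] := interior_sheet Tb Ku lu; have [d d0 Hd] := Hr1 1 ltr01.
have : \forall w \near g u, Omega (iota P r C w).
  by apply: near_iota; apply: near_domain => //; rewrite (face_goodK vrBC gu).
move=> /near_norm[d' d'0 Hd'].
have md : 0 < Num.min d d' by rewrite lt_min d0.
have [w] := generic_dense (g u) ps' md.
rewrite lt_min => /andP[wd wd'] gw; have Ow := Hd' w wd'.
have [v [_ gvw bv _ _]] := Hd w wd; rewrite bu in bv.
have := degree Tb gw; rewrite (dcount_sum g sgE).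
(* The point [iota P r C w] lies in [Omega], so the chain has the value 1 on both sides and no
   jump. *)
have -> : b w = 0.
  have Hw : sides a P (iota P r C w) 1 1.
    by apply: filterS (near_domain oO Ow) => y Oy; rewrite indic1.
  have oaw := generic_only T rv Cv vrBC gw.
  rewrite /b; have [-> _] := trace_locconst T rv rB Cv CB vrBC Ps psi0 oaw Hw.
  by rewrite subrr psi0.
move/eqP; rewrite mulf_eq0 (negPf tau0) /= => /eqP S0.
by have := sum_fiber_ge1 Tb b01 bv gvw; rewrite S0 ler10.
Qed.

End FaceImage.

Section Bijection.
Variables (R : realType) (m : nat) (Omega : set 'rV[R]_(1 + m)).
Variables (s : seq ('cV[R]_(1 + m) * R)) (f : 'rV[R]_(1 + m) -> 'rV[R]_(1 + m)).
Variable D : 'rV[R]_(1 + m) -> 'M[R]_(1 + m).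
Local Notation a := (\1_Omega : 'rV[R]_(1 + m) -> R).
Hypothesis lO : lipschitz_domain Omega.
Hypothesis T : tangent_chain s a f D.
Hypothesis D_pos : forall x, closure Omega x -> 0 < \det (D x).

Let oO : open Omega. Proof. by case: lO. Qed.
Let ps := tc_proper T.
Let F y := [set x | csupp a x /\ f x = y].

Lemma fiber_count y : generic s y -> \sum_(x \in F y) a x = a y.
Proof.
move=> /(degree T) <-; rewrite (@dcount_sum _ _ _ _ D 1) ?mul1r// =>
  x /indic_neq0 Ox.
by apply/gtr0_sg/D_pos/subset_closure.
Qed.

Lemma locally_onto x r : Omega x -> 0 < r -> exists2 d, 0 < d & forall y,
  `|y - f x| < d -> exists x', [/\ `|x' - x| < r, f x' = y & Omega x'].
Proof.
move=> Ox r0; have Kx : csupp a x by rewrite csupp_indic; exact: subset_closure.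
have [r1 _ Hr1] := interior_sheet T Kx (locconst_domain oO Ox).
have [d d0 Hd] := Hr1 r r0.
exists d => // y /Hd[x' [x'x fx' ax' _ _]]; exists x'; split=> //.
by apply: indic_neq0; rewrite ax' indic1// oner_neq0.
Qed.

(** Generic points near [f x] have a preimage in [Omega], so their count is at least 1 and they
    belong to [Omega]. Hence [f x] is interior to the closure. *)
Lemma maps_into x : Omega x -> Omega (f x).
Proof.
move=> Ox; have [d d0 Hd] := locally_onto Ox ltr01.
apply: (interior_closure_lipschitz lO); apply/near_norm; exists d => // y yx.
apply/closure_norm => e e0.
have me : 0 < Num.min e (d - `|y - f x|) by rewrite lt_min e0 subr_gt0.
have [w] := generic_dense y ps me; rewrite lt_min => /andP[we wd] gw.
exists w => //; have [|x' [_ fx' /indic1 ax']] := Hd w.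
  by rewrite -(subrKA y) (le_lt_trans (ler_normD _ _))//; lra.
have := sum_fiber_ge1 T (indic01 Omega) ax' fx'.
rewrite fiber_count// => aw; apply: indic_neq0.
by apply: contraTneq aw => ->; rewrite ler10.
Qed.

(** Two points with one image would give a nearby generic point two preimages, while its count is at
    most 1. *)
Lemma injective_on : set_inj Omega f.
Proof.
move=> x x' /set_mem Ox /set_mem Ox' E; apply: contrapT => /eqP xx'.
pose r := `|x - x'| / 2;
  have r0 : 0 < r by rewrite divr_gt0// normr_gt0 subr_eq0.
have [d d0 Hd] := locally_onto Ox r0; have [d' d'0 Hd'] := locally_onto Ox' r0.
have md : 0 < Num.min d d' by rewrite lt_min d0.
have [w] := generic_dense (f x) ps md; rewrite lt_min => /andP[wd].
rewrite {1}E => wd' gw.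
have [p [px fp /indic1 ap]] := Hd w wd; have [q [qx fq /indic1 aq]] :=
  Hd' w wd'.
have pq : p <> q.
  move=> pq; have : `|x - x'| < r + r.
    rewrite -(subrKA p) (le_lt_trans (ler_normD _ _))// ltrD//;
      first by rewrite distrC.
    by rewrite pq.
  rewrite /r; lra.
have := sum_fiber_ge2 T (indic01 Omega) pq ap aq fp fq.
by rewrite fiber_count//; case: (indic01 Omega w) => ->; lra.
Qed.

(** Generic points near [y] have count 1, so they are images; the image of the closure is compact,
    hence closed. *)
Lemma closure_onto y : Omega y -> exists2 x, closure Omega x & f x = y.
Proof.
move=> Oy; have cf : compact (f @` csupp a).
  by apply: continuous_compact (csupp_compact T);
    exact: sdiff_within (tc_sdiff T).
suff [x Kx fx] : (f @` csupp a) y by exists x; rewrite -?csupp_indic.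
apply: (compact_closed (@norm_hausdorff _ _) cf); apply/closure_norm => e e0.
have /near_norm[d d0 Hd] := near_domain oO Oy.
have me : 0 < Num.min e d by rewrite lt_min e0.
have [w] := generic_dense y ps me; rewrite lt_min => /andP[we wd] gw.
exists w => //; apply: contrapT => H.
have := fiber_count gw; rewrite (indic1 (Hd w wd)) fsbig1 =>
  [/esym/eqP|x [Kx fx]].
  by rewrite oner_eq0.
by case: H; exists x.
Qed.

(** A preimage on the boundary could be moved to a simple boundary point whose image is still in
    [Omega], against [face_image]. *)
Lemma maps_onto y : Omega y -> exists2 x, Omega x & f x = y.
Proof.
move=> Oy; have [x cx fx] := closure_onto Oy; exists x => //.
apply: contrapT => nx; rewrite -csupp_indic in cx.
have nl : ~ locconst a x.
  move=> /near_norm[d d0 Hd].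
  have [z az zx] := (closure_norm _ _).1 cx d d0.
  by move: az; rewrite /= Hd// indic0// eqxx.
have /near_norm[e e0 He] := near_domain oO Oy.
have [d d0 Hd] := sdiff_cts (tc_sdiff T) cx e0.
have [z [zx sz nz]] := nonlc_simple T nl d0.
have [P Ps Pz] : exists2 P, P \in s & alt P z = 0.
  apply: contrapT => H; apply: nz; apply: (tc_generic T) => P Ps.
  by apply/eqP => Pz; apply: H; exists P.
apply: (face_image oO T Ps sz Pz nz); apply: He; rewrite -fx; apply: Hd => //.
exact: nonlc_csupp.
Qed.

Lemma bijective_on : set_bij Omega Omega f.
Proof.
split; first exact: maps_into.
  exact: injective_on.
by move=> y /maps_onto[x Ox <-]; exists x.
Qed.

End Bijection.

Theorem proposition3p8 (R : realType) (n : nat) (Omega : set 'rV[R]_n)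
    (phi : 'rV[R]_n -> 'rV[R]_n) (m : R)
    (hOmega : polyhedral_domain Omega)
    (hphi : U0 Omega phi)
    (hmin : is_minimum
       [set jacobian_det Omega (id \+ phi) x | x in closure Omega] m)
    (hm : 0 < m) :
  set_bij Omega Omega (id \+ phi).
Proof.
case: n Omega phi hOmega hphi hmin => [|n] Omega phi hOmega hphi hmin.
  (* In dimension 0 the space is a single point. *)
  have E x y : x = y :> 'rV[R]_0 by rewrite [LHS]thinmx0 [RHS]thinmx0.
  split=> [x Ox|x y _ _ _|y Oy]; [by rewrite (E (_ x) x)|exact: E|].
  by exists y => //; exact: E.
have [[_ _ [dphi [dphi_cts dphiE]]] _] := hphi; have [_ lO pO] := hOmega.
have [s ps sO] := polyhedron_planes (ltn0Sn n) pO.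
have T := @domain_chain R n Omega phi m hOmega hphi hmin hm dphi s dphi_cts
  dphiE ps sO.
apply: (bijective_on lO T); exact: (det_pos hphi hmin hm dphi_cts dphiE).
Qed.
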